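(* Let $k$ be an algebraically closed field of characteristic $p\neq 3$. Then for all but finitely many $j$-invariants $j\in k$, the corresponding elliptic curve $E$ over $k$ (the elliptic curve with $j$-invariant $j$) admits a finite generically étale map $E\to\mathbb{P}^1_k$ with only triple ramification.
   Context: For a finite generically étale morphism $h:C\to D$ of proper smooth curves over a field, the ramification points are the closed points of $C$ at which $h$ is not étale; the ramification index at a rational point $c\in C$ is the length of the Artin ring $\mathcal{O}_{C,c}/\mathfrak{m}_{D,h(c)}\mathcal{O}_{C,c}$. One says that $h$ has only triple ramification if all ramification points are rational and have ramification index $3$. *)

(* Defs.v *)
From HB Require Import structures.
From mathcomp Require Import all_boot all_order all_algebra.
From mathcomp Require Import boolp classical_sets.
From mathcomp Require Import mpoly.

Set Implicit Arguments.
Unset Strict Implicit.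
Unset Printing Implicit Defensive.

Import GRing.Theory.

Local Open Scope classical_set_scope.
Local Open Scope ring_scope.

(* Curves and morphisms are taken in the language of classical varieties over
   an algebraically closed field k: a variety is a locally closed subset of
   some P^n(k), its points are the closed points of the corresponding scheme
   (all of them rational, with residue field k), and its structure sheaf is
   the sheaf of k-valued regular functions.  Functions and maps are total on
   projective space; only their values on the variety at hand matter. *)

(* P^n(k): the lines of k^(n+1). *)
Definition projsp (k : fieldType) (n : nat) :=
  {L : {vspace 'rV[k]_n.+1} | \dim L == 1%N}.

(* Homogeneous coordinates are those of a chosen nonzero vector of the line;
   vanishing of a homogeneous polynomial and quotients of homogeneous
   polynomials of the same degree do not depend on the choice. *)
Definition hcoord (k : fieldType) (n : nat) (P : projsp k n) :
  'I_n.+1 -> k := fun i => vpick (val P) 0 i.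

Definition hval (k : fieldType) (n : nat) (F : {mpoly k[n.+1]})
  (P : projsp k n) : k := F.@[hcoord P].

Section Varieties.
Variable k : fieldType.

Definition zariski_closed n (Z : set (projsp k n)) : Prop :=
  exists T : set {mpoly k[n.+1]},
    (forall F, T F -> exists d : nat, F \is d.-homog) /\
    Z = [set P | forall F, T F -> hval F P = 0].

Definition open_in n (X U : set (projsp k n)) : Prop :=
  exists2 Z, zariski_closed Z & U = X `\` Z.

Definition locally_closed n (X : set (projsp k n)) : Prop :=
  exists2 Z, zariski_closed Z & open_in Z X.

Definition regular_at n (X : set (projsp k n)) (P : projsp k n)
    (f : projsp k n -> k) : Prop :=
  exists (U : set (projsp k n)) (d : nat) (g h : {mpoly k[n.+1]}),
    [/\ open_in X U, U P, g \is d.-homog, h \is d.-homog &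
        forall Q, U Q -> hval h Q != 0 /\ f Q = hval g Q / hval h Q].

Definition regular_on n (U : set (projsp k n)) (f : projsp k n -> k) : Prop :=
  forall P, U P -> regular_at U P f.

Definition is_morphism n m (X : set (projsp k n)) (Y : set (projsp k m))
    (h : projsp k n -> projsp k m) : Prop :=
  [/\ forall P, X P -> Y (h P),
      forall V, open_in Y V -> open_in X (X `&` h @^-1` V) &
      forall V f, open_in Y V -> regular_on V f ->
        regular_on (X `&` h @^-1` V) (f \o h)].

Definition isomorphic n m (X : set (projsp k n)) (Y : set (projsp k m)) :
    Prop :=
  exists (h : projsp k n -> projsp k m) (h' : projsp k m -> projsp k n),
    [/\ is_morphism X Y h, is_morphism Y X h',
        forall P, X P -> h' (h P) = P & forall Q, Y Q -> h (h' Q) = Q].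

(* A^n, embedded in P^n as the complement of the hyperplane X_0 = 0. *)
Definition affine_space n : set (projsp k n) :=
  [set P | hcoord P ord0 != 0].

Definition affine n (X : set (projsp k n)) : Prop :=
  locally_closed X /\
  exists m (Z : set (projsp k m)),
    zariski_closed Z /\ isomorphic X (Z `&` @affine_space m).

(* The ring of regular functions on h^-1(V) is a finitely generated module
   over the ring of regular functions on V. *)
Definition finite_over n m (U : set (projsp k n)) (V : set (projsp k m))
    (h : projsp k n -> projsp k m) : Prop :=
  exists (N : nat) (b : 'I_N -> projsp k n -> k),
    (forall i, regular_on U (b i)) /\
    forall f, regular_on U f ->
      exists2 a : 'I_N -> projsp k m -> k, forall i, regular_on V (a i) &
        forall P, U P -> f P = \sum_(i < N) a i (h P) * b i P.

Definition finite_morphism n m (X : set (projsp k n)) (Y : set (projsp k m))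
    (h : projsp k n -> projsp k m) : Prop :=
  is_morphism X Y h /\
  forall Q, Y Q -> exists V : set (projsp k m),
    [/\ open_in Y V, V Q, affine V, affine (X `&` h @^-1` V) &
        finite_over (X `&` h @^-1` V) V h].

(* The local ring O_{X,P} is the ring of functions regular at P, modulo
   equality of germs. *)
Definition germ_eq n (X : set (projsp k n)) (P : projsp k n)
    (f g : projsp k n -> k) : Prop :=
  exists U, [/\ open_in X U, U P & forall Q, U Q -> f Q = g Q].

(* An ideal of O_{X,P} is given by the set of all functions whose germ
   belongs to it. *)
Record is_ideal n (X : set (projsp k n)) (P : projsp k n)
    (I : set (projsp k n -> k)) : Prop := IsIdeal {
  ideal_regular : forall f, I f -> regular_at X P f;
  ideal_germ : forall f g, germ_eq X P f g -> I f -> I g;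
  ideal_0 : I (fun=> 0);
  ideal_D : forall f g, I f -> I g -> I (fun Q => f Q + g Q);
  ideal_M : forall f g, regular_at X P f -> I g -> I (fun Q => f Q * g Q) }.

Definition max_ideal n (X : set (projsp k n)) (P : projsp k n) :
    set (projsp k n -> k) :=
  [set f | regular_at X P f /\ f P = 0].

(* m_{Y,h(P)} O_{X,P} *)
Definition extended_ideal n m (X : set (projsp k n)) (Y : set (projsp k m))
    (h : projsp k n -> projsp k m) (P : projsp k n) :
    set (projsp k n -> k) :=
  [set f | forall I, is_ideal X P I ->
     (forall a, max_ideal Y (h P) a -> I (a \o h)) -> I f].

(* The length of the O_{X,P}-module O_{X,P} / J is the supremum of the
   lengths of the strictly increasing chains of its submodules, that is, of
   the ideals containing J. *)
Definition ideal_chain n (X : set (projsp k n)) (P : projsp k n)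
    (J : set (projsp k n -> k)) (l : nat)
    (I : nat -> set (projsp k n -> k)) : Prop :=
  (forall i, (i <= l)%N -> is_ideal X P (I i) /\ J `<=` I i) /\
  (forall i, (i < l)%N -> I i `<` I i.+1).

Definition quotient_length n (X : set (projsp k n)) (P : projsp k n)
    (J : set (projsp k n -> k)) (l : nat) : Prop :=
  (exists I, ideal_chain X P J l I) /\
  (forall l' I, ideal_chain X P J l' I -> (l' <= l)%N).

Definition ramification_index n m (X : set (projsp k n))
    (Y : set (projsp k m)) (h : projsp k n -> projsp k m) (P : projsp k n)
    (e : nat) : Prop :=
  quotient_length X P (extended_ideal X Y h P) e.

(* Flatness of O_{X,P} over O_{Y,h(P)}: every O_{Y,h(P)}-linear relation in
   O_{X,P} is a consequence of relations in O_{Y,h(P)} (the equational form of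
   the injectivity of I (x) O_{X,P} -> O_{X,P} for all finitely generated
   ideals I of O_{Y,h(P)}). *)
Definition flat_at n m (X : set (projsp k n)) (Y : set (projsp k m))
    (h : projsp k n -> projsp k m) (P : projsp k n) : Prop :=
  forall (r : nat) (a : 'I_r -> projsp k m -> k) (x : 'I_r -> projsp k n -> k),
    (forall i, regular_at Y (h P) (a i)) ->
    (forall i, regular_at X P (x i)) ->
    germ_eq X P (fun Q => \sum_(i < r) a i (h Q) * x i Q) (fun=> 0) ->
    exists (s : nat) (b : 'I_r -> 'I_s -> projsp k m -> k)
           (y : 'I_s -> projsp k n -> k),
      [/\ forall i j, regular_at Y (h P) (b i j),
          forall j, regular_at X P (y j),
          forall i, germ_eq X P (x i)
                      (fun Q => \sum_(j < s) b i j (h Q) * y j Q) &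
          forall j, germ_eq Y (h P)
                      (fun Q => \sum_(i < r) a i Q * b i j Q) (fun=> 0)].

(* There is no condition on residue fields: they are all equal to k. *)
Definition unramified_at n m (X : set (projsp k n)) (Y : set (projsp k m))
    (h : projsp k n -> projsp k m) (P : projsp k n) : Prop :=
  extended_ideal X Y h P = max_ideal X P.

Definition etale_at n m (X : set (projsp k n)) (Y : set (projsp k m))
    (h : projsp k n -> projsp k m) (P : projsp k n) : Prop :=
  flat_at X Y h P /\ unramified_at X Y h P.

Definition generically_etale n m (X : set (projsp k n))
    (Y : set (projsp k m)) (h : projsp k n -> projsp k m) : Prop :=
  exists U, [/\ open_in X U,
    forall V, open_in X V -> V !=set0 -> (U `&` V) !=set0 &
    forall P, U P -> etale_at X Y h P].

Definition ramification_point n m (X : set (projsp k n))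
    (Y : set (projsp k m)) (h : projsp k n -> projsp k m) (P : projsp k n) :
    Prop := X P /\ ~ etale_at X Y h P.

Definition only_triple_ramification n m (X : set (projsp k n))
    (Y : set (projsp k m)) (h : projsp k n -> projsp k m) : Prop :=
  forall P, ramification_point X Y h P -> ramification_index X Y h P 3.

End Varieties.

Record weierstrass (k : fieldType) := Weierstrass
  { wa1 : k; wa2 : k; wa3 : k; wa4 : k; wa6 : k }.

Section Weierstrass.
Variables (k : fieldType) (W : weierstrass k).
Let a1 := wa1 W.
Let a2 := wa2 W.
Let a3 := wa3 W.
Let a4 := wa4 W.
Let a6 := wa6 W.

Definition wb2 : k := a1 ^+ 2 + 4 * a2.
Definition wb4 : k := 2 * a4 + a1 * a3.
Definition wb6 : k := a3 ^+ 2 + 4 * a6.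
Definition wb8 : k :=
  a1 ^+ 2 * a6 + 4 * a2 * a6 - a1 * a3 * a4 + a2 * a3 ^+ 2 - a4 ^+ 2.
Definition wc4 : k := wb2 ^+ 2 - 24 * wb4.
Definition wdisc : k :=
  - wb2 ^+ 2 * wb8 - 8 * wb4 ^+ 3 - 27 * wb6 ^+ 2 + 9 * wb2 * wb4 * wb6.

Definition wcurve : set (projsp k 2) :=
  [set P | let x := hcoord P (inord 0) in
           let y := hcoord P (inord 1) in
           let z := hcoord P (inord 2) in
           y ^+ 2 * z + a1 * x * y * z + a3 * y * z ^+ 2
           = x ^+ 3 + a2 * x ^+ 2 * z + a4 * x * z ^+ 2 + a6 * z ^+ 3].

End Weierstrass.

(* Every elliptic curve has a Weierstrass equation with nonzero discriminant,
   in every characteristic, and the j-invariant is read off from it. *)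
Record elliptic_curve (k : fieldType) := EllipticCurve
  { ec_eqn : weierstrass k; ec_smooth : wdisc ec_eqn != 0 }.

Definition ec_curve (k : fieldType) (E : elliptic_curve k) :
  set (projsp k 2) := wcurve (ec_eqn E).

Definition j_invariant (k : fieldType) (E : elliptic_curve k) : k :=
  wc4 (ec_eqn E) ^+ 3 / wdisc (ec_eqn E).

Definition proj_line (k : fieldType) : set (projsp k 1) := setT.
Arguments proj_line k : clear implicits.

(* Main.v *)
Require Import Defs.
From mathcomp Require Import all_boot all_order all_algebra.
From mathcomp Require Import boolp classical_sets.
From mathcomp Require Import mpoly.
From mathcomp Require Import ring zify.

(** An elliptic curve with j <> 0 carries a rational function f of degree 4 whose
    differential has four double zeros and no other zeros; by Riemann-Hurwitz
    this is the only way for a map of degree 4 to have only triple ramification.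
    The function is a root of T^2 - c1 T - g(x), where g = M / D has degree 4 on
    the x-line, so that everything can be read off from polynomials in x.

    - If 2 is invertible, let w = 2 y + a1 x + a3, with square a cubic D(x), and
      f = Q(x) / w with Q monic quadratic. The zeros of df are those of
      2 Q' D - Q D', which has degree 4, and Q must be such that this is the
      square of a quadratic polynomial, up to a constant: each of its roots is
      the abscissa of two triple points. Comparing coefficients, one can solve
      for Q as soon as a quartic polynomial has a suitable root
      ([covering_parameters]). The condition c4 <> 0 makes Q separable and prime
      to D.
    - In characteristic 2, the condition c4 <> 0 means a1 <> 0, and the equation
      can be brought to the form y^2 + a x y = x^3 + rho^2 x with
      rho = beta^2 + a beta ([even_normal_form]). The function
      f = y / (a x) + beta^2 / (x + rho) is a root of T^2 - T - M / D, and
      M' D - M D' is the square of a (x + rho) (x^2 + a beta x + rho^2): the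
      roots of the last factor are the abscissas of the triple points.

    The passage from polynomials to geometry is the same in both cases. The local
    rings of the curve are discrete valuation rings ([dvr_wcurve]): at a smooth
    point x or y gives a parameter, and a function has finite order because its
    norm to k(x) has. Hence f, like every rational function, extends to a
    morphism to the projective line ([rational_map_morphism]). When the pullback
    of a parameter has order e, the ideal that it generates is the e-th power of
    the maximal ideal, whose powers are the only ideals above it. So e is the
    ramification index ([ramification_order]), and the map is etale if e = 1
    ([etale_order1]). The order of f - f(P) is that of g - g(P), or half of it
    where T^2 - c1 T - g(P) has a double root; at the poles of f it is half of
    the order of 1 / g.

    For finiteness, let c be a noncritical value of g. The complement V of the
    values of f over g = c is a principal open subset of the projective line,
    and so is its preimage in the curve, which leaves out the fibre of g over c;
    such subsets are affine ([affine_principal]). As a module over the functions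
    on V, the functions on the preimage are filtered by the order of their poles
    at the points left out. Multiplication by 1 / (g - c), a function on V,
    raises this order by one, and the filtration starts with the constants
    ([regular_cst]). The leading coefficients lie in a fixed finite-dimensional
    space, so finitely many functions generate ([finite_by_poles]). The sets V
    for varying c cover the projective line. *)

Set Implicit Arguments.
Unset Strict Implicit.
Unset Printing Implicit Defensive.

Import GRing.Theory.

Local Open Scope classical_set_scope.
Local Open Scope ring_scope.

(** * Forms and points of projective space *)

Section Forms.
Variables (k : fieldType) (n : nat).
Implicit Types (d e : nat) (phi psi : ('I_n.+1 -> k) -> k).

(** Forms are handled through the functions they induce on coordinate
    vectors, so that identities between them are proved by computing with
    values. *)
Definition isform d phi : Prop :=
  exists2 F : {mpoly k[n.+1]}, F \is d.-homog & forall v, F.@[v] = phi v.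

Lemma form_mpoly d (F : {mpoly k[n.+1]}) :
  F \is d.-homog -> isform d (fun v => F.@[v]).
Proof. by move=> hF; exists F. Qed.

Lemma form_ext d phi psi : phi =1 psi -> isform d phi -> isform d psi.
Proof. by move=> e [F hF Fv]; exists F => // v; rewrite Fv e. Qed.

Lemma form_cst c : isform 0 (fun=> c).
Proof.
exists (c%:MP) => [|v]; last by rewrite mevalC.
by rewrite -(mulr1 c%:MP) mul_mpolyC; apply/dhomogZ/dhomog1.
Qed.

Lemma form_zero d : isform d (fun=> 0).
Proof. by exists 0 => [|v]; [exact: dhomog0 | rewrite meval0]. Qed.

Lemma form_var i : isform 1 (fun v => v i).
Proof.
exists 'X_i => [|v]; last by rewrite mevalXU.
by rewrite dhomogX; apply/eqP; exact: mdeg1.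
Qed.

Lemma form_add d phi psi :
  isform d phi -> isform d psi -> isform d (fun v => phi v + psi v).
Proof.
move=> [F hF Fv] [G hG Gv]; exists (F + G) => [|v]; first exact: dhomogD.
by rewrite mevalD Fv Gv.
Qed.

Lemma form_scale d c phi : isform d phi -> isform d (fun v => c * phi v).
Proof.
move=> [F hF Fv]; exists (c *: F) => [|v]; first exact: dhomogZ.
by rewrite mevalZ Fv.
Qed.

Lemma form_opp d phi : isform d phi -> isform d (fun v => - phi v).
Proof. by move/(form_scale (-1)); apply: form_ext => v; rewrite mulN1r. Qed.

Lemma form_sub d phi psi :
  isform d phi -> isform d psi -> isform d (fun v => phi v - psi v).
Proof. by move=> hp /form_opp; exact: form_add. Qed.

Lemma form_mul d e phi psi :
  isform d phi -> isform e psi -> isform (d + e) (fun v => phi v * psi v).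
Proof.
move=> [F hF Fv] [G hG Gv]; exists (F * G) => [|v]; first exact: dhomogM.
by rewrite mevalM Fv Gv.
Qed.

Lemma form_exp d phi m : isform d phi -> isform (d * m) (fun v => phi v ^+ m).
Proof.
move=> hp; elim: m => [|m IH].
  by rewrite muln0; apply: form_ext (form_cst 1) => v; rewrite expr0.
by rewrite mulnS; apply: form_ext (form_mul hp IH) => v; rewrite exprS.
Qed.

Lemma form_varX i d : isform d (fun v => v i ^+ d).
Proof. by have := form_exp d (form_var i); rewrite mul1n. Qed.

Lemma form_sum d (I : Type) (r : seq I) (F : I -> ('I_n.+1 -> k) -> k) :
  (forall i, isform d (F i)) -> isform d (fun v => \sum_(i <- r) F i v).
Proof.
move=> hF; elim: r => [|i r IH].
  by apply: form_ext (form_zero d) => v; rewrite big_nil.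
by apply: form_ext (form_add (hF i) IH) => v; rewrite big_cons.
Qed.

(** Every form is built from constants by multiplications by coordinates and
    by sums; this replaces the manipulation of monomials. *)
Lemma form_ind (Q : nat -> (('I_n.+1 -> k) -> k) -> Prop) :
  (forall c, Q 0 (fun=> c)) ->
  (forall d, Q d (fun=> 0)) ->
  (forall d i phi, isform d phi -> Q d phi -> Q d.+1 (fun v => v i * phi v)) ->
  (forall d phi psi, isform d phi -> isform d psi ->
     Q d phi -> Q d psi -> Q d (fun v => phi v + psi v)) ->
  forall d phi, isform d phi -> Q d phi.
Proof.
move=> Qc Q0 QX QD d phi [F hF Fv].
have mono : forall d c (m : 'X_{1..n.+1}), mdeg m = d ->
    isform d (fun v => c * 'X_[m].@[v]) /\ Q d (fun v => c * 'X_[m].@[v]).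
  elim=> [|e IH] c m hm.
    have -> : (fun v : 'I_n.+1 -> k => c * 'X_[m].@[v]) = fun=> c.
      apply/funext => v; move/eqP: hm; rewrite mdeg_eq0 => /eqP ->.
      by rewrite mpolyX0 meval1 mulr1.
    by split; [exact: form_cst | exact: Qc].
  have [i hi] : exists i, (0 < m i)%N.
    apply/existsP; apply: contraT; rewrite negb_exists => /forallP h.
    have : mdeg m = 0%N by rewrite mdegE big1 // => i _; move: (h i); case: (m i).
    by rewrite hm.
  have em : m = (U_(i) + (m - U_(i)))%MM.
    rewrite addmC submK //; apply/mnm_lepP => j; rewrite mnm1E.
    by case: eqP => // <-.
  have hm' : mdeg (m - U_(i))%MM = e.
    by move: hm; rewrite {1}em mdegD mdeg1 add1n => -[].
  have [f1 q1] := IH c _ hm'.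
  have -> : (fun v => c * 'X_[m].@[v]) =
            (fun v => v i * (c * 'X_[m - U_(i)].@[v])).
    apply/funext => v.
    by rewrite {1}em mpolyXD mevalM mevalXU mulrCA.
  split; last exact: QX.
  by rewrite -add1n; apply: form_mul f1; exact: form_var.
have -> : phi = fun v => \sum_(m <- msupp F) F@_m * 'X_[m].@[v].
  apply/funext => v; rewrite -Fv {1}(mpolyE F) raddf_sum /=.
  by apply: eq_bigr => m _; rewrite mevalZ.
move/dhomogP: hF => /= hF.
suff : isform d (fun v => \sum_(m <- msupp F) F@_m * 'X_[m].@[v]) /\
  Q d (fun v => \sum_(m <- msupp F) F@_m * 'X_[m].@[v]) by case.
elim: (msupp F) hF => [_|m s IH hF].
  have -> : (fun v => \sum_(m <- [::]) F@_m * 'X_[m].@[v]) = fun=> 0.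
    by apply/funext => v; rewrite big_nil.
  by split; [exact: form_zero | exact: Q0].
have -> : (fun v => \sum_(j <- m :: s) F@_j * 'X_[j].@[v]) =
  (fun v => F@_m * 'X_[m].@[v] + \sum_(j <- s) F@_j * 'X_[j].@[v]).
  by apply/funext => v; rewrite big_cons.
have [f1 q1] := mono d (F@_m) m (hF _ (mem_head _ _)).
have [|f2 q2] := IH; first by move=> j hj; apply: hF; rewrite inE hj orbT.
by split; [exact: form_add | exact: QD].
Qed.

Lemma form_homog d phi : isform d phi ->
  forall c v, phi (fun i => c * v i) = c ^+ d * phi v.
Proof.
apply: (form_ind (Q := fun d phi => forall c v, _ = c ^+ d * phi v)).
- by move=> c a v; rewrite expr0 mul1r.
- by move=> e a v; rewrite mulr0.
- by move=> e i f _ IH a v; rewrite IH exprS; ring.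
- by move=> e f g _ _ IHf IHg a v; rewrite IHf IHg mulrDr.
Qed.

End Forms.

Lemma form_comp (k : fieldType) n m d e (phi : ('I_n.+1 -> k) -> k)
    (psi : 'I_n.+1 -> ('I_m.+1 -> k) -> k) :
  isform d phi -> (forall i, isform e (psi i)) ->
  isform (d * e) (fun v => phi (fun i => psi i v)).
Proof.
move=> hp hpsi; move: d phi hp.
apply: (form_ind (Q := fun d phi => isform (d * e) (fun v => phi (fun i => psi i v)))).
- by move=> c; exact: form_cst.
- by move=> d; exact: form_zero.
- by move=> d i f _ IH; rewrite mulSn; exact: form_mul.
- by move=> d f g _ _; exact: form_add.
Qed.

Section Points.
Variables (k : fieldType) (n : nat).
Implicit Types (P Q : projsp k n) (v w : 'I_n.+1 -> k).

Lemma hcoord_neq0 P : exists i, hcoord P i != 0.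
Proof.
apply/existsP; apply: contraT; rewrite negb_exists => /forallP h.
have : vpick (val P) = 0.
  by apply/rowP => i; rewrite mxE; move: (h i); rewrite negbK => /eqP.
move/eqP; rewrite vpick0 => /eqP L0.
by have := valP P; rewrite /= L0 dimv0.
Qed.

Lemma line_subproof (v : 'rV[k]_n.+1) : v != 0 -> \dim <[v]>%VS == 1%N.
Proof. by rewrite dim_vline => ->. Qed.

Lemma pt0_subproof : \dim <[(const_mx 1 : 'rV[k]_n.+1)]>%VS == 1%N.
Proof.
apply: line_subproof; apply/eqP => /rowP /(_ ord0); rewrite !mxE => /eqP.
by rewrite oner_eq0.
Qed.

(** The value at the zero vector is a junk value. *)
Definition pt v : projsp k n :=
  insubd (exist (fun L : {vspace 'rV[k]_n.+1} => \dim L == 1%N) _ pt0_subproof)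
    <[\row_i v i]>%VS.

Lemma val_pt v : (exists i, v i != 0) -> val (pt v) = <[\row_i v i]>%VS.
Proof.
move=> [i vi]; rewrite val_insubd line_subproof //.
by apply: contra vi => /eqP /rowP /(_ i); rewrite !mxE => ->.
Qed.

Lemma hcoord_pt v : (exists i, v i != 0) ->
  exists2 c, c != 0 & hcoord (pt v) = fun i => c * v i.
Proof.
move=> hv; have := memv_pick (val (pt v)); rewrite [in X in _ \in X](val_pt hv).
move=> /vlineP [c hc]; exists c; last first.
  by apply/funext => i; rewrite /hcoord hc !mxE.
have [i] := hcoord_neq0 (pt v); rewrite /hcoord hc !mxE.
by apply: contraNneq => ->; rewrite mul0r.
Qed.

Lemma pt_eq P v c : c != 0 -> (forall i, v i = c * hcoord P i) -> pt v = P.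
Proof.
move=> c0 hv; apply: val_inj.
have [i Pi] := hcoord_neq0 P.
rewrite val_pt; last by exists i; rewrite hv mulf_neq0.
have -> : \row_i v i = c *: vpick (val P).
  by apply/rowP => j; rewrite !mxE hv.
apply/eqP; rewrite eqEdim; apply/andP; split.
  by rewrite -memvE memvZ // memv_pick.
rewrite dim_vline (eqP (valP P)) scaler_eq0 negb_or c0 /= vpick0.
by rewrite -dimv_eq0 (eqP (valP P)).
Qed.

Lemma pt_hcoord P : pt (hcoord P) = P.
Proof. by apply: (pt_eq (oner_neq0 k)) => i; rewrite mul1r. Qed.

Lemma pt_scale v c : (exists i, v i != 0) -> c != 0 ->
  pt (fun i => c * v i) = pt v.
Proof.
move=> hv c0; have [a a0 ha] := hcoord_pt hv.
apply: (pt_eq (c := c / a)); first by rewrite mulf_neq0 ?invr_eq0.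
by move=> i; rewrite ha mulrA divfK.
Qed.

Lemma form_pt d phi v : isform d phi -> (exists i, v i != 0) ->
  exists2 c, c != 0 & phi (hcoord (pt v)) = c ^+ d * phi v.
Proof.
by move=> hp /hcoord_pt [c c0 ->]; exists c => //; rewrite (form_homog hp).
Qed.

Lemma form_pt_neq0 d phi v : isform d phi -> (exists i, v i != 0) ->
  (phi (hcoord (pt v)) != 0) = (phi v != 0).
Proof.
by move=> hp /(form_pt hp) [c c0 ->]; rewrite mulf_eq0 expf_eq0 (negPf c0) andbF.
Qed.

End Points.

(** * Neighbourhoods and regular functions *)

Section Local.
Variables (k : fieldType) (n : nat).
Implicit Types (X U : set (projsp k n)) (P Q : projsp k n) (A B : set (projsp k n)).
Implicit Types (f g : projsp k n -> k).

(** The complements of hypersurfaces are a basis of the topology. *)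
Definition near X P A : Prop := X P /\
  exists d phi, [/\ isform d phi, phi (hcoord P) != 0 &
    forall Q, X Q -> phi (hcoord Q) != 0 -> A Q].

Lemma near_mem X P A : near X P A -> X P. Proof. by case. Qed.

Lemma near_pt X P A : near X P A -> A P.
Proof. by case=> XP [d [phi [_ h]]]; apply. Qed.

Lemma near_form X P d phi : X P -> isform d phi -> phi (hcoord P) != 0 ->
  near X P (fun Q => phi (hcoord Q) != 0).
Proof. by move=> XP h1 h2; split=> //; exists d, phi. Qed.

Lemma near_sub X P A B :
  (forall Q, X Q -> A Q -> B Q) -> near X P A -> near X P B.
Proof.
move=> AB [XP [d [phi [h1 h2 h3]]]]; split=> //; exists d, phi; split=> // Q XQ h.
exact/AB/h3.
Qed.

Lemma near_all X P A : X P -> (forall Q, X Q -> A Q) -> near X P A.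
Proof.
move=> XP h; split=> //; exists 0%N, (fun=> 1); split; first exact: form_cst.
  exact: oner_neq0.
by move=> Q XQ _; exact: h.
Qed.

Lemma near_and X P A B : near X P A -> near X P B ->
  near X P (fun Q => A Q /\ B Q).
Proof.
move=> [XP [d [phi [h1 h2 h3]]]] [_ [e [psi [g1 g2 g3]]]]; split=> //.
exists (d + e)%N, (fun v => phi v * psi v); split; first exact: form_mul.
  by rewrite mulf_neq0.
move=> Q XQ; rewrite mulf_eq0 negb_or => /andP [a b].
by split; [apply: h3 | apply: g3].
Qed.

Lemma near_map2 X P A B C : (forall Q, X Q -> A Q -> B Q -> C Q) ->
  near X P A -> near X P B -> near X P C.
Proof.
by move=> h a b; apply: near_sub (near_and a b) => Q XQ []; exact: h.
Qed.

Lemma near_near X P A : near X P A -> near X P (fun Q => near X Q A).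
Proof.
move=> [XP [d [phi [h1 h2 h3]]]]; split=> //; exists d, phi; split=> // Q XQ hQ.
by split=> //; exists d, phi.
Qed.

Lemma open_inP X U : open_in X U <->
  U `<=` X /\ forall P, U P -> near X P U.
Proof.
split.
  case=> Z [T [hT ->]] ->; split=> [P [] //|P [XP /= nP]]; split=> //.
  have [F TF FP] : exists2 F, T F & hval F P != 0.
    apply/not_exists2P => h; apply: nP => F TF.
    by case: (h F) => // /negP; rewrite negbK => /eqP.
  have [d hF] := hT _ TF; exists d, (fun v => F.@[v]); split=> //.
    exact: form_mpoly.
  move=> Q XQ hQ; split=> //= h; move/negP: hQ; apply; apply/eqP; exact: h.
case=> UX hU.
pose T := [set F : {mpoly k[n.+1]} | (exists d, F \is d.-homog) /\
             forall Q, X Q -> ~ U Q -> hval F Q = 0].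
exists [set P | forall F, T F -> hval F P = 0]; first by exists T; split=> // F [].
apply/seteqP; split=> [P UP|P [XP /= nP]].
  split; first exact: UX.
  have [XP [d [phi [[F hF Fv] h2 h3]]]] := hU _ UP.
  move=> h; move: h2; rewrite -Fv => /negP; apply; apply/eqP.
  apply: (h F); split; first by exists d.
  move=> Q XQ nU; apply/eqP; apply: contraT => hQ; case: nU; apply: h3 => //.
  by rewrite -Fv.
by apply: contrapT => nU; apply: nP => F [_]; exact.
Qed.

Lemma open_near X U P : open_in X U -> U P -> near X P U.
Proof. by move=> /open_inP [_]; exact. Qed.

Lemma open_sub X U P : open_in X U -> U P -> X P.
Proof. by move=> /open_inP [h _]; exact: h. Qed.

Lemma near_open X P A : near X P A ->
  exists U, [/\ open_in X U, U P & forall Q, U Q -> A Q].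
Proof.
move=> [XP [d [phi [h1 h2 h3]]]].
exists [set Q | X Q /\ phi (hcoord Q) != 0]; split=> //.
  apply/open_inP; split=> [Q [] //|Q [XQ hQ]]; split=> //.
  by exists d, phi.
by move=> Q [XQ hQ]; exact: h3.
Qed.

Lemma germ_eqP X P f g : germ_eq X P f g <-> near X P (fun Q => f Q = g Q).
Proof.
split; last by move/near_open => [U [h1 h2 h3]]; exists U.
move=> [U [h1 h2 h3]]; apply: near_sub (open_near h1 h2) => Q _; exact: h3.
Qed.

Lemma regularP X P f : regular_at X P f <-> exists d a b,
  [/\ isform d a, isform d b, b (hcoord P) != 0 &
      near X P (fun Q => f Q = a (hcoord Q) / b (hcoord Q))].
Proof.
split.
  move=> [U [d [g [h [h1 h2 h3 h4 h5]]]]].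
  exists d, (fun v => g.@[v]), (fun v => h.@[v]); split.
  - exact: form_mpoly.
  - exact: form_mpoly.
  - by case: (h5 _ h2).
  - by apply: near_sub (open_near h1 h2) => Q _ /h5 [].
move=> [d [g [h [hg hh hP nP]]]].
have [U [h1 h2 h3]] := near_open (near_and nP (near_form (near_mem nP) hh hP)).
case: hg => G G1 G2; case: hh => H H1 H2.
exists U, d, G, H; split=> // Q /h3 [e1 e2].
by rewrite /hval H2 G2.
Qed.

Lemma reg_mem X P f : regular_at X P f -> X P.
Proof. by move/regularP => [d [g [h [_ _ _ /near_mem]]]]. Qed.

Lemma reg_near X P f g : near X P (fun Q => f Q = g Q) ->
  regular_at X P f -> regular_at X P g.
Proof.
move=> e /regularP [d [a [b [h1 h2 h3 h4]]]]; apply/regularP.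
exists d, a, b; split=> //; apply: near_map2 e h4 => Q _ -> //.
Qed.

Lemma reg_form X P d a b : X P -> isform d a -> isform d b -> b (hcoord P) != 0 ->
  regular_at X P (fun Q => a (hcoord Q) / b (hcoord Q)).
Proof.
by move=> XP *; apply/regularP; exists d, a, b; split=> //; exact: near_all.
Qed.

Lemma reg_cst X P c : X P -> regular_at X P (fun=> c).
Proof.
move=> XP; have := reg_form XP (form_cst n c) (form_cst n 1) (oner_neq0 k).
by apply: reg_near; apply: near_all => // Q _; rewrite divr1.
Qed.

Lemma reg_add X P f g : regular_at X P f -> regular_at X P g ->
  regular_at X P (fun Q => f Q + g Q).
Proof.
move=> /regularP [d [a [b [h1 h2 h3 h4]]]] /regularP [e [a' [b' [g1 g2 g3 g4]]]].
apply/regularP; exists (d + e)%N, (fun v => a v * b' v + a' v * b v),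
  (fun v => b v * b' v); split.
- apply: form_add; first exact: form_mul.
  by rewrite addnC; apply: form_mul.
- exact: form_mul.
- by rewrite mulf_neq0.
have XP := near_mem h4.
have nz := near_and (near_form XP h2 h3) (near_form XP g2 g3).
apply: near_map2 nz (near_and h4 g4) => Q _ [n1 n2] [-> ->].
by field; rewrite n1 n2.
Qed.

Lemma reg_mul X P f g : regular_at X P f -> regular_at X P g ->
  regular_at X P (fun Q => f Q * g Q).
Proof.
move=> /regularP [d [a [b [h1 h2 h3 h4]]]] /regularP [e [a' [b' [g1 g2 g3 g4]]]].
apply/regularP; exists (d + e)%N, (fun v => a v * a' v),
  (fun v => b v * b' v); split.
- exact: form_mul.
- exact: form_mul.
- by rewrite mulf_neq0.
by apply: near_map2 h4 g4 => Q _ -> ->; rewrite mulf_div.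
Qed.

Lemma reg_opp X P f : regular_at X P f -> regular_at X P (fun Q => - f Q).
Proof.
move=> h; apply: reg_near (reg_mul (reg_cst (-1) (reg_mem h)) h).
by apply: near_all (reg_mem h) _ => Q _; rewrite mulN1r.
Qed.

Lemma reg_sub X P f g : regular_at X P f -> regular_at X P g ->
  regular_at X P (fun Q => f Q - g Q).
Proof. by move=> hf /reg_opp; exact: reg_add. Qed.

Lemma reg_exp X P f m : regular_at X P f -> regular_at X P (fun Q => f Q ^+ m).
Proof.
move=> h; elim: m => [|m IH]; first exact: reg_cst (reg_mem h).
apply: reg_near (reg_mul h IH).
by apply: near_all (reg_mem h) _ => Q _; rewrite exprS.
Qed.

Lemma reg_sum X P (I : Type) (r : seq I) (F : I -> projsp k n -> k) :
  X P -> (forall i, regular_at X P (F i)) ->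
  regular_at X P (fun Q => \sum_(i <- r) F i Q).
Proof.
move=> XP hF; elim: r => [|i r IH].
  apply: reg_near (reg_cst 0 XP).
  by apply: near_all XP _ => Q _; rewrite big_nil.
apply: reg_near (reg_add (hF i) IH).
by apply: near_all XP _ => Q _; rewrite big_cons.
Qed.

Lemma reg_horner X P f (p : {poly k}) :
  regular_at X P f -> regular_at X P (fun Q => p.[f Q]).
Proof.
move=> h; have XP := reg_mem h.
elim/poly_ind: p => [|p c IH].
  by apply: reg_near (reg_cst 0 XP); apply: near_all => // Q _; rewrite horner0.
apply: reg_near (reg_add (reg_mul IH h) (reg_cst c XP)).
by apply: near_all => // Q _; rewrite hornerMXaddC.
Qed.

Lemma reg_neq0 X P f : regular_at X P f -> f P != 0 ->
  near X P (fun Q => f Q != 0).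
Proof.
move=> /regularP [d [a [b [h1 h2 h3 h4]]]] fP; have XP := near_mem h4.
have aP : a (hcoord P) != 0.
  by move: fP; rewrite (near_pt h4); apply: contraNneq => ->; rewrite mul0r.
apply: near_map2 h4 (near_and (near_form XP h1 aP) (near_form XP h2 h3)).
by move=> Q _ -> [n1 n2]; rewrite mulf_neq0 ?invr_eq0.
Qed.

Lemma reg_inv X P f : regular_at X P f -> f P != 0 ->
  regular_at X P (fun Q => (f Q)^-1).
Proof.
move=> /regularP [d [a [b [h1 h2 h3 h4]]]] fP; have XP := near_mem h4.
have aP : a (hcoord P) != 0.
  by move: fP; rewrite (near_pt h4); apply: contraNneq => ->; rewrite mul0r.
apply/regularP; exists d, b, a; split=> //.
by apply: near_sub h4 => Q _ ->; rewrite invf_div.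
Qed.

Lemma reg_div X P f g : regular_at X P f -> regular_at X P g -> g P != 0 ->
  regular_at X P (fun Q => f Q / g Q).
Proof. by move=> hf hg /(reg_inv hg); exact: reg_mul. Qed.

Lemma reg_nbhd X P f : regular_at X P f -> near X P (fun Q => regular_at X Q f).
Proof.
move=> /regularP [d [a [b [h1 h2 h3 h4]]]]; have XP := near_mem h4.
apply: near_map2 (near_form XP h2 h3) (near_near h4) => Q XQ bQ nQ.
by apply/regularP; exists d, a, b.
Qed.

Lemma near_openE X U P A : open_in X U -> U P -> near U P A -> near X P A.
Proof.
move=> oU UP [_ [d [phi [h1 h2 h3]]]].
apply: near_map2 (open_near oU UP) (near_form (open_sub oU UP) h1 h2).
by move=> Q _; exact: h3.
Qed.

Lemma near_restrict X U P A : (forall Q, U Q -> X Q) -> U P ->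
  near X P A -> near U P A.
Proof.
move=> UX UP [_ [d [phi [h1 h2 h3]]]]; split=> //; exists d, phi; split=> //.
by move=> Q UQ; apply: h3; exact: UX.
Qed.

Lemma reg_openE X U P f : open_in X U -> U P ->
  regular_at U P f <-> regular_at X P f.
Proof.
move=> oU UP; split=> /regularP [d [a [b [h1 h2 h3 h4]]]]; apply/regularP.
  by exists d, a, b; split=> //; exact: near_openE oU UP h4.
exists d, a, b; split=> //; apply: near_restrict h4 => // Q.
exact: open_sub.
Qed.

Lemma closedP (S : set (('I_n.+1 -> k) -> k)) :
  (forall phi, S phi -> exists d, isform d phi) ->
  zariski_closed [set P : projsp k n | forall phi, S phi -> phi (hcoord P) = 0].
Proof.
move=> h; exists [set F : {mpoly k[n.+1]} | (exists d, F \is d.-homog) /\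
  S (fun v => F.@[v])]; split; first by move=> F [].
apply/seteqP; split=> [P hP F [_ SF]|P hP phi Sphi]; first exact: hP SF.
have [d [F F1 F2]] := h _ Sphi.
rewrite -F2; apply: hP; split; first by exists d.
by move: Sphi; congr S; apply/funext => v; rewrite F2.
Qed.

(** Truth off a hypersurface that does not contain X; when X is irreducible
    this is truth on a dense open subset. *)
Definition gen X A : Prop := exists d phi, [/\ isform d phi,
  exists2 Q, X Q & phi (hcoord Q) != 0 &
  forall Q, X Q -> phi (hcoord Q) != 0 -> A Q].

(** The homogeneous ideal of X is prime. *)
Definition irreducible X : Prop := forall d e phi psi, isform d phi -> isform e psi ->
  (forall Q, X Q -> phi (hcoord Q) * psi (hcoord Q) = 0) ->
  (forall Q, X Q -> phi (hcoord Q) = 0) \/ (forall Q, X Q -> psi (hcoord Q) = 0).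

Lemma near_gen X P A : near X P A -> gen X A.
Proof. by move=> [XP [d [phi [h1 h2 h3]]]]; exists d, phi; split=> //; exists P. Qed.

Lemma gen_sub X A B : (forall Q, X Q -> A Q -> B Q) -> gen X A -> gen X B.
Proof.
move=> AB [d [phi [h1 h2 h3]]]; exists d, phi; split=> // Q XQ h; exact/AB/h3.
Qed.

Lemma gen_ex X A : gen X A -> exists2 Q, X Q & A Q.
Proof. by move=> [d [phi [h1 [Q XQ hQ] h3]]]; exists Q => //; exact: h3. Qed.

Section Irreducible.
Variables (X : set (projsp k n)) (irrX : irreducible X).

Lemma gen_and A B : gen X A -> gen X B -> gen X (fun Q => A Q /\ B Q).
Proof.
move=> [d [phi [h1 [Q1 X1 n1] h3]]] [e [psi [g1 [Q2 X2 n2] g3]]].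
exists (d + e)%N, (fun v => phi v * psi v); split; first exact: form_mul.
  apply/not_exists2P => h.
  have [] := irrX h1 g1.
  - move=> Q XQ; apply/eqP; apply: contraT => nz.
    by case: (h Q) => // /negP; rewrite nz.
  - by move/(_ _ X1)/eqP; rewrite (negPf n1).
  - by move/(_ _ X2)/eqP; rewrite (negPf n2).
move=> Q XQ; rewrite mulf_eq0 negb_or => /andP [a b].
by split; [apply: h3 | apply: g3].
Qed.

Lemma gen_map2 A B C : (forall Q, X Q -> A Q -> B Q -> C Q) ->
  gen X A -> gen X B -> gen X C.
Proof.
by move=> h a b; apply: gen_sub (gen_and a b) => Q XQ []; exact: h.
Qed.

Lemma gen_form0 d phi : isform d phi -> gen X (fun Q => phi (hcoord Q) = 0) ->
  forall Q, X Q -> phi (hcoord Q) = 0.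
Proof.
move=> h [e [psi [g1 [Q1 X1 n1] g3]]].
have fg Q : X Q -> phi (hcoord Q) * psi (hcoord Q) = 0.
  case: (eqVneq (psi (hcoord Q)) 0) => [->|nz]; first by rewrite mulr0.
  by move=> XQ; rewrite g3 // mul0r.
by case: (irrX h g1 fg) => // /(_ _ X1)/eqP; rewrite (negPf n1).
Qed.

(** Regular functions are determined by their generic values. *)
Lemma gen_reg0 P f : regular_at X P f -> gen X (fun Q => f Q = 0) ->
  near X P (fun Q => f Q = 0).
Proof.
move=> /regularP [d [a [b [h1 h2 h3 h4]]]] f0; have XP := near_mem h4.
have a0 : forall Q, X Q -> a (hcoord Q) = 0.
  apply: gen_form0 h1 _.
  apply: gen_map2 f0 (near_gen (near_and h4 (near_form XP h2 h3))).
  move=> Q XQ -> [/esym/eqP]; rewrite mulf_eq0 invr_eq0 => /orP [/eqP //|].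
  by move=> e /negP.
by apply: near_sub h4 => Q XQ ->; rewrite a0 // mul0r.
Qed.

Lemma gen_reg P f g : regular_at X P f -> regular_at X P g ->
  gen X (fun Q => f Q = g Q) -> near X P (fun Q => f Q = g Q).
Proof.
move=> hf hg e.
have : near X P (fun Q => f Q - g Q = 0).
  apply: gen_reg0 (reg_sub hf hg) _.
  by apply: gen_sub e => Q _ ->; rewrite subrr.
by apply: near_sub => Q _ /eqP; rewrite subr_eq0 => /eqP.
Qed.

Lemma reg_gen_neq0 P f : regular_at X P f -> ~ near X P (fun Q => f Q = 0) ->
  gen X (fun Q => f Q != 0).
Proof.
move=> /regularP [d [a [b [h1 h2 h3 h4]]]] nf; have XP := near_mem h4.
have [Q XQ aQ] : exists2 Q, X Q & a (hcoord Q) != 0.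
  apply: contrapT => /forall2NP h; apply: nf.
  apply: near_sub h4 => Q XQ ->; case: (h Q) => // /negP.
  by rewrite negbK => /eqP ->; rewrite mul0r.
apply: gen_map2 (near_gen (near_and h4 (near_form XP h2 h3))) (near_gen (near_form XQ h1 aQ)).
by move=> R XR [-> b0] a0; rewrite mulf_neq0 ?invr_eq0.
Qed.

Lemma reg_domain P f g : regular_at X P f -> regular_at X P g ->
  near X P (fun Q => f Q * g Q = 0) ->
  ~ near X P (fun Q => f Q = 0) -> near X P (fun Q => g Q = 0).
Proof.
move=> hf hg fg nf; apply: gen_reg0 => //.
apply: gen_map2 (reg_gen_neq0 hf nf) (near_gen fg) => Q _ f0 /eqP.
by rewrite mulf_eq0 (negPf f0) => /eqP.
Qed.

Lemma reg_cancel P f g h : regular_at X P f -> regular_at X P g ->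
  regular_at X P h -> ~ near X P (fun Q => f Q = 0) ->
  near X P (fun Q => f Q * g Q = f Q * h Q) -> near X P (fun Q => g Q = h Q).
Proof.
move=> hf hg hh nf e.
have : near X P (fun Q => g Q - h Q = 0).
  apply: (reg_domain hf (reg_sub hg hh)) => //.
  by apply: near_sub e => Q _; rewrite mulrBr => ->; rewrite subrr.
by apply: near_sub => Q _ /eqP; rewrite subr_eq0 => /eqP.
Qed.

End Irreducible.
End Local.

(** * Morphisms *)

Section Morphisms.
Variables (k : fieldType) (n m : nat).
Variables (X : set (projsp k n)) (Y : set (projsp k m)).
Variable (h : projsp k n -> projsp k m).

(** The homogeneous coordinates of h are regular functions rather than forms, so
    that maps given by quotients of forms need no common denominator. *)
Definition local_coords (P : projsp k n) (phi : 'I_m.+1 -> projsp k n -> k) :=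
  [/\ forall i, regular_at X P (phi i), exists i, phi i P != 0 &
      near X P (fun Q => h Q = pt (fun i => phi i Q))].

Lemma reg_isform d a (phi : 'I_m.+1 -> projsp k n -> k) P : X P ->
  isform d a -> (forall i, regular_at X P (phi i)) ->
  regular_at X P (fun Q => a (fun i => phi i Q)).
Proof.
move=> XP ha hphi; move: d a ha.
apply: (form_ind (Q := fun _ a => regular_at X P (fun Q => a (fun i => phi i Q)))).
- by move=> c; exact: reg_cst.
- by move=> _; exact: reg_cst.
- by move=> d i a _; exact: reg_mul.
- by move=> d a b _ _; exact: reg_add.
Qed.

Lemma local_coords_nz P phi : X P -> local_coords P phi ->
  near X P (fun Q => exists i, phi i Q != 0).
Proof.
move=> XP [h1 [i hi] _]; apply: near_sub (reg_neq0 (h1 i) hi) => Q _ ?.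
by exists i.
Qed.

Lemma pull_near P phi A : X P -> local_coords P phi ->
  near Y (h P) A -> (forall Q, X Q -> Y (h Q)) -> near X P (fun Q => A (h Q)).
Proof.
move=> XP lc [_ [d [a [h1 h2 h3]]]] XY.
have nz := local_coords_nz XP lc; have [g1 g2 g3] := lc.
have hreg := reg_isform XP h1 g1.
have aP : a (fun i => phi i P) != 0.
  by move: h2; rewrite (near_pt g3) (form_pt_neq0 h1) //; exact: near_pt nz.
apply: near_map2 (near_and nz g3) (reg_neq0 hreg aP) => Q XQ [z e] aQ.
apply: h3; first exact: XY.
by rewrite e (form_pt_neq0 h1).
Qed.

Lemma pull_reg P phi f : X P -> local_coords P phi ->
  (forall Q, X Q -> Y (h Q)) ->
  regular_at Y (h P) f -> regular_at X P (f \o h).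
Proof.
move=> XP lc XY /regularP [d [a [b [h1 h2 h3 h4]]]].
have nz := local_coords_nz XP lc; have [g1 g2 g3] := lc.
have bP : b (fun i => phi i P) != 0.
  by move: h3; rewrite (near_pt g3) (form_pt_neq0 h2) //; exact: near_pt nz.
apply: reg_near (reg_div (reg_isform XP h1 g1) (reg_isform XP h2 g1) bP).
have := pull_near XP lc h4 XY.
apply: near_map2 (near_and nz g3) => Q XQ [z e] /= ->.
have [c c0 ec] := hcoord_pt z.
by rewrite e ec (form_homog h1) (form_homog h2) -mulf_div divff ?mul1r ?expf_neq0.
Qed.

Lemma local_morphism : (forall Q, X Q -> Y (h Q)) ->
  (forall P, X P -> exists phi, local_coords P phi) -> is_morphism X Y h.
Proof.
move=> XY lc.
have pre V : open_in Y V -> open_in X (X `&` h @^-1` V).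
  move=> oV; apply/open_inP; split=> [P [] //|P [XP VP]].
  have [phi hphi] := lc _ XP.
  have := pull_near XP hphi (open_near oV VP) XY.
  by apply: near_sub => Q XQ.
split=> // V f oV rf P [XP VP].
have [phi hphi] := lc _ XP.
apply/(reg_openE _ (pre V oV)) => //.
apply: pull_reg hphi XY _ => //.
by apply/(reg_openE _ oV) => //; exact: rf.
Qed.

End Morphisms.

(** * Principal open subsets are affine *)

Section AffinePrincipal.
Variables (k : fieldType) (n d : nat) (Z : set (projsp k n)).
Variable Hc : 'I_n.+1 -> ('I_n.+1 -> k) -> k.
Hypothesis clZ : zariski_closed Z.
Hypothesis formHc : forall i, isform d (Hc i).

Let H (v : 'I_n.+1 -> k) := \sum_i v i * Hc i v.
Let J := ('I_n.+1 + 'I_n.+1)%type.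
Let A (j : J) (v : 'I_n.+1 -> k) :=
  match j with inl i => v i ^+ d | inr i => Hc i v end.
Let IJ := ('I_n.+1 * J)%type.
Let m := #|{: IJ}|.
Let idx (i : 'I_n.+1) (j : J) : 'I_m.+1 := lift ord0 (enum_rank ((i, j) : IJ)).

(** The matrix of all x_i A_j is homogeneous of the degree of H, and its columns
   recover x: this embeds the complement of H = 0 as the matrices of rank one
   whose rows are proportional to (A_j)_j, normalised by H = 1. *)
Let nuv (v : 'I_n.+1 -> k) : 'I_m.+1 -> k := fun a =>
  if unlift ord0 a is Some b then
    let: (i, j) := (enum_val b : IJ) in v i * A j v
  else H v.

Let nuv0 v : nuv v ord0 = H v.
Proof. by rewrite /nuv unlift_none. Qed.

Let nuvM v i j : nuv v (idx i j) = v i * A j v.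
Proof. by rewrite /nuv /idx liftK enum_rankK. Qed.

Let idxP a : a = ord0 \/ exists i j, a = idx i j.
Proof.
case: (unliftP ord0 a) => [b ->|->]; last by left.
right; exists (enum_val b : IJ).1, (enum_val b : IJ).2.
by rewrite /idx -surjective_pairing enum_valK.
Qed.

Let formA j : isform d (A j).
Proof.
case: j => i; last exact: formHc.
by have := form_exp d (form_var k i); rewrite mul1n.
Qed.

Let formH : isform d.+1 H.
Proof.
apply: form_sum => i; rewrite -add1n; apply: form_mul => //; exact: form_var.
Qed.

Let form_nuv a : isform d.+1 (fun v => nuv v a).
Proof.
case: (idxP a) => [->|[i [j ->]]].
  by apply: form_ext formH => v; rewrite nuv0.
have := form_mul (form_var k i) (formA j); rewrite add1n.
by apply: form_ext => v; rewrite nuvM.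
Qed.

Let X := Z `&` [set P | H (hcoord P) != 0].

(** The equations of the image: the matrix has rank one, its rows are
    proportional to (A_j)_j, it is normalised by H = 1, and its columns are on
    the closed set Z. *)
Let Seq : set (('I_m.+1 -> k) -> k) := [set phi |
  [\/ exists i j i' j', phi = fun t =>
        t (idx i j) * t (idx i' j') - t (idx i j') * t (idx i' j),
      exists i j j' l, phi = fun t =>
        t (idx i j) * A j' (fun a => t (idx a l)) -
        t (idx i j') * A j (fun a => t (idx a l)),
      phi = (fun t => \sum_i t (idx i (inr i)) - t ord0) |
      exists e psi l, [/\ isform e psi,
        forall Q, Z Q -> psi (hcoord Q) = 0 &
        phi = fun t => psi (fun a => t (idx a l))]]].

Let Seq_form phi : Seq phi -> exists e, isform e phi.
Proof.
have fv := @form_var k m.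
have fc e (psi : ('I_n.+1 -> k) -> k) l :
    isform e psi -> isform e (fun t : 'I_m.+1 -> k => psi (fun a => t (idx a l))).
  by move=> h; have := form_comp h (fun i => fv (idx i l)); rewrite muln1.
case=> [[i [j [i' [j' ->]]]]|[i [j [j' [l ->]]]]|->|[e [psi [l [h _ ->]]]]].
- by exists 2; apply: form_sub; apply: (form_mul (d := 1) (e := 1)).
- exists (1 + d)%N; apply: form_sub; apply: form_mul => //; apply: fc; exact: formA.
- by exists 1%N; apply: form_sub => //; apply: form_sum => i.
- by exists e; exact: fc.
Qed.

Let Z' : set (projsp k m) := [set t | forall phi, Seq phi -> phi (hcoord t) = 0].

Let clZ' : zariski_closed Z'. Proof. exact: closedP Seq_form. Qed.

Let nu (P : projsp k n) : projsp k m := pt (nuv (hcoord P)).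

(** Any nonzero column of the matrix serves to recover the point. *)
Let colidx (t : projsp k m) : J :=
  odflt (inl ord0) [pick l : J | [exists i, hcoord t (idx i l) != 0]].

Let colidxP t i l : hcoord t (idx i l) != 0 ->
  exists i', hcoord t (idx i' (colidx t)) != 0.
Proof.
move=> nz; rewrite /colidx; case: pickP => [l' h|h]; first by apply/existsP.
suff : [exists i, hcoord t (idx i l) != 0] by rewrite h.
by apply/existsP; exists i.
Qed.

Let mu (t : projsp k m) : projsp k n :=
  pt (fun i => hcoord t (idx i (colidx t))).

Let nuv_nz P : X P -> exists a, nuv (hcoord P) a != 0.
Proof. by case=> _ /= h; exists ord0; rewrite nuv0. Qed.

Let nu_in P : X P -> (Z' `&` @affine_space k m) (nu P).
Proof.
move=> XP; have nz := nuv_nz XP; split; last first.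
  rewrite /affine_space /=; have [c c0 ->] := hcoord_pt nz.
  by rewrite mulf_neq0 // nuv0; case: XP.
move=> phi Sphi; have [e fe] := Seq_form Sphi.
have [c c0 ->] := form_pt fe nz.
case: Sphi {fe} => [[i [j [i' [j' ->]]]]|[i [j [j' [l ->]]]]|->|
    [e' [psi [l [h hZ ->]]]]].
- by rewrite !nuvM; ring.
- have -> : (fun a => nuv (hcoord P) (idx a l)) =
    (fun a => A l (hcoord P) * hcoord P a).
    by apply/funext => a; rewrite nuvM mulrC.
  by rewrite !nuvM !(form_homog (formA _)); ring.
- rewrite nuv0; under eq_bigr => i _ do rewrite nuvM.
  by rewrite subrr mulr0.
have -> : (fun a => nuv (hcoord P) (idx a l)) =
    (fun a => A l (hcoord P) * hcoord P a).
  by apply/funext => a; rewrite nuvM mulrC.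
by rewrite (form_homog h) hZ ?mulr0 //; case: XP.
Qed.

Section Image.
Variables (t : projsp k m) (Zt : Z' t) (t0 : @affine_space k m t).
Let v := hcoord t.

Let rank1 i j i' j' : v (idx i j) * v (idx i' j') = v (idx i j') * v (idx i' j).
Proof.
apply/eqP; rewrite -subr_eq0; apply/eqP.
apply: (Zt (phi := fun t =>
  t (idx i j) * t (idx i' j') - t (idx i j') * t (idx i' j))).
by apply: Or41; exists i, j, i', j'.
Qed.

Let prop_row i j j' l : v (idx i j) * A j' (fun a => v (idx a l)) =
  v (idx i j') * A j (fun a => v (idx a l)).
Proof.
apply/eqP; rewrite -subr_eq0; apply/eqP.
apply: (Zt (phi := fun t => t (idx i j) * A j' (fun a => t (idx a l)) -
        t (idx i j') * A j (fun a => t (idx a l)))).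
by apply: Or42; exists i, j, j', l.
Qed.

Let sum_diag : v ord0 = \sum_i v (idx i (inr i)).
Proof.
apply/eqP; rewrite eq_sym -subr_eq0; apply/eqP.
by apply: (Zt (phi := fun t => \sum_i t (idx i (inr i)) - t ord0)); apply: Or43.
Qed.

Let entry_nz : exists i l, v (idx i l) != 0.
Proof.
apply: contrapT => h; move/negP: t0; apply; rewrite -/(v ord0) sum_diag big1 // => i _.
apply/eqP; apply: contraT => nz; case: h; by exists i, (inr i).
Qed.

Lemma mu_col i l : v (idx i l) != 0 -> mu t = pt (fun a => v (idx a l)).
Proof.
move=> nz; have [i' nz'] := colidxP nz.
rewrite /mu; move: (colidx t) nz' => l' nz'.
have nz2 : v (idx i' l) != 0.
  apply: contraT; rewrite negbK => /eqP z; have := rank1 i l i' l'.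
  by rewrite z mulr0 => /eqP; rewrite mulf_eq0 (negPf nz) (negPf nz').
set c := v (idx i' l') / v (idx i' l).
have c0 : c != 0 by rewrite mulf_neq0 ?invr_eq0.
rewrite -(pt_scale (v := fun a => v (idx a l)) _ c0); last by exists i.
congr pt; apply/funext => a.
by apply: (mulfI nz2); rewrite rank1 /c mulrCA !mulrA divfK // mulrC.
Qed.

(** The equations determine the matrix up to a scalar from one of its nonzero
    columns p: each row is proportional to (A_j(p))_j. *)
Lemma image_nu : exists p lam, [/\ exists i, p i != 0, lam != 0,
  v = fun a => lam * nuv p a & mu t = pt p].
Proof.
have [i0 [l nz]] := entry_nz.
set p := fun a => v (idx a l).
have Aj1 : A (inl i0) p != 0 by rewrite /= expf_neq0.
exists p, (v (idx i0 (inl i0)) / (p i0 * A (inl i0) p)).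
set lam := _ / _.
have E i j : v (idx i j) = lam * (p i * A j p).
  have e1 : v (idx i j) * p i0 = p i * v (idx i0 j).
    by rewrite /p rank1.
  have e2 : v (idx i0 j) * A (inl i0) p = v (idx i0 (inl i0)) * A j p.
    exact: prop_row.
  apply: (mulIf nz); rewrite -/(p i0) e1; apply: (mulIf Aj1).
  rewrite -(mulrA (p i)) e2 /lam.
  have G (a b w x y : k) : a != 0 -> y != 0 ->
    x * (w * b) = w / (y * a) * (x * b) * y * a.
    by move=> a0 y0; field; rewrite a0 y0.
  exact: G.
have E0 : v ord0 = lam * H p.
  rewrite sum_diag /H mulr_sumr; apply: eq_bigr => i _; exact: E.
split.
- by exists i0.
- by apply: contraTneq t0 => l0; rewrite -/(v ord0) E0 l0 mul0r negbK.
- apply/funext => a; case: (idxP a) => [->|[i [j ->]]]; first by rewrite nuv0.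
  by rewrite nuvM.
- exact: mu_col nz.
Qed.

End Image.

Let Zclosed P : (forall e psi, isform e psi ->
  (forall Q, Z Q -> psi (hcoord Q) = 0) -> psi (hcoord P) = 0) -> Z P.
Proof.
case: clZ => T [hT eZ] h; rewrite eZ => F TF; have [e hF] := hT _ TF.
apply: (h e (fun v => F.@[v])); first exact: form_mpoly.
by move=> Q; rewrite eZ => /(_ _ TF).
Qed.

Let mu_in t : (Z' `&` @affine_space k m) t -> X (mu t) /\ nu (mu t) = t.
Proof.
move=> [Zt t0]; have [p [lam [pnz l0 ev em]]] := image_nu Zt t0.
have [c c0 ep] := hcoord_pt pnz.
have Hp : H p != 0.
  apply: contraTneq t0; rewrite /affine_space /= -/(hcoord t ord0) ev nuv0 => ->.
  by rewrite mulr0 eqxx.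
split; last first.
  rewrite em; apply: (pt_eq (c := c ^+ d.+1 / lam)).
    by rewrite mulf_neq0 ?invr_eq0 ?expf_neq0.
  move=> a; rewrite ev mulrA divfK // ep.
  by have := form_homog (form_nuv a) c p.
split; last by rewrite em /= ep (form_homog formH) mulf_neq0 ?expf_neq0.
apply: Zclosed => e psi fpsi hZ.
have [i pi] := pnz.
have : psi (fun a => hcoord t (idx a (inl i))) = 0.
  apply: (Zt (fun t => psi (fun a => t (idx a (inl i))))).
  by apply: Or44; exists e, psi, (inl i).
have -> : (fun a => hcoord t (idx a (inl i))) = (fun a => (lam * p i ^+ d) * p a).
  by apply/funext => a; rewrite ev nuvM /=; ring.
rewrite (form_homog fpsi) => /eqP; rewrite mulf_eq0 expf_eq0 mulf_eq0.
rewrite (negPf l0) expf_eq0 (negPf pi) !andbF /= => /eqP e0.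
by rewrite em ep (form_homog fpsi) e0 mulr0.
Qed.

Let nu_morphism : is_morphism X (Z' `&` @affine_space k m) nu.
Proof.
apply: local_morphism; first exact: nu_in.
move=> P XP; have [b Pb] := hcoord_neq0 P.
have bd : (hcoord P b) ^+ d.+1 != 0 by rewrite expf_neq0.
have fb : isform d.+1 (fun v : 'I_n.+1 -> k => v b ^+ d.+1) := form_varX k b d.+1.
exists (fun a Q => nuv (hcoord Q) a / (hcoord Q b) ^+ d.+1); split.
- by move=> a; apply: (reg_form XP (form_nuv a) fb).
- by have [a ha] := nuv_nz XP; exists a; rewrite mulf_neq0 ?invr_eq0.
apply: near_map2 (near_form XP fb bd) (near_all XP (fun Q XQ => XQ)) => Q XQ hb _.
rewrite /nu -(pt_scale (nuv_nz XQ) (c := (hcoord Q b ^+ d.+1)^-1)) ?invr_eq0 //.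
by congr pt; apply/funext => a; rewrite mulrC.
Qed.

Let mu_morphism : is_morphism (Z' `&` @affine_space k m) X mu.
Proof.
apply: local_morphism => [t /mu_in [] //|t At]; have [Zt t0] := At.
have [p [lam [[i pi] l0 ev em]]] := image_nu Zt t0.
have nz : hcoord t (idx i (inl i)) != 0.
  by rewrite ev nuvM /= !mulf_neq0 ?expf_neq0.
exists (fun a s => hcoord s (idx a (inl i)) / hcoord s ord0); split.
- by move=> a; apply: (reg_form At (form_var k _) (form_var k _)).
- by exists i; rewrite mulf_neq0 ?invr_eq0.
apply: near_map2 (near_form At (form_var k (idx i (inl i))) nz)
  (near_all At (fun s As => As)) => s [Zs s0] nzs _.
rewrite (mu_col Zs nzs) -(pt_scale (v := fun a => hcoord s (idx a (inl i))) _
  (c := (hcoord s ord0)^-1)) ?invr_eq0 //; last by exists i.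
by congr pt; apply/funext => a; rewrite mulrC.
Qed.

Let mu_nu P : X P -> mu (nu P) = P.
Proof.
move=> XP; have [Zt t0] := nu_in XP; have [i Pi] := hcoord_neq0 P.
have [c c0 ec] := hcoord_pt (nuv_nz XP).
have nz : hcoord (nu P) (idx i (inl i)) != 0.
  by rewrite ec nuvM /= !mulf_neq0 ?expf_neq0.
rewrite (mu_col Zt nz); apply: (pt_eq (c := c * hcoord P i ^+ d)).
  by rewrite mulf_neq0 ?expf_neq0.
by move=> a; rewrite ec nuvM /=; ring.
Qed.

(** Functions on the complement of a hypersurface are generated by the quotients
    of forms by H. The decomposition of H along the coordinates makes the
    equation H = 1 linear in the entries x_i A_j / H of the matrix. *)
Lemma affine_principal :
  affine (Z `&` [set P | \sum_i hcoord P i * Hc i (hcoord P) != 0]).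
Proof.
split.
  exists Z => //; apply/open_inP; split=> [P [] //|P [ZP HP]].
  apply: near_map2 (near_form ZP formH HP) (near_all ZP (fun Q ZQ => ZQ)).
  by move=> Q ZQ hQ _.
exists m, Z'; split=> //; exists nu, mu; split=> // Q /mu_in [] //.
Qed.

End AffinePrincipal.

Lemma form_split (k : fieldType) n d (H : ('I_n.+1 -> k) -> k) :
  isform d.+1 H -> exists2 Hc, forall i, isform d (Hc i) &
    forall v, H v = \sum_i v i * Hc i v.
Proof.
suff : forall e (H : ('I_n.+1 -> k) -> k), isform e H -> forall d, e = d.+1 ->
    exists2 Hc, forall i, isform d (Hc i) & forall v, H v = \sum_i v i * Hc i v.
  by move=> h /h; apply.
apply: form_ind => //.
- move=> e d' _; exists (fun _ _ => 0) => [i|v]; first exact: form_zero.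
  by rewrite big1 // => i _; rewrite mulr0.
- move=> e i phi hp _ d' [<-]; exists (fun j v => if j == i then phi v else 0).
    by move=> j; case: (j == i) => //; exact: form_zero.
  move=> v; rewrite (bigD1 i) //= eqxx big1 ?addr0 // => j /negPf ->.
  by rewrite mulr0.
- move=> e phi psi _ _ IH1 IH2 d' e'.
  have [A hA eA] := IH1 _ e'; have [B hB eB] := IH2 _ e'.
  exists (fun i v => A i v + B i v) => [i|v]; first exact: form_add.
  by rewrite eA eB -big_split; apply: eq_bigr => i _; rewrite mulrDr.
Qed.

Lemma affine_form (k : fieldType) n d (Z : set (projsp k n)) H :
  zariski_closed Z -> isform d.+1 H ->
  affine (Z `&` [set P | H (hcoord P) != 0]).
Proof.
move=> clZ /form_split [Hc h1 h2]; have := affine_principal clZ h1.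
by congr affine; congr (_ `&` _); apply/seteqP; split=> P /=; rewrite h2.
Qed.

(** * Local parameters *)

Section LocalRing.
Variables (k : fieldType) (n : nat) (X : set (projsp k n)) (P : projsp k n).
Implicit Types (f g : projsp k n -> k).

(** A generator of the maximal ideal with a nonzero germ. *)
Record param (pi : projsp k n -> k) : Prop := Param {
  param_reg : regular_at X P pi;
  param_0 : pi P = 0;
  param_nz : ~ near X P (fun Q => pi Q = 0);
  param_max : forall f, regular_at X P f -> f P = 0 ->
    exists2 g, regular_at X P g & near X P (fun Q => f Q = pi Q * g Q) }.

(** Vanishing of f at P to order exactly e. *)
Definition ordat pi e f : Prop := exists u,
  [/\ regular_at X P u, u P != 0 & near X P (fun Q => f Q = pi Q ^+ e * u Q)].

Definition dvr pi : Prop := param pi /\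
  forall f, regular_at X P f ->
    near X P (fun Q => f Q = 0) \/ exists e, ordat pi e f.

(** The e-th power of the maximal ideal. *)
Definition max_power (pi : projsp k n -> k) e : set (projsp k n -> k) :=
  [set f | regular_at X P f /\ exists2 g, regular_at X P g &
     near X P (fun Q => f Q = pi Q ^+ e * g Q)].

Section Param.
Variables (pi : projsp k n -> k) (hpi : param pi).
Hypothesis irrX : irreducible X.
Let XP : X P := reg_mem (param_reg hpi).

Lemma param_exp_nz e : ~ near X P (fun Q => pi Q ^+ e = 0).
Proof.
move=> h; apply: (param_nz hpi); apply: near_sub h => Q _ /eqP.
by rewrite expf_eq0 => /andP [_ /eqP].
Qed.

Lemma ordat_near e f g : near X P (fun Q => f Q = g Q) -> ordat pi e f ->
  ordat pi e g.
Proof.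
by move=> e' [u [h1 h2 h3]]; exists u; split=> //; apply: near_map2 e' h3 => Q _ ->.
Qed.

Lemma ordat_unit f : regular_at X P f -> f P != 0 -> ordat pi 0 f.
Proof.
by move=> h1 h2; exists f; split=> //; apply: near_all => // Q _; rewrite mul1r.
Qed.

Lemma ordat_self : ordat pi 1 pi.
Proof.
exists (fun=> 1); split; [exact: reg_cst | exact: oner_neq0 |].
by apply: near_all => // Q _; rewrite mulr1.
Qed.

Lemma ordat_mul e e' f g : ordat pi e f -> ordat pi e' g ->
  ordat pi (e + e') (fun Q => f Q * g Q).
Proof.
move=> [u [h1 h2 h3]] [v [g1 g2 g3]]; exists (fun Q => u Q * v Q); split.
- exact: reg_mul.
- by rewrite mulf_neq0.
- by apply: near_map2 h3 g3 => Q _ -> ->; rewrite exprD mulrACA.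
Qed.

Lemma ordat_exp e f m : ordat pi e f -> ordat pi (e * m) (fun Q => f Q ^+ m).
Proof.
move=> h; elim: m => [|m IH].
  by rewrite muln0; apply: ordat_unit; [exact: reg_cst | exact: oner_neq0].
rewrite mulnS; apply: ordat_near (ordat_mul h IH).
by apply: near_all => // Q _; rewrite exprS.
Qed.

Lemma ordat_at0 e f : (0 < e)%N -> ordat pi e f -> f P = 0.
Proof.
by case: e => // e _ [u [_ _ /near_pt ->]]; rewrite (param_0 hpi) expr0n mul0r.
Qed.

Lemma ordat_lt_cancel e f u : regular_at X P f -> regular_at X P u ->
  u P != 0 -> ~ near X P (fun Q => pi Q ^+ e * u Q = pi Q ^+ e.+1 * f Q).
Proof.
move=> hf hu uP h.
have : near X P (fun Q => u Q = pi Q * f Q).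
  apply: (reg_cancel irrX (reg_exp e (param_reg hpi)) hu
    (reg_mul (param_reg hpi) hf) (@param_exp_nz e)).
  by apply: near_sub h => Q _ ->; rewrite exprSr mulrA.
by move/near_pt; rewrite (param_0 hpi) mul0r => e0; rewrite e0 eqxx in uP.
Qed.

(** Factors pi are divided out of f as long as f vanishes at P; after m steps
    this has stopped at the order of f or not. *)
Lemma param_expand m f : regular_at X P f ->
  (exists2 g, regular_at X P g & near X P (fun Q => f Q = pi Q ^+ m * g Q)) \/
  exists2 i, (i < m)%N & ordat pi i f.
Proof.
elim: m f => [|m IH] f hf.
  by left; exists f => //; apply: near_all => // Q _; rewrite mul1r.
case: (IH f hf) => [[g hg eg]|[i im hi]]; last first.
  by right; exists i => //; exact: ltnW.
case: (eqVneq (g P) 0) => [g0|g0]; last by right; exists m => //; exists g.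
have [g' hg' eg'] := param_max hpi hg g0.
left; exists g' => //; apply: near_map2 eg eg' => Q _ -> ->.
by rewrite exprSr mulrA.
Qed.

Lemma max_power_ideal e : is_ideal X P (max_power pi e).
Proof.
split.
- by move=> f [].
- move=> f g /germ_eqP fg [hf [a ha ea]]; split; first exact: reg_near hf.
  by exists a => //; apply: near_map2 fg ea => Q _ ->.
- split; first exact: reg_cst.
  exists (fun=> 0); first exact: reg_cst.
  by apply: near_all => // Q _; rewrite mulr0.
- move=> f g [hf [a ha ea]] [hg [b hb eb]]; split; first exact: reg_add.
  exists (fun Q => a Q + b Q); first exact: reg_add.
  by apply: near_map2 ea eb => Q _ -> ->; rewrite mulrDr.
- move=> f g hf [hg [b hb eb]]; split; first exact: reg_mul.
  exists (fun Q => f Q * b Q); first exact: reg_mul.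
  by apply: near_sub eb => Q _ ->; rewrite mulrCA.
Qed.

Lemma max_power1 : max_power pi 1 = max_ideal X P.
Proof.
apply/seteqP; split=> f [hf].
  case=> g hg /near_pt e; split=> //.
  by rewrite e expr1 (param_0 hpi) mul0r.
move=> f0; split=> //; have [g hg e] := param_max hpi hf f0.
by exists g.
Qed.

Lemma max_power_sub e e' : (e' <= e)%N -> max_power pi e `<=` max_power pi e'.
Proof.
move=> le f [hf [g hg eg]]; split=> //.
exists (fun Q => pi Q ^+ (e - e') * g Q).
  by apply: reg_mul => //; apply: reg_exp; exact: param_reg.
by apply: near_sub eg => Q _ ->; rewrite mulrA -exprD subnKC.
Qed.

Lemma max_power_mem e : max_power pi e (fun Q => pi Q ^+ e).
Proof.
split; first by apply: reg_exp; exact: param_reg.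
exists (fun=> 1); first exact: reg_cst.
by apply: near_all => // Q _; rewrite mulr1.
Qed.

Lemma max_power_lt e e' : max_power pi e (fun Q => pi Q ^+ e') -> (e <= e')%N.
Proof.
move=> [_ [g hg eg]]; rewrite leqNgt; apply/negP => lt.
apply: (@ordat_lt_cancel e' (fun Q => pi Q ^+ (e - e'.+1) * g Q) (fun=> 1)).
- by apply: reg_mul => //; apply: reg_exp; exact: param_reg.
- exact: reg_cst.
- exact: oner_neq0.
by apply: near_sub eg => Q _; rewrite mulr1 => ->; rewrite mulrA -exprD subnKC.
Qed.

(** The least power of the parameter in I generates I, because an element of I
    is a multiple of it, or a unit times a smaller power of the parameter. *)
Lemma ideal_max_power e I : is_ideal X P I -> max_power pi e `<=` I ->
  exists2 i, (i <= e)%N & I = max_power pi i.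
Proof.
move=> hI sI.
have [i Ii imin] : exists2 i, I (fun Q => pi Q ^+ i) &
    forall j, I (fun Q => pi Q ^+ j) -> (i <= j)%N.
  have ex : exists i, `[< I (fun Q => pi Q ^+ i) >].
    by exists e; apply/asboolP/sI/max_power_mem.
  exists (ex_minn ex); first by case: ex_minnP => i /asboolP.
  by move=> j Ij; case: ex_minnP => i _; apply; apply/asboolP.
exists i; first by apply/imin/sI/max_power_mem.
apply/seteqP; split=> f.
  move=> If; have hf := ideal_regular hI If; split=> //.
  have [//|[j ji [u [hu u0 eu]]]] := param_expand i hf.
  have : I (fun Q => pi Q ^+ j).
    apply: (ideal_germ hI) (ideal_M hI (reg_inv hu u0) If).
    apply/germ_eqP; apply: near_map2 eu (reg_neq0 hu u0) => Q _ -> uQ.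
    by rewrite mulrCA mulVf // mulr1.
  by move/imin; rewrite leqNgt ji.
move=> [hf [g hg eg]]; apply: (ideal_germ hI) (ideal_M hI hg Ii).
by apply/germ_eqP; apply: near_sub eg => Q _ ->; rewrite mulrC.
Qed.

Lemma max_power_length e : quotient_length X P (max_power pi e) e.
Proof.
split.
  exists (fun i => max_power pi (e - i)); split=> i ie.
    by split; [exact: max_power_ideal | apply: max_power_sub; exact: leq_subr].
  split; first by apply: max_power_sub; exact: leq_sub2l.
  move/(_ _ (max_power_mem _))/max_power_lt.
  by rewrite leqNgt => /negP; apply; rewrite ltn_sub2l.
move=> l I [hI sI].
have hi i : (i <= l)%N -> exists2 j, (j <= e)%N & I i = max_power pi j.
  by case/hI; exact: ideal_max_power.
suff H : forall i, (i <= l)%N ->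
    exists2 j, (j + i <= e)%N & I i = max_power pi j.
  by have [j hj _] := H l (leqnn l); exact: leq_trans (leq_addl _ _) hj.
elim=> [|i IH] il; first by have [j ? ?] := hi 0%N il; exists j; rewrite ?addn0.
have [j hj ej] := IH (ltnW il); have [j' _ ej'] := hi _ il.
exists j' => //; have [sub nsub] := sI i il.
have lt : (j' < j)%N.
  rewrite ltnNge; apply/negP => le; apply: nsub; rewrite ej ej'.
  exact: max_power_sub.
by rewrite addnS; apply: leq_trans hj; rewrite -addSn leq_add2r.
Qed.

End Param.
End LocalRing.

(** * Ramification along local parameters *)

Section Ramification.
Variables (k : fieldType) (n m : nat).
Variables (X : set (projsp k n)) (Y : set (projsp k m)).
Variable (h : projsp k n -> projsp k m).
Hypothesis irrX : irreducible X.
Variables (P : projsp k n) (pi : projsp k n -> k) (t : projsp k m -> k) (e : nat).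
Hypothesis hpi : param X P pi.
Hypothesis ht : dvr Y (h P) t.
Hypothesis pull_regh : forall f, regular_at Y (h P) f -> regular_at X P (f \o h).
Hypothesis pull_nearh : forall A, near Y (h P) A -> near X P (fun Q => A (h Q)).
Hypothesis ord_t : ordat X P pi e (t \o h).

(** The maximal ideal at h(P) is generated by t, whose pullback is a unit times
    the e-th power of the parameter at P. *)
Lemma extended_max_power : extended_ideal X Y h P = max_power X P pi e.
Proof.
case: ord_t => u [hu u0 eu]; have [pt _] := ht.
apply/seteqP; split=> f.
  apply; first exact: max_power_ideal.
  move=> a [ha a0]; split; first exact: pull_regh.
  have [b hb eb] := param_max pt ha a0.
  exists (fun Q => u Q * b (h Q)); first by apply: reg_mul => //; exact: pull_regh.
  by apply: near_map2 (pull_nearh eb) eu => Q _ /= -> ->; rewrite mulrA.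
move=> [hf [g hg eg]] I hI tI.
have It : I (t \o h) by apply: tI; split; [exact: (param_reg pt) | exact: (param_0 pt)].
apply: (ideal_germ hI) (ideal_M hI (reg_div hg hu u0) It).
apply/germ_eqP; apply: near_map2 (near_and eu eg) (reg_neq0 hu u0).
by move=> Q _ [-> ->] uQ; rewrite mulrCA divfK.
Qed.

Lemma ramification_order : ramification_index X Y h P e.
Proof.
by rewrite /ramification_index extended_max_power; exact: max_power_length.
Qed.

(** Flatness over a discrete valuation ring: in a linear relation, divide by
    the coefficient of least order. *)
Lemma flat_dvr : flat_at X Y h P.
Proof.
move=> r a x ha hx rel; have [pt dt] := ht.
have XP : X P := reg_mem (param_reg hpi).
have YP : Y (h P) := reg_mem (param_reg pt).
have reg1 j i : regular_at Y (h P) (fun=> (i == j)%:R : k) by exact: reg_cst.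
case: (pselect (forall i, near Y (h P) (fun Q => a i Q = 0))) => [a0|].
  exists r, (fun i j _ => (i == j)%:R), x; split=> // i; apply/germ_eqP.
    apply: near_all => // Q _; rewrite (bigD1 i) //= eqxx mul1r big1 ?addr0 //.
    by move=> j /negPf ji; rewrite eq_sym ji mul0r.
  apply: near_sub (a0 i) => Q _ e0; rewrite (bigD1 i) //= eqxx e0 mul0r add0r.
  by rewrite big1 // => j /negPf ->; rewrite mulr0.
move=> /existsNP [i1 n1].
have [e1 o1] : exists e, ordat Y (h P) t e (a i1) by case: (dt _ (ha i1)).
have ex : exists d, `[< exists i, ordat Y (h P) t d (a i) >].
  by exists e1; apply/asboolP; exists i1.
have [i0 [d o0 dmin]] : exists i, exists2 d, ordat Y (h P) t d (a i) &
    forall d' j, ordat Y (h P) t d' (a j) -> (d <= d')%N.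
  case: (ex_minnP ex) => d /asboolP [i0 o0] dmin; exists i0, d => // d' j oj.
  by apply: dmin; apply/asboolP; exists j.
have hc i : exists c, regular_at Y (h P) c /\
    near Y (h P) (fun Q => a i Q = a i0 Q * c Q).
  have [z|[d' oi]] := dt _ (ha i).
    exists (fun=> 0); split; first exact: reg_cst.
    by apply: near_sub z => Q _ ->; rewrite mulr0.
  have le := dmin _ _ oi; case: oi => v [hv v0 ev]; case: o0 => u [hu u0 eu].
  exists (fun Q => t Q ^+ (d' - d) * (v Q / u Q)); split.
    apply: reg_mul; last exact: reg_div.
    by apply: reg_exp; exact: param_reg.
  apply: near_map2 (near_and eu ev) (reg_neq0 hu u0) => Q _ [-> ->] uQ.
  by rewrite -{1}(subnKC le) exprD; field.
have [c0 hc0] := choice hc.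
pose c j := if j == i0 then (fun=> 0) else c0 j.
have rc j : regular_at Y (h P) (c j).
  by rewrite /c; case: eqP => _; [exact: reg_cst | case: (hc0 j)].
pose b i j : projsp k m -> k :=
  if i == i0 then (fun Q => - c j Q) else fun=> (i == j)%:R.
exists r, b, (fun j => if j == i0 then (fun=> 0) else x j); split.
- move=> i j; rewrite /b; case: eqP => _; [exact: reg_opp | exact: reg1].
- by move=> j; case: eqP => _; [exact: reg_cst | exact: hx].
- move=> i; apply/germ_eqP; rewrite /b; case: (eqVneq i i0) => [->|ii0]; last first.
    apply: near_all => // Q _; rewrite (bigD1 i) //= eqxx (negPf ii0) mul1r.
    by rewrite big1 ?addr0 // => j /negPf ji; rewrite eq_sym ji mul0r.
  have na0 : ~ near X P (fun Q => a i0 (h Q) = 0).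
    case: o0 => u [hu u0 eu] z; case: ord_t => w [hw w0 ew].
    have : near X P (fun Q => pi Q ^+ (e * d) = 0).
      apply: near_map2 (near_and z (pull_nearh eu))
        (near_and ew (near_and (reg_neq0 hw w0) (pull_nearh (reg_neq0 hu u0)))).
      move=> Q _ [-> /esym/eqP]; rewrite mulf_eq0 => /orP q [ew' [wQ uQ]].
      case: q => [|/eqP q]; last by rewrite q eqxx in uQ.
      rewrite expf_eq0 => /andP [d0 /eqP tQ]; move: ew' => /= /esym/eqP.
      rewrite tQ mulf_eq0 (negPf wQ) orbF exprM => /eqP ->.
      by rewrite expr0n eqn0Ngt d0.
    exact: param_exp_nz.
  apply: (reg_cancel irrX (pull_regh (ha i0)) (hx i0)) na0 _.
    apply: reg_sum => // j; apply: reg_mul.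
      by have := pull_regh (reg_opp (rc j)).
    by case: eqP => _; [exact: reg_cst | exact: hx].
  have hall : near X P (fun Q => forall j, a j (h Q) = a i0 (h Q) * c0 j (h Q)).
    have : forall s : seq 'I_r, near X P (fun Q => forall j, j \in s ->
        a j (h Q) = a i0 (h Q) * c0 j (h Q)).
      elim=> [|j s IH]; first exact: near_all.
      apply: near_map2 IH (pull_nearh (hc0 j).2) => Q _ e1' e2 j'.
      by rewrite inE => /orP [/eqP ->|/e1'].
    by move/(_ (enum 'I_r)); apply: near_sub => Q _ e' j; apply: e'; rewrite mem_enum.
  have relP := (germ_eqP _ _ _ _).1 rel.
  apply: near_map2 hall relP => Q _ ej; rewrite (bigD1 i0) //= => /eqP.
  rewrite addr_eq0 => /eqP ->; rewrite mulr_sumr [RHS](bigD1 i0) //= eqxx !mulr0 add0r.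
  rewrite -sumrN; apply: eq_bigr => j /negPf ji; rewrite /c ji ej.
  by rewrite mulNr mulrN mulrA.
- move=> j; apply/germ_eqP; apply: near_sub (hc0 j).2 => Q _ ej.
  rewrite (bigD1 i0) //= /b eqxx /c; case: (eqVneq j i0) => [->|ji].
    rewrite oppr0 mulr0 add0r big1 // => i ii.
    by rewrite (negPf ii) mulr0.
  rewrite (bigD1 j) //= (negPf ji) eqxx mulr1 ej mulrN addKr big1 //.
  by move=> i /andP [/negPf ii /negPf ij]; rewrite ii ij mulr0.
Qed.

Lemma etale_order1 : e = 1%N -> etale_at X Y h P.
Proof.
move=> e1; split; first exact: flat_dvr.
by rewrite /unramified_at extended_max_power e1; exact: max_power1.
Qed.

End Ramification.

(** * The projective line *)

Lemma dvr_order (k : fieldType) n (X : set (projsp k n)) P t :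
  regular_at X P t -> t P = 0 -> ~ near X P (fun Q => t Q = 0) ->
  (forall f, regular_at X P f ->
    near X P (fun Q => f Q = 0) \/ exists e, ordat X P t e f) -> dvr X P t.
Proof.
move=> ht t0 tnz ord; split=> //; split=> // f hf f0.
have [z|[[|e] [u [hu u0 eu]]]] := ord f hf.
- exists (fun=> 0); first exact/reg_cst/(reg_mem hf).
  by apply: near_sub z => Q _ ->; rewrite mulr0.
- by move: u0; rewrite -(mul1r (u P)) -(near_pt eu) f0 eqxx.
exists (fun Q => t Q ^+ e * u Q); first by apply: reg_mul => //; exact: reg_exp.
by apply: near_sub eu => Q _ ->; rewrite exprS mulrA.
Qed.

Section ProjectiveLine.
Variable k : closedFieldType.
Implicit Types (Q R : projsp k 1).

Definition pair_coord (a b : k) : 'I_2 -> k := fun i => if i == ord0 then a else b.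

Lemma binary_form (i j : 'I_2) d phi : i != j -> isform d phi ->
  exists p : {poly k}, forall v,
    phi v = \sum_(l < d.+1) p`_l * (v i ^+ (d - l) * v j ^+ l).
Proof.
move=> ij hphi; suff : exists p : {poly k}, (size p <= d.+1)%N /\ forall v,
    phi v = \sum_(l < d.+1) p`_l * (v i ^+ (d - l) * v j ^+ l).
  by case=> p [_ hp]; exists p.
move: d phi hphi.
apply: form_ind.
- move=> c; exists c%:P; split=> [|v]; first exact: size_polyC_leq1.
  by rewrite big_ord1 coefC eqxx !mulr1.
- move=> d; exists 0; split=> [|v]; first by rewrite size_poly0.
  by rewrite big1 // => l _; rewrite coef0 mul0r.
- move=> d a phi _ [p [sp hp]].
  case: (eqVneq a i) => [->|ai].
    exists p; split=> [|v]; first exact: leqW.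
    rewrite big_ord_recr /= (nth_default _ sp) mul0r addr0 hp mulr_sumr.
    apply: eq_bigr => l _; have ld : (l <= d)%N by rewrite -ltnS.
    by rewrite subSn // exprS mulrCA -!mulrA.
  have -> : a = j.
    by move: ij ai; clear; case: a => [[|[]]] //; case: i => [[|[]]] //;
      case: j => [[|[]]] // *; exact: val_inj.
  exists (p * 'X); split=> [|v].
    by rewrite (leq_trans (size_polyMleq _ _)) // size_polyX addn2.
  rewrite big_ord_recl /= coefMX eqxx mul0r add0r hp mulr_sumr.
  by apply: eq_bigr => l _; rewrite /bump /= add1n coefMX /= subSS exprS mulrCA; congr (_ * _); rewrite mulrCA.
- move=> d phi psi _ _ [p [sp hp]] [q [sq hq]]; exists (p + q); split=> [|v].
    by rewrite (leq_trans (size_polyD _ _)) // geq_max sp sq.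
  rewrite hp hq -big_split; apply: eq_bigr => l _.
  by rewrite coefD mulrDl.
Qed.

(** Dehomogenisation loses no form: p is truncated at the degree d, so that p = 0
    forces phi = 0 even where v i vanishes. *)
Lemma binary_horner (i j : 'I_2) d phi : i != j -> isform d phi ->
  exists2 p : {poly k}, p = 0 -> forall v, phi v = 0 &
    forall v, v i != 0 -> phi v = v i ^+ d * p.[v j / v i].
Proof.
move=> ij /(binary_form ij) [p hp].
exists (\poly_(l < d.+1) p`_l).
  move/polyP => p0 v; rewrite hp big1 // => l _.
  by have := p0 l; rewrite coef_poly ltn_ord coef0 => ->; rewrite mul0r.
move=> v vi; rewrite hp horner_poly mulr_sumr; apply: eq_bigr => l _.
rewrite [RHS]mulrCA; congr (_ * _).
have ld : (l <= d)%N by rewrite -ltnS.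
have -> : v i ^+ d = v i ^+ (d - l) * v i ^+ l by rewrite -exprD subnK.
rewrite expr_div_n -mulrA; congr (_ * _).
by rewrite mulrCA divff ?mulr1 // expf_neq0.
Qed.

Lemma poly_all_roots (p : {poly k}) : (forall x, p.[x] = 0) -> p = 0.
Proof.
move=> h; apply/eqP; apply: contraT => /closed_nonrootP [x].
by rewrite /root h eqxx.
Qed.

Lemma proj_line_irr : irreducible (proj_line k).
Proof.
move=> d e phi psi hphi hpsi hz; have ij : ord0 != (lift ord0 ord0) :> 'I_2 by [].
have [p p0 hp] := binary_horner ij hphi; have [q q0 hq] := binary_horner ij hpsi.
have : p * q = 0.
  apply: poly_all_roots => x; rewrite hornerM.
  pose v : 'I_2 -> k := pair_coord 1 x.
  have nz : exists i, v i != 0 by exists ord0; exact: oner_neq0.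
  have [c c0 ec] := hcoord_pt nz.
  have := hz (pt v) I; rewrite ec (form_homog hphi) (form_homog hpsi) => /eqP.
  rewrite !mulf_eq0 !expf_eq0 (negPf c0) !andbF /= hp ?hq ?oner_neq0 //.
  by rewrite /= !expr1n !mul1r divr1 => /orP [] /eqP ->; rewrite ?mulr0 ?mul0r.
by move/eqP; rewrite mulf_eq0 => /orP [/eqP /p0 h|/eqP /q0 h]; [left|right].
Qed.

Lemma proj_line_dvr (i j : 'I_2) Q : i != j -> hcoord Q i != 0 ->
  dvr (proj_line k) Q (fun R => hcoord R j / hcoord R i - hcoord Q j / hcoord Q i).
Proof.
move=> ij Qi; have YQ : proj_line k Q by [].
set tau := hcoord Q j / hcoord Q i; set t := fun R => _ / _ - tau.
have fi := form_var k i; have fj := form_var k j.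
have rx := reg_form YQ fj fi Qi.
have rt : regular_at (proj_line k) Q t by apply: reg_sub => //; exact: reg_cst.
apply: dvr_order => //; first by rewrite /t subrr.
  move/near_gen => z.
  have : forall R, proj_line k R -> hcoord R j - tau * hcoord R i = 0.
    apply: (gen_form0 proj_line_irr (form_sub fj (form_scale tau fi))).
    apply: (gen_map2 proj_line_irr _ z (near_gen (near_form YQ fi Qi))).
    move=> R _ /eqP; rewrite subr_eq0 => /eqP eR Ri.
    by rewrite -eR divfK // subrr.
  pose v : 'I_2 -> k := fun a => (a == j)%:R.
  have nz : exists i, v i != 0 by exists j; rewrite /v eqxx oner_neq0.
  have [c c0 ec] := hcoord_pt nz; move/(_ (pt v) Logic.I).
  rewrite ec /v eqxx (negPf ij) !mulr0 mulr1 subr0 => ec0.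
  by rewrite ec0 eqxx in c0.
move=> f /regularP [d [a [b [ha hb b0 ef]]]].
have [p p0 hp] := binary_horner ij ha.
case: (eqVneq p 0) => [/p0 a0|pnz].
  by left; apply: near_sub ef => R _ ->; rewrite a0 mul0r.
right; have [e [q qr ep]] := multiplicity_XsubC p tau.
rewrite pnz /= in qr.
have fid : isform d (fun v : 'I_2 -> k => v i ^+ d) := form_varX k i d.
exists e, (fun R => q.[hcoord R j / hcoord R i] * (hcoord R i ^+ d / b (hcoord R))).
split.
- apply: reg_mul; first exact: (reg_horner q rx).
  exact: (reg_form YQ fid hb b0).
- by rewrite !mulf_neq0 ?invr_eq0 ?expf_neq0.
apply: near_map2 ef (near_form YQ fi Qi) => R _ -> Ri.
rewrite hp // ep hornerM horner_exp hornerXsubC /t.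
have G (x y z w : k) : x * (y * z) / w = z * (y * (x / w)) by ring.
exact: G.
Qed.

End ProjectiveLine.

(** * Rational functions as maps to the projective line *)

Section RationalMap.
Variables (k : closedFieldType) (n : nat) (X : set (projsp k n)).
Hypothesis irrX : irreducible X.
Hypothesis dvrX : forall P, X P -> exists pi, dvr X P pi.
Variable f : projsp k n -> k.
Hypothesis ratf : exists P, regular_at X P f.

Lemma form_order P pi d a : dvr X P pi -> isform d a ->
  (exists2 Q, X Q & a (hcoord Q) != 0) ->
  exists l e, [/\ isform 1 l, l (hcoord P) != 0 &
    ordat X P pi e (fun Q => a (hcoord Q) / l (hcoord Q) ^+ d)].
Proof.
move=> [hp dp] ha [Q1 X1 n1].
have [i Pi] := hcoord_neq0 P; have fi := form_var k i.
have XP := reg_mem (param_reg hp).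
exists (fun v => v i).
have fid : isform d (fun v : 'I_n.+1 -> k => v i ^+ d) := form_varX k i d.
have Pd : hcoord P i ^+ d != 0 by rewrite expf_neq0.
have [z|[e he]] := dp _ (reg_form XP ha fid Pd); last by exists e.
have := gen_form0 irrX ha; move/(_ _ Q1 X1) => e0.
suff : a (hcoord Q1) = 0 by move=> e1; rewrite e1 eqxx in n1.
apply: e0; apply: (@near_gen _ _ X P); apply: near_map2 z (near_form XP fid Pd).
by move=> Q _ /eqP; rewrite mulf_eq0 invr_eq0 => /orP [/eqP //|/eqP ->] /eqP.
Qed.

(** Over a discrete valuation ring, a fraction or its inverse is integral. *)
Lemma rational_dichotomy P : X P ->
  (exists2 psi, regular_at X P psi & gen X (fun Q => psi Q = f Q)) \/
  (exists psi, [/\ regular_at X P psi, psi P = 0 &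
     gen X (fun Q => psi Q * f Q = 1)]).
Proof.
move=> XP; have [pi dpi] := dvrX XP; have hp := dpi.1.
case: ratf => P1 /regularP [d [a [b [ha hb b1 ef]]]].
have X1 := near_mem ef.
case: (pselect (exists2 Q, X Q & a (hcoord Q) != 0)) => [anz|/forall2NP az]; last first.
  left; exists (fun=> 0); first exact: reg_cst.
  apply: gen_sub (near_gen ef) => Q XQ ->; case: (az Q) => // /negP.
  by rewrite negbK => /eqP ->; rewrite mul0r.
have bnz : exists2 Q, X Q & b (hcoord Q) != 0 by exists P1.
have [l [e [fl lP [u [ru u0 eu]]]]] := form_order dpi ha anz.
have [l' [e' [fl' lP' [v [rv v0 ev]]]]] := form_order dpi hb bnz.
have rpi := param_reg hp.
have gpi : gen X (fun Q => pi Q != 0).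
  exact: reg_gen_neq0 rpi (param_nz hp).
(* the two coordinates used to clear denominators may differ *)
pose w Q := (l (hcoord Q) / l' (hcoord Q)) ^+ d.
have rw : regular_at X P w by apply: reg_exp; exact: (reg_form XP fl fl' lP').
have w0 : w P != 0 by rewrite expf_neq0 // mulf_neq0 ?invr_eq0.
have ggen : gen X (fun Q => [/\ f Q = pi Q ^+ e * u Q * w Q / (pi Q ^+ e' * v Q),
    pi Q != 0, u Q != 0, v Q != 0 & w Q != 0]).
  have g1 := gen_and irrX (near_gen (near_and eu ev)) (near_gen
    (near_and (near_form XP fl lP) (near_form XP fl' lP'))).
  have g2 := near_gen (near_and (reg_neq0 ru u0) (near_and (reg_neq0 rv v0)
    (reg_neq0 rw w0))).
  have g3 := gen_and irrX (near_gen (near_and ef (near_form X1 hb b1))) gpi.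
  apply: (gen_map2 irrX _ (gen_and irrX g1 g2) g3) => Q _.
  case=> [[[e1 e2] [l1 l1']] [u1 [v1 w1]]] [[-> bQ] p1].
  split=> //; rewrite -e1 -e2 /w expr_div_n; field.
  by rewrite bQ !expf_neq0.
case: (leqP e' e) => [le|lt].
  left; exists (fun Q => pi Q ^+ (e - e') * (u Q * w Q / v Q)).
    apply: reg_mul; first exact: reg_exp.
    by apply: reg_div => //; exact: reg_mul.
  apply: gen_sub ggen => Q _ [-> p1 u1 v1 w1].
  rewrite -{2}(subnKC le) exprD; field.
  by rewrite v1 expf_neq0.
right; exists (fun Q => pi Q ^+ (e' - e) * (v Q / (u Q * w Q))); split.
- apply: reg_mul; first exact: reg_exp.
  by apply: reg_div; [|exact: reg_mul|rewrite mulf_neq0].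
- by rewrite (param_0 hp) expr0n eqn0Ngt subn_gt0 lt mul0r.
apply: gen_sub ggen => Q _ [-> p1 u1 v1 w1].
rewrite -{2}(subnKC (ltnW lt)) exprD; field.
by rewrite u1 v1 w1 !expf_neq0.
Qed.

(** The function f only stands for a rational function: its own value at P is
    irrelevant. *)
Definition rational_value P c :=
  exists2 psi, regular_at X P psi & gen X (fun Q => psi Q = f Q) /\ psi P = c.

Lemma rational_value_uniq P c c' :
  rational_value P c -> rational_value P c' -> c = c'.
Proof.
move=> [psi h1 [h2 <-]] [psi' g1 [g2 <-]].
suff /near_pt : near X P (fun Q => psi Q = psi' Q) by [].
by apply: (gen_reg irrX h1 g1); apply: (gen_map2 irrX _ h2 g2) => Q _ -> ->.
Qed.

Definition rational_map P : projsp k 1 :=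
  match pselect (exists c, rational_value P c) with
  | left ex => pt (pair_coord 1 (projT1 (cid ex)))
  | right _ => pt (pair_coord 0 1)
  end.

Lemma rational_mapE P psi : regular_at X P psi ->
  gen X (fun Q => psi Q = f Q) -> rational_map P = pt (pair_coord 1 (psi P)).
Proof.
move=> h1 h2; rewrite /rational_map; case: pselect => [ex|[]]; last first.
  by exists (psi P), psi.
by congr (pt (pair_coord 1 _)); apply: rational_value_uniq (projT2 (cid ex)) _; exists psi.
Qed.

Lemma pair_coord_nz (a b : k) : a != 0 \/ b != 0 -> exists i, pair_coord a b i != 0.
Proof. by case=> h; [exists ord0 | exists (lift ord0 ord0)]. Qed.

Lemma rational_map_pole P psi : regular_at X P psi ->
  gen X (fun Q => psi Q * f Q = 1) ->
  rational_map P = pt (pair_coord (psi P) 1).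
Proof.
move=> h1 h2; case: (eqVneq (psi P) 0) => [p0|p0].
  rewrite p0 /rational_map; case: pselect => [ex|//]; exfalso.
  case: ex => c [phi g1 [g2 _]].
  have : near X P (fun Q => psi Q * phi Q = 1).
    apply: gen_reg => //; [exact: reg_mul | exact/reg_cst/(reg_mem h1)|].
    by apply: (gen_map2 irrX _ h2 g2) => Q _ h ->.
  by move/near_pt/eqP; rewrite p0 mul0r eq_sym oner_eq0.
rewrite (rational_mapE (reg_inv h1 p0)); last first.
  apply: (gen_map2 irrX _ h2 (near_gen (reg_neq0 h1 p0))) => Q _ e q0.
  by apply: (mulfI q0); rewrite e divff.
rewrite -(pt_scale (v := pair_coord (psi P) 1) (c := (psi P)^-1)) ?invr_eq0 //.
  congr pt; apply/funext => i; rewrite /pair_coord; case: ifP => _.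
    by rewrite mulVf.
  by rewrite mulr1.
by apply: pair_coord_nz; right; exact: oner_neq0.
Qed.

Lemma rational_map_near P psi : regular_at X P psi ->
  gen X (fun Q => psi Q = f Q) ->
  near X P (fun Q => rational_map Q = pt (pair_coord 1 (psi Q))).
Proof.
by move=> h1 h2; apply: near_sub (reg_nbhd h1) => Q _ rQ; exact: rational_mapE.
Qed.

Lemma rational_map_pole_near P psi : regular_at X P psi ->
  gen X (fun Q => psi Q * f Q = 1) ->
  near X P (fun Q => rational_map Q = pt (pair_coord (psi Q) 1)).
Proof.
by move=> h1 h2; apply: near_sub (reg_nbhd h1) => Q _ rQ; exact: rational_map_pole.
Qed.

Lemma rational_local_coords P : X P -> exists phi, local_coords X rational_map P phi.
Proof.
move=> XP; have [[psi h1 h2]|[psi [h1 _ h2]]] := rational_dichotomy XP.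
  exists (fun i Q => pair_coord 1 (psi Q) i); split.
  - by move=> i; rewrite /pair_coord; case: (i == ord0) => //; exact: reg_cst.
  - by apply: pair_coord_nz; left; exact: oner_neq0.
  - exact: rational_map_near.
exists (fun i Q => pair_coord (psi Q) 1 i); split.
- by move=> i; rewrite /pair_coord; case: (i == ord0) => //; exact: reg_cst.
- by apply: pair_coord_nz; right; exact: oner_neq0.
- exact: rational_map_pole_near.
Qed.

Lemma rational_map_morphism : is_morphism X (proj_line k) rational_map.
Proof. by apply: local_morphism => // P; exact: rational_local_coords. Qed.

(** The order of f - f(P), or of 1/f at a pole: the ramification index at P of
    the map defined by f. *)
Definition map_order P pi e : Prop :=
  (exists psi, [/\ regular_at X P psi, gen X (fun Q => psi Q = f Q) &
     ordat X P pi e (fun Q => psi Q - psi P)]) \/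
  (exists psi, [/\ regular_at X P psi, gen X (fun Q => psi Q * f Q = 1) &
     psi P = 0 /\ ordat X P pi e psi]).

Lemma map_order_pull P pi e : X P -> map_order P pi e ->
  exists2 t, dvr (proj_line k) (rational_map P) t &
    ordat X P pi e (t \o rational_map).
Proof.
move=> XP [[psi [h1 h2 h3]]|[psi [h1 h2 [p0 h3]]]].
  have nz Q : exists i, pair_coord 1 (psi Q) i != 0.
    by apply: pair_coord_nz; left; exact: oner_neq0.
  have ij : ord0 != lift ord0 ord0 :> 'I_2 by [].
  have [c c0 ec] := hcoord_pt (nz P).
  have eP := rational_mapE h1 h2.
  have Pi : hcoord (rational_map P) ord0 != 0 by rewrite eP ec mulf_neq0 ?oner_neq0.
  eexists; first exact: (proj_line_dvr ij Pi).
  case: h3 => u [g1 g2 g3]; exists u; split=> //.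
  apply: near_map2 g3 (rational_map_near h1 h2) => Q _ e1 e2.
  have [c' c0' ec'] := hcoord_pt (nz Q).
  rewrite /= e2 eP ec ec' -e1 /pair_coord /= !mulr1.
  by field; rewrite c0 c0'.
have nz Q : exists i, pair_coord (psi Q) 1 i != 0.
  by apply: pair_coord_nz; right; exact: oner_neq0.
have ij : lift ord0 ord0 != ord0 :> 'I_2 by [].
have [c c0 ec] := hcoord_pt (nz P).
have eP := rational_map_pole h1 h2.
have Pi : hcoord (rational_map P) (lift ord0 ord0) != 0.
  by rewrite eP ec mulf_neq0 ?oner_neq0.
eexists; first exact: (proj_line_dvr ij Pi).
case: h3 => u [g1 g2 g3]; exists u; split=> //.
apply: near_map2 g3 (rational_map_pole_near h1 h2) => Q _ e1 e2.
have [c' c0' ec'] := hcoord_pt (nz Q).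
rewrite /= e2 eP ec ec' -e1 /pair_coord /= !mulr1 p0.
by field; rewrite c0 c0'.
Qed.

Lemma map_order_ramification P pi e : param X P pi -> map_order P pi e ->
  ramification_index X (proj_line k) rational_map P e.
Proof.
move=> hp mo; have XP := reg_mem (param_reg hp).
have [t ht ot] := map_order_pull XP mo; have [phi lc] := rational_local_coords XP.
apply: (ramification_order irrX hp ht _ _ ot) => [a|A].
- exact: pull_reg lc _.
- by move=> h; apply: pull_near lc h _.
Qed.

Lemma map_order_etale P pi : param X P pi -> map_order P pi 1 ->
  etale_at X (proj_line k) rational_map P.
Proof.
move=> hp mo; have XP := reg_mem (param_reg hp).
have [t ht ot] := map_order_pull XP mo; have [phi lc] := rational_local_coords XP.
apply: (etale_order1 irrX hp ht _ _ ot) => [a|A|//].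
- exact: pull_reg lc _.
- by move=> h; apply: pull_near lc h _.
Qed.

End RationalMap.

(** * Finiteness *)

Lemma linear_vspace (k : fieldType) r (I : 'rV[k]_r -> Prop) :
  I 0 -> (forall a u v, I u -> I v -> I (u + a *: v)) ->
  exists J : {vspace 'rV[k]_r}, forall v, I v <-> v \in J.
Proof.
move=> I0 Il.
have ex : exists d, `[< exists2 J : {vspace 'rV[k]_r}, \dim J = d &
    forall v, v \in J -> I v >].
  exists 0%N; apply/asboolP; exists 0%VS; first exact: dimv0.
  by move=> v; rewrite memv0 => /eqP ->.
have bd d : `[< exists2 J : {vspace 'rV[k]_r}, \dim J = d &
    forall v, v \in J -> I v >] -> (d <= \dim {:'rV[k]_r})%N.
  by move/asboolP => [J <- _]; rewrite dimvS // subvf.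
case: (ex_maxnP ex bd) => d /asboolP [J dJ JI] dmax.
exists J => v; split=> [Iv|]; last exact: JI.
apply: contraT => nv.
suff : (\dim (J + <[v]>) <= d)%N.
  rewrite dimv_disjoint_sum.
    rewrite dim_vline dJ; case: eqP nv => [->|_ _]; first by rewrite mem0v.
    by rewrite addn1 ltnn.
  apply/eqP; rewrite -subv0; apply/subvP => w; rewrite memv_cap memv0.
  case/andP=> wJ /vlineP [c ew]; move: wJ; rewrite ew.
  case: (eqVneq c 0) => [->|c0]; first by rewrite scale0r.
  by move=> cv; move: nv; rewrite -(scalerK c0 v) memvZ.
apply: dmax; apply/asboolP; exists (J + <[v]>)%VS => // w /memv_addP.
by case=> u uJ [x /vlineP [c ->] ->]; apply: Il => //; exact: JI.
Qed.

Section Finite.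
Variables (k : closedFieldType) (n m : nat) (X : set (projsp k n)).
Variables (V : set (projsp k m)) (h : projsp k n -> projsp k m).
Hypothesis irrX : irreducible X.
Hypothesis dvrX : forall P, X P -> exists pi, dvr X P pi.
Hypothesis constX : forall f,
  (forall P, X P -> exists c, rational_value X f P c) ->
  exists c, gen X (fun Q => f Q = c).
Let U := X `&` h @^-1` V.
Hypothesis oU : open_in X U.
Hypothesis U0 : U !=set0.
Variables (r : nat) (s : 'I_r -> projsp k n) (theta : projsp k n -> k).
Hypothesis covU : forall P, X P -> U P \/ exists i, P = s i.
Hypothesis theta_param : forall i,
  exists2 pi, param X (s i) pi & gen X (fun Q => pi Q = theta Q).
Variable F : projsp k m -> k.
Hypothesis regF : regular_on V F.
Hypothesis regFh : regular_on U (F \o h).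
Hypothesis F_theta : gen X (fun Q => F (h Q) * theta Q = 1).

Let rv f i c := rational_value X f (s i) c.

Lemma rv_gen f g i c : gen X (fun Q => f Q = g Q) -> rv f i c -> rv g i c.
Proof.
move=> e [psi h1 [h2 h3]]; exists psi => //; split=> //.
by apply: (gen_map2 irrX _ e h2) => Q _ <-.
Qed.

Lemma rv_ext f g i c : f =1 g -> rv f i c -> rv g i c.
Proof. by move/funext=> ->. Qed.

Lemma rv_lin f g i c d a :
  rv f i c -> rv g i d -> rv (fun Q => f Q + a * g Q) i (c + a * d).
Proof.
move=> [psi h1 [h2 h3]] [phi g1 [g2 g3]]; have Xs := reg_mem h1.
exists (fun Q => psi Q + a * phi Q).
  by apply: reg_add => //; apply: reg_mul => //; exact: reg_cst.
split; last by rewrite h3 g3.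
by apply: (gen_map2 irrX _ h2 g2) => Q _ -> ->.
Qed.

Lemma rv0 i : rv (fun=> 0) i 0.
Proof.
have [pi hp _] := theta_param i.
have Xs := reg_mem (param_reg hp).
exists (fun=> 0); first exact: reg_cst.
by split=> //; apply: (@near_gen _ _ X (s i)); exact: near_all.
Qed.

Lemma rv_sum (I : Type) (l : seq I) f c i :
  (forall j, rv (f j) i (c j)) ->
  rv (fun Q => \sum_(j <- l) f j Q) i (\sum_(j <- l) c j).
Proof.
move=> H; elim: l => [|j l IH].
  by rewrite big_nil; apply: rv_ext (rv0 i) => Q; rewrite big_nil.
rewrite big_cons; have := rv_lin 1 (H j) IH; rewrite mul1r.
by apply: rv_ext => Q; rewrite big_cons mul1r.
Qed.

Lemma rv_down f i d : rv (fun Q => f Q * theta Q ^+ d.+1) i 0 ->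
  exists c, rv (fun Q => f Q * theta Q ^+ d) i c.
Proof.
move=> [psi h1 [h2 h3]]; have [pi hp ep] := theta_param i.
have [g hg eg] := param_max hp h1 h3.
exists (g (s i)), g => //; split=> //.
have pnz := reg_gen_neq0 irrX (param_reg hp) (param_nz hp).
apply: (gen_map2 irrX _ (gen_and irrX h2 ep) (gen_and irrX pnz (near_gen eg))).
move=> Q _ [e1 e2] [p0 e3]; apply: (mulfI p0).
by rewrite -e3 e1 -e2 exprS mulrCA.
Qed.

Lemma rv_up f i d c : rv (fun Q => f Q * theta Q ^+ d) i c ->
  rv (fun Q => f Q * theta Q ^+ d.+1) i 0.
Proof.
move=> [psi h1 [h2 h3]]; have [pi hp ep] := theta_param i.
exists (fun Q => psi Q * pi Q); first by apply: reg_mul => //; exact: param_reg hp.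
split; last by rewrite (param_0 hp) mulr0.
by apply: (gen_map2 irrX _ h2 ep) => Q _ -> ->; rewrite exprSr mulrA.
Qed.

Lemma rv_mulF f i d e c : rv (fun Q => f Q * theta Q ^+ d) i c ->
  rv (fun Q => F (h Q) ^+ e * f Q * theta Q ^+ (d + e)) i c.
Proof.
apply: rv_gen; apply: gen_sub F_theta => Q _ e1.
have -> : F (h Q) ^+ e * f Q * theta Q ^+ (d + e) =
  f Q * theta Q ^+ d * (F (h Q) * theta Q) ^+ e.
  by rewrite exprD exprMn; ring.
by rewrite e1 expr1n mulr1.
Qed.

Lemma regU f P : regular_on U f -> U P -> regular_at X P f.
Proof. by move=> rf UP; apply/(reg_openE f oU UP); exact: rf. Qed.

(** The functions on U with poles of order at most d at the points s i. *)
Let poles d f := regular_on U f /\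
  forall i, exists c, rv (fun Q => f Q * theta Q ^+ d) i c.

Lemma rv_le d e f i : (d <= e)%N ->
  (exists c, rv (fun Q => f Q * theta Q ^+ d) i c) ->
  exists c, rv (fun Q => f Q * theta Q ^+ e) i c.
Proof.
move=> le H; rewrite -(subnKC le).
elim: (e - d)%N => [|j [c IH]]; first by rewrite addn0.
by exists 0; rewrite addnS; exact: rv_up IH.
Qed.

Lemma poles_bounded f : regular_on U f -> exists d, poles d f.
Proof.
move=> rf.
have H i : exists d, exists c, rv (fun Q => f Q * theta Q ^+ d) i c.
  have [w hw ew] := theta_param i.
  have Xs : X (s i) := reg_mem (param_reg hw).
  have ratf : exists P, regular_at X P f.
    by case: U0 => P UP; exists P; exact: regU.
  have [[psi h1 h2]|[psi [h1 h2 h3]]] := rational_dichotomy irrX dvrX ratf Xs.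
    exists 0%N, (psi (s i)), psi => //; split=> //.
    by apply: gen_sub h2 => Q _ ->; rewrite mulr1.
  have [pi [hp dp]] := dvrX Xs.
  have [z|[e [u [hu u0 eu]]]] := dp _ h1.
    have [Q _ [e1 e2]] := gen_ex (gen_and irrX (near_gen z) h3).
    by move/eqP: e2; rewrite e1 mul0r eq_sym oner_eq0.
  have [g hg eg] := param_max hp (param_reg hw) (param_0 hw).
  exists e, (g (s i) ^+ e / u (s i)), (fun Q => g Q ^+ e / u Q).
    by apply: reg_div => //; exact: reg_exp.
  split=> //.
  have g1 := near_gen (near_and eu (near_and (reg_neq0 hu u0) eg)).
  apply: (gen_map2 irrX _ (gen_and irrX g1 ew) h3).
  move=> Q _ [[e1 [uQ e2]] e3] e4; rewrite -e3 e2 exprMn.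
  apply: (mulIf uQ); rewrite divfK // -[LHS]mul1r -e4 e1.
  by move: (_ ^+ _) (f Q) (g Q ^+ e) (u Q) => *; ring.
have [d hd] := choice H.
exists (\max_i d i); split=> // i.
by apply: rv_le (hd i); exact: leq_bigmax.
Qed.

Lemma poles0_cst f : poles 0 f -> exists c, forall P, U P -> f P = c.
Proof.
move=> [rf H]; have [|c hc] := constX (f := f).
  move=> P XP; case: (covU XP) => [UP|[i ->]].
    exists (f P), f; first exact: regU.
    by split=> //; apply: (@near_gen _ _ X P); exact: near_all.
  have [c hc] := H i; exists c; apply: rv_ext hc => Q; exact: mulr1.
exists c => P UP; have := gen_reg irrX (regU rf UP) (reg_cst c UP.1) hc.
by move/near_pt.
Qed.

(** The leading coefficients at the points s i of the functions with poles of
    order at most d. *)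
Let lead d (v : 'rV[k]_r) := exists2 f, regular_on U f &
  forall i, rv (fun Q => f Q * theta Q ^+ d) i (v 0 i).

Lemma regU_sum (I : Type) (l : seq I) (f : I -> projsp k n -> k) :
  (forall j, regular_on U (f j)) -> regular_on U (fun Q => \sum_(j <- l) f j Q).
Proof. by move=> H P UP; apply: reg_sum => // j; exact: H. Qed.

Lemma lead_vspace d : exists J : {vspace 'rV[k]_r}, forall v, lead d v <-> v \in J.
Proof.
apply: linear_vspace.
  exists (fun=> 0) => [P UP|i]; first exact: reg_cst.
  by rewrite mxE; apply: rv_ext (rv0 i) => Q; rewrite mul0r.
move=> a u v [f rf hf] [g rg hg]; exists (fun Q => f Q + a * g Q).
  move=> P UP; apply: reg_add; first exact: rf.
  by apply: reg_mul; [exact: reg_cst | exact: rg].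
move=> i; rewrite !mxE; apply: rv_ext (rv_lin a (hf i) (hg i)) => Q.
by rewrite mulrDl mulrA.
Qed.

Lemma lead_up d v : lead d v -> lead d.+1 v.
Proof.
move=> [f rf hf]; exists (fun Q => F (h Q) ^+ 1 * f Q).
  by move=> P UP; apply: reg_mul; [exact/reg_exp/regFh | exact: rf].
by move=> i; have := rv_mulF 1 (hf i); rewrite addn1.
Qed.

Let span (bs : seq (projsp k n -> k)) f := exists2 a : nat -> projsp k m -> k,
  forall i, regular_on V (a i) & forall P, U P ->
    f P = \sum_(i < size bs) a i (h P) * nth (fun=> 0) bs i P.

Lemma span_add bs f g : span bs f -> span bs g -> span bs (fun Q => f Q + g Q).
Proof.
move=> [a ra ea] [b rb eb]; exists (fun i Q => a i Q + b i Q).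
  by move=> i Q VQ; apply: reg_add; [exact: ra | exact: rb].
move=> P UP; rewrite ea // eb // -big_split; apply: eq_bigr => i _.
by rewrite /= mulrDl.
Qed.

Lemma span_scale bs f c : regular_on V c -> span bs f ->
  span bs (fun Q => c (h Q) * f Q).
Proof.
move=> rc [a ra ea]; exists (fun i Q => c Q * a i Q).
  by move=> i Q VQ; apply: reg_mul; [exact: rc | exact: ra].
move=> P UP; rewrite ea // mulr_sumr; apply: eq_bigr => i _.
by rewrite mulrA.
Qed.

Lemma span_mem bs i : (i < size bs)%N -> span bs (nth (fun=> 0) bs i).
Proof.
move=> lt; exists (fun j _ => (j == i)%:R).
  by move=> j Q VQ; exact: reg_cst.
move=> P UP; rewrite (bigD1 (Ordinal lt)) //= eqxx mul1r big1 ?addr0 // => j.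
by rewrite -val_eqE /= => /negPf ->; rewrite mul0r.
Qed.

Lemma span_ext bs f g : (forall P, U P -> f P = g P) -> span bs f -> span bs g.
Proof. by move=> e [a ra ea]; exists a => // P UP; rewrite -e // ea. Qed.

Lemma span_sum bs (I : Type) (l : seq I) f :
  (forall j, span bs (f j)) -> span bs (fun Q => \sum_(j <- l) f j Q).
Proof.
move=> H; elim: l => [|j l IH].
  exists (fun _ _ => 0) => [i Q VQ|P UP]; first exact: reg_cst.
  by rewrite big_nil big1 // => i _; rewrite mul0r.
by apply: span_ext (span_add (H j) IH) => P UP; rewrite big_cons.
Qed.

(** The regular functions on U are filtered by the order of their poles at the
    points s i. Multiplication by F embeds the space of leading coefficients
    of each step into that of the next one, so these spaces are eventually
    constant, and finitely many functions generate. *)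
Theorem finite_by_poles : finite_over U V h.
Proof.
have [J hJ] := choice lead_vspace.
have Jup d e : (d <= e)%N -> (J d <= J e)%VS.
  move=> le; rewrite -(subnKC le); elim: (e - d)%N => [|j IH].
    by rewrite addn0.
  rewrite addnS; apply: subv_trans IH _; apply/subvP => v /hJ /lead_up.
  by move/hJ.
have [M hM] : exists M, forall d, (M <= d)%N -> J d = J M.
  have ex : exists d, `[< exists M, \dim (J M) = d >].
    by exists (\dim (J 0)); apply/asboolP; exists 0%N.
  have bd d : `[< exists M, \dim (J M) = d >] -> (d <= \dim {:'rV[k]_r})%N.
    by move/asboolP => [N <-]; rewrite dimvS // subvf.
  case: (ex_maxnP ex bd) => d /asboolP [M dM] dmax; exists M => e le.
  apply/eqP; rewrite eq_sym eqEdim Jup //= dM; apply: dmax.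
  by apply/asboolP; exists e.
have ex_g d : exists g : 'rV[k]_r -> projsp k n -> k, forall v, v \in J d ->
    regular_on U (g v) /\ forall i, rv (fun Q => g v Q * theta Q ^+ d) i (v 0 i).
  suff H v : exists f, v \in J d -> regular_on U f /\
      forall i, rv (fun Q => f Q * theta Q ^+ d) i (v 0 i).
    by have [g hg] := choice H; exists g.
  case: (boolP (v \in J d)) => [/hJ [f rf hf]|_]; first by exists f.
  by exists (fun=> 0).
have [g hg] := choice ex_g.
(* The constant 1 generates the step 0 of the filtration. *)
pose bs := (fun=> 1) :: flatten [seq [seq g d v | v <- vbasis (J d)] | d <- iota 0 M.+1].
have bs_mem d (l : 'I_(\dim (J d))) : (d <= M)%N -> exists2 i, (i < size bs)%N &
    nth (fun=> 0) bs i = g d (vbasis (J d))`_l.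
  move=> dM.
  have : forall N, (d < N)%N -> exists2 i,
    (i < size (flatten [seq [seq g d v | v <- vbasis (J d)] | d <- iota 0 N]))%N &
    nth (fun=> 0) (flatten [seq [seq g d v | v <- vbasis (J d)] | d <- iota 0 N]) i
      = g d (vbasis (J d))`_l.
    elim=> // N IH; rewrite ltnS leq_eqVlt -(addn1 N) iotaD map_cat flatten_cat /=.
    rewrite cats0 size_cat; case/orP => [/eqP eN|/IH [i lt <-]]; last first.
      by exists i; [exact: leq_trans (leq_addr _ _) | rewrite nth_cat lt].
    rewrite -eN; exists (size (flatten [seq [seq g d v | v <- vbasis (J d)] |
      d <- iota 0 d]) + l)%N.
      by rewrite ltn_add2l size_map size_tuple.
    rewrite nth_cat ltnNge leq_addr /= addKn (nth_map 0) // size_tuple //.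
  by move/(_ M.+1 dM) => [i lt e]; exists i.+1.
have gen_f : forall d f, poles d f -> span bs f.
  elim=> [|d IH] f.
    case/poles0_cst => c hc.
    apply: (span_ext (f := fun Q => c * nth (fun=> 0) bs 0 Q)).
      by move=> P UP; rewrite hc //= mulr1.
    apply: (@span_scale bs _ (fun=> c)); last exact: span_mem.
    by move=> Q VQ; exact: reg_cst.
  move=> [rf hf]; have [c hc] := choice hf.
  pose v : 'rV[k]_r := \row_i c i.
  have vJ : v \in J d.+1.
    by apply/hJ; exists f => // i; rewrite mxE.
  (* From step M on, powers of F carry the leading coefficients up. *)
  pose e := minn d.+1 M.
  have eM : (e <= M)%N by exact: geq_minr.
  have ed : (e <= d.+1)%N by exact: geq_minl.
  have vJe : v \in J e.
    rewrite /e /minn; case: (ltnP d.+1 M) => // le.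
    by rewrite -(hM _ le).
  pose b l := (vbasis (J e))`_l.
  have bJ l : (l < \dim (J e))%N -> b l \in J e.
    by move=> lt; apply: vbasis_mem; rewrite mem_nth // size_tuple.
  pose a (l : 'I_(\dim (J e))) := coord (vbasis (J e)) l v.
  pose w (l : 'I_(\dim (J e))) Q := F (h Q) ^+ (d.+1 - e) * g e (b l) Q.
  have rw l : regular_on U (w l).
    move=> P UP; apply: reg_mul; first exact/reg_exp/regFh.
    by have [] := hg e _ (bJ l (ltn_ord l)); move/(_ _ UP).
  pose S Q := \sum_l a l * w l Q.
  have rS : regular_on U S.
    by apply: regU_sum => l P UP; apply: reg_mul; [exact: reg_cst | exact: rw].
  have hS i : rv (fun Q => S Q * theta Q ^+ d.+1) i (v 0 i).
    have -> : v 0 i = \sum_l a l * b l 0 i.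
      rewrite {1}(coord_vbasis vJe) summxE; apply: eq_bigr => l _.
      by rewrite mxE.
    apply: rv_ext (rv_sum (index_enum _) (f := fun l Q => a l * (w l Q * theta Q ^+ d.+1)) _).
      by move=> Q; rewrite /S mulr_suml; apply: eq_bigr => l _; rewrite mulrA.
    move=> l; have [_ /(_ i) H] := hg e _ (bJ l (ltn_ord l)).
    have := rv_lin (a l) (rv0 i) (rv_mulF (d.+1 - e) H).
    by rewrite add0r; apply: rv_ext => Q; rewrite add0r subnKC.
  have hd : poles d (fun Q => f Q + (-1) * S Q).
    split.
      move=> P UP; apply: reg_add; first exact: rf.
      by apply: reg_mul; [exact: reg_cst | exact: rS].
    move=> i; apply: rv_down.
    have := rv_lin (-1) (hc i) (hS i).
    rewrite mxE mulN1r subrr; apply: rv_ext => Q.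
    by rewrite mulrDl mulrA.
  apply: (span_ext (f := fun Q => (f Q + (-1) * S Q) + S Q)).
    by move=> P _; rewrite mulN1r subrK.
  apply: span_add (IH _ hd) _; apply: span_sum => l.
  have [i lt ei] := bs_mem e l eM.
  apply: (span_ext (f := fun Q => (a l * F (h Q) ^+ (d.+1 - e)) * nth (fun=> 0) bs i Q)).
    by move=> P _; rewrite ei /w mulrA.
  apply: (@span_scale bs _ (fun R => a l * F R ^+ (d.+1 - e))); last exact: span_mem.
  by move=> Q VQ; apply: reg_mul; [exact: reg_cst | exact/reg_exp/regF].
exists (size bs), (fun i => nth (fun=> 0) bs i); split.
  move=> i; suff : forall j, regular_on U (nth (fun=> 0) bs j) by [].
  case=> [|j]; first by move=> P UP; exact: reg_cst.
  change (regular_on U (nth (fun=> 0)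
    (flatten [seq [seq g d v | v <- vbasis (J d)] | d <- iota 0 M.+1]) j)).
  elim: (iota 0 M.+1) j => [|d l IH] j /=; first by case: j => [|j] P UP; exact: reg_cst.
  rewrite nth_cat size_map size_tuple; case: ltnP => lt; last exact: IH.
  rewrite (nth_map 0) ?size_tuple //.
  by case: (hg d (vbasis (J d))`_j) => //; apply: vbasis_mem; rewrite mem_nth // size_tuple.
move=> f rf; have [d hd] := poles_bounded rf.
by have [a ra ea] := gen_f _ _ hd; exists (fun i => a i).
Qed.

End Finite.

(** * Regular functions near a point of projective space *)

Section Taylor.
Variables (k : fieldType) (n : nat) (X : set (projsp k n)).
Variables (P : projsp k n) (l : 'I_n.+1).
Hypotheses (XP : X P) (Pl : hcoord P l != 0).

Let chart i (Q : projsp k n) := hcoord Q i / hcoord Q l.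

Lemma chart_reg i : regular_at X P (chart i).
Proof. exact: (reg_form XP (form_var k i) (form_var k l)). Qed.

(** A Taylor expansion of order one, which replaces differentiation of forms. *)
Lemma form_taylor d phi : isform d phi -> exists c A,
  (forall i, regular_at X P (A i)) /\
  near X P (fun Q => phi (hcoord Q) / hcoord Q l ^+ d =
    c + \sum_i (chart i Q - chart i P) * A i Q).
Proof.
move: d phi; apply: form_ind.
- move=> c; exists c, (fun _ _ => 0); split=> [i|]; first exact: reg_cst.
  by apply: near_all => // Q _; rewrite big1 ?divr1 ?addr0 // => i _; rewrite mulr0.
- move=> d; exists 0, (fun _ _ => 0); split=> [i|]; first exact: reg_cst.
  apply: near_all => // Q _; rewrite mul0r big1 ?addr0 // => i _.
  by rewrite mulr0.
- move=> d j phi _ [c [A [rA eA]]].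
  exists (chart j P * c), (fun i Q => chart j Q * A i Q + c * (i == j)%:R); split.
    move=> i; apply: reg_add; last exact: reg_cst.
    by apply: reg_mul; [exact: chart_reg|].
  apply: near_map2 eA (near_form XP (form_var k l) Pl) => Q _ e Ql.
  have -> : hcoord Q j * phi (hcoord Q) / hcoord Q l ^+ d.+1 =
    chart j Q * (phi (hcoord Q) / hcoord Q l ^+ d).
    by rewrite exprS /chart; field; rewrite Ql expf_neq0.
  rewrite e.
  have -> : \sum_i (chart i Q - chart i P) * (chart j Q * A i Q + c * (i == j)%:R) =
    chart j Q * (\sum_i (chart i Q - chart i P) * A i Q) +
    (chart j Q - chart j P) * c.
    under eq_bigr => i _ do rewrite mulrDr.
    rewrite big_split /= mulr_sumr; congr (_ + _).
      by apply: eq_bigr => i _; rewrite mulrCA.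
    rewrite (bigD1 j) //= eqxx mulr1 big1 ?addr0 // => i /negPf ->.
    by rewrite !mulr0.
  by ring.
- move=> d phi psi _ _ [c [A [rA eA]]] [c' [A' [rA' eA']]].
  exists (c + c'), (fun i Q => A i Q + A' i Q); split=> [i|]; first exact: reg_add.
  apply: near_map2 eA eA' => Q _ e e'; rewrite mulrDl e e' addrACA -big_split.
  by congr (_ + _); apply: eq_bigr => i _; rewrite mulrDr.
Qed.

(** The differences of affine coordinates generate the maximal ideal. *)
Lemma max_chart f : regular_at X P f -> f P = 0 -> exists2 B,
  forall i, regular_at X P (B i) &
  near X P (fun Q => f Q = \sum_i (chart i Q - chart i P) * B i Q).
Proof.
move=> /regularP [d [a [b [ha hb b0 ef]]]] f0.
have [c [A [rA eA]]] := form_taylor ha.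
have ld : isform d (fun v : 'I_n.+1 -> k => v l ^+ d) := form_varX k l d.
have c0 : c = 0.
  have := near_pt eA; rewrite big1 ?addr0 => [<-|i _]; last by rewrite subrr mul0r.
  move: f0; rewrite (near_pt ef) => /eqP.
  by rewrite mulf_eq0 invr_eq0 (negPf b0) orbF => /eqP ->; rewrite mul0r.
exists (fun i Q => A i Q * (hcoord Q l ^+ d / b (hcoord Q))).
  by move=> i; apply: reg_mul => //; exact: (reg_form XP ld hb b0).
apply: near_map2 (near_and ef eA) (near_form XP (form_var k l) Pl).
move=> Q _ [-> e] Ql; rewrite c0 add0r in e.
under eq_bigr => i _ do rewrite mulrA.
rewrite -mulr_suml -e mulrA divfK //.
by rewrite expf_neq0.
Qed.

(** It suffices to divide the differences of affine coordinates by pi. *)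
Lemma param_chart pi g : regular_at X P pi -> pi P = 0 ->
  ~ near X P (fun Q => pi Q = 0) ->
  (forall i, regular_at X P (g i) /\
     near X P (fun Q => chart i Q - chart i P = pi Q * g i Q)) ->
  param X P pi.
Proof.
move=> rpi p0 pnz hg; split=> // f rf f0; have [B rB eB] := max_chart rf f0.
exists (fun Q => \sum_i g i Q * B i Q).
  by apply: reg_sum => // i; apply: reg_mul => //; case: (hg i).
have hall : near X P (fun Q => forall i, chart i Q - chart i P = pi Q * g i Q).
  have : forall s : seq 'I_n.+1, near X P (fun Q => forall i, i \in s ->
      chart i Q - chart i P = pi Q * g i Q).
    elim=> [|i s IH]; first exact: near_all.
    apply: near_map2 IH (hg i).2 => Q _ e1 e2 j.
    by rewrite inE => /orP [/eqP ->|/e1].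
  by move/(_ (enum 'I_n.+1)); apply: near_sub => Q _ e i; apply: e; rewrite mem_enum.
apply: near_map2 eB hall => Q _ -> e; rewrite mulr_sumr.
by apply: eq_bigr => i _; rewrite e mulrA.
Qed.

End Taylor.

(** * Weierstrass curves *)

(* Sizes of the same polynomial at different structures are identified before
   the arithmetic. *)
Ltac size_lia :=
  repeat match goal with H : context [size _] |- _ => revert H end;
  repeat match goal with |- context [size (polyseq ?p)] =>
    let n := fresh "n" in move: (size p) => n end;
  lia.

Lemma ord3_cases (i : 'I_3) : [\/ i = inord 0, i = inord 1 | i = inord 2].
Proof.
case: i => [[|[|[|i]]] hi] //.
- by apply: Or31; apply: val_inj; rewrite /= inordK.
- by apply: Or32; apply: val_inj; rewrite /= inordK.
- by apply: Or33; apply: val_inj; rewrite /= inordK.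
Qed.

Section Weierstrass.
Variables (k : closedFieldType) (W : weierstrass k).
Let a1 := wa1 W.
Let a2 := wa2 W.
Let a3 := wa3 W.
Let a4 := wa4 W.
Let a6 := wa6 W.
Let X := wcurve W.
Let i0 : 'I_3 := inord 0.
Let i1 : 'I_3 := inord 1.
Let i2 : 'I_3 := inord 2.

Let I3 i : [\/ i = i0, i = i1 | i = i2] := ord3_cases i.

Let i01 : (i0 == i1) = false. Proof. by rewrite -val_eqE /= !inordK. Qed.
Let i02 : (i0 == i2) = false. Proof. by rewrite -val_eqE /= !inordK. Qed.
Let i12 : (i1 == i2) = false. Proof. by rewrite -val_eqE /= !inordK. Qed.
Let i10 : (i1 == i0) = false. Proof. by rewrite eq_sym i01. Qed.
Let i20 : (i2 == i0) = false. Proof. by rewrite eq_sym i02. Qed.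
Let i21 : (i2 == i1) = false. Proof. by rewrite eq_sym i12. Qed.

Definition triple_coord (a b c : k) : 'I_3 -> k :=
  fun i => if i == inord 0 then a else if i == inord 1 then b else c.

Lemma triple0 a b c : triple_coord a b c (inord 0) = a.
Proof. by rewrite /triple_coord eqxx. Qed.
Lemma triple1 a b c : triple_coord a b c (inord 1) = b.
Proof. by rewrite /triple_coord i10 eqxx. Qed.
Lemma triple2 a b c : triple_coord a b c (inord 2) = c.
Proof. by rewrite /triple_coord i20 i21. Qed.
Let tripleE := (triple0, triple1, triple2).

Definition weq x y := y ^+ 2 + a1 * x * y + a3 * y =
  x ^+ 3 + a2 * x ^+ 2 + a4 * x + a6.

Definition xcoord (P : projsp k 2) := hcoord P i0 / hcoord P i2.
Definition ycoord (P : projsp k 2) := hcoord P i1 / hcoord P i2.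
Definition affine_pt x y := pt (triple_coord x y 1).
Definition origin := pt (triple_coord 0 1 0).

Lemma triple_nz1 x y : exists i, triple_coord x y 1 i != 0.
Proof. by exists i2; rewrite tripleE oner_neq0. Qed.

Lemma origin_nz : exists i, triple_coord 0 1 0 i != 0.
Proof. by exists i1; rewrite tripleE oner_neq0. Qed.

Lemma wcurve_affine P : X P -> hcoord P i2 != 0 -> weq (xcoord P) (ycoord P).
Proof.
rewrite /X /wcurve /= -/i0 -/i1 -/i2 -/a1 -/a2 -/a3 -/a4 -/a6 => e z0.
rewrite /weq /xcoord /ycoord; apply: (mulIf (expf_neq0 3 z0)).
transitivity (hcoord P i1 ^+ 2 * hcoord P i2 + a1 * hcoord P i0 * hcoord P i1 *
  hcoord P i2 + a3 * hcoord P i1 * hcoord P i2 ^+ 2); first by field.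
by rewrite e; field.
Qed.

Lemma affine_pt_in x y : weq x y -> X (affine_pt x y).
Proof.
rewrite /weq /X /wcurve /= => e; have [c c0 ->] := hcoord_pt (triple_nz1 x y).
rewrite !tripleE -/a1 -/a2 -/a3 -/a4 -/a6.
transitivity (c ^+ 3 * (y ^+ 2 + a1 * x * y + a3 * y)); first by ring.
by rewrite e; ring.
Qed.

Lemma affine_pt_z x y : hcoord (affine_pt x y) i2 != 0.
Proof.
have [c c0 ->] := hcoord_pt (triple_nz1 x y).
by rewrite tripleE mulr1.
Qed.

Lemma xcoord_pt x y : xcoord (affine_pt x y) = x.
Proof.
rewrite /xcoord; have [c c0 ->] := hcoord_pt (triple_nz1 x y).
by rewrite !tripleE mulr1 mulrAC divff ?mul1r.
Qed.

Lemma ycoord_pt x y : ycoord (affine_pt x y) = y.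
Proof.
rewrite /ycoord; have [c c0 ->] := hcoord_pt (triple_nz1 x y).
by rewrite !tripleE mulr1 mulrAC divff ?mul1r.
Qed.

Lemma hcoord_affine P : hcoord P i2 != 0 ->
  hcoord P = fun i => hcoord P i2 * triple_coord (xcoord P) (ycoord P) 1 i.
Proof.
move=> z0; apply/funext => i; rewrite /xcoord /ycoord.
by case: (I3 i) => ->; rewrite tripleE ?mulr1 // mulrC divfK.
Qed.

Lemma affine_ptE P : hcoord P i2 != 0 -> P = affine_pt (xcoord P) (ycoord P).
Proof.
move=> z0; apply/esym.
rewrite /affine_pt -(pt_scale (triple_nz1 _ _) z0) -hcoord_affine //.
exact: pt_hcoord.
Qed.

Lemma form_affine d phi P : isform d phi -> hcoord P i2 != 0 ->
  phi (hcoord P) = hcoord P i2 ^+ d * phi (triple_coord (xcoord P) (ycoord P) 1).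
Proof.
by move=> hp z0; rewrite {1}(hcoord_affine z0) (form_homog hp).
Qed.

Lemma origin_in : X origin.
Proof.
rewrite /X /wcurve /=; have [c c0 ->] := hcoord_pt origin_nz.
by rewrite !tripleE; ring.
Qed.

Lemma originP P : X P -> hcoord P i2 = 0 -> P = origin.
Proof.
rewrite /X /wcurve /= -/i0 -/i1 -/i2 => e z0.
have /eqP : hcoord P i0 ^+ 3 = 0.
  transitivity (hcoord P i0 ^+ 3 + a2 * hcoord P i0 ^+ 2 * hcoord P i2 +
    a4 * hcoord P i0 * hcoord P i2 ^+ 2 + a6 * hcoord P i2 ^+ 3).
    by rewrite z0; ring.
  by rewrite -e z0; ring.
rewrite expf_eq0 /= => /eqP x0.
have y0 : hcoord P i1 != 0.
  have [i] := hcoord_neq0 P; case: (I3 i) => -> //; by rewrite ?x0 ?z0 eqxx.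
apply/esym; apply: (pt_eq (c := (hcoord P i1)^-1)); first by rewrite invr_eq0.
by move=> i; case: (I3 i) => ->; rewrite tripleE ?x0 ?z0 ?mulr0 ?mulVf.
Qed.

Lemma wcurve_cases P : X P ->
  P = origin \/ exists x y, [/\ weq x y, P = affine_pt x y & hcoord P i2 != 0].
Proof.
move=> XP; case: (eqVneq (hcoord P i2) 0) => [z0|z0]; [left|right].
  exact: originP.
exists (xcoord P), (ycoord P); split=> //; [exact: wcurve_affine | exact: affine_ptE].
Qed.

Lemma origin_y : hcoord origin i1 != 0.
Proof.
have [c c0 ->] := hcoord_pt origin_nz.
by rewrite tripleE mulr1.
Qed.

Lemma quadratic_root (a b : k) : exists y, y ^+ 2 + a * y = b.
Proof.
have [y hy] := @solve_monicpoly k 2 (nth 0 [:: b; - a]) isT.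
exists y; rewrite hy !big_ord_recr big_ord0 /=; ring.
Qed.

Lemma weq_ex x : exists y, weq x y.
Proof.
have [y hy] := quadratic_root (a1 * x + a3) (x ^+ 3 + a2 * x ^+ 2 + a4 * x + a6).
by exists y; rewrite /weq -hy; ring.
Qed.

Definition conj_y x y := - y - a1 * x - a3.

Lemma weq_conj x y : weq x y -> weq x (conj_y x y).
Proof. by rewrite /weq /conj_y => <-; ring. Qed.

(** The functions on the affine curve are r(x) + s(x) y, conjugate to
    r(x) + s(x) conj_y. *)
Let L : {poly k} := a1 *: 'X + a3%:P.
Let C : {poly k} := 'X^3 + a2 *: 'X^2 + a4 *: 'X + a6%:P.

Let hE := (hornerD, hornerN, hornerM, hornerZ, hornerXn, hornerX, hornerC, horner_exp).

(** The norm of r(x) + s(x) y to k[x]. *)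
Definition norm_poly (r s : {poly k}) : {poly k} := r ^+ 2 - L * r * s - C * s ^+ 2.

Lemma L_horner x : L.[x] = a1 * x + a3.
Proof. by rewrite /L !hE. Qed.

Lemma C_horner x : C.[x] = x ^+ 3 + a2 * x ^+ 2 + a4 * x + a6.
Proof. by rewrite /C !hE. Qed.

Lemma norm_horner r s x y : weq x y ->
  (norm_poly r s).[x] = (r.[x] + s.[x] * y) * (r.[x] + s.[x] * conj_y x y).
Proof.
rewrite /weq => w; rewrite /norm_poly /L /C /conj_y !hE.
move: (r.[x]) (s.[x]) => R S; apply/eqP; rewrite -subr_eq0; apply/eqP.
transitivity (S ^+ 2 * ((y ^+ 2 + a1 * x * y + a3 * y) -
  (x ^+ 3 + a2 * x ^+ 2 + a4 * x + a6))); first by ring.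
by rewrite w subrr mulr0.
Qed.

Lemma size_C : size C = 4%N.
Proof.
rewrite /C -!addrA size_polyDl ?size_polyXn //.
rewrite (leq_ltn_trans (size_polyD _ _)) // gtn_max.
rewrite (leq_ltn_trans (size_scale_leq _ _)) ?size_polyXn //=.
rewrite (leq_ltn_trans (size_polyD _ _)) // gtn_max.
rewrite (leq_ltn_trans (size_scale_leq _ _)) ?size_polyX //=.
by rewrite (leq_ltn_trans (size_polyC_leq1 _)).
Qed.

Lemma size_L : (size L <= 2)%N.
Proof.
rewrite /L (leq_trans (size_polyD _ _)) // geq_max.
rewrite (leq_trans (size_scale_leq _ _)) ?size_polyX //=.
by rewrite (leq_trans (size_polyC_leq1 _)).
Qed.

(** For the pole order at infinity, y has weight 3 and x has weight 2: the terms
   r^2 and C s^2 of the norm have degrees of different parities. *)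
Lemma norm_eq0 r s : norm_poly r s = 0 -> r = 0 /\ s = 0.
Proof.
rewrite /norm_poly => e.
have e1 : r ^+ 2 = L * r * s + C * s ^+ 2.
  by move/eqP: e; rewrite -addrA -opprD subr_eq0 => /eqP.
case: (eqVneq s 0) e1 => [->|s0] e1.
  split=> //; move/eqP: e1; rewrite expr0n /= !mulr0 addr0.
  by rewrite expf_eq0 => /andP [_ /eqP].
exfalso; have C0 : C != 0 by rewrite -size_poly_eq0 size_C.
have sCs : size (C * s ^+ 2) = ((size s).*2 + 2)%N.
  rewrite size_mul ?expf_neq0 // size_C expr2 size_mul //.
  by move: s0; rewrite -size_poly_gt0; size_lia.
have sq : (0 < size s)%N by rewrite size_poly_gt0.
case: (eqVneq r 0) e1 => [->|r0] e1.
  move: e1; rewrite mulr0 mul0r add0r expr0n /= => e1.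
  by move: sCs; rewrite -e1 size_poly0 addn2.
have sr : size (r ^+ 2) = ((size r).*2 - 1)%N.
  by rewrite expr2 size_mul // -addnn subn1.
have sp : (0 < size r)%N by rewrite size_poly_gt0.
have sm : (size (L * r * s)%R <= size r + size s)%N.
  apply: leq_trans (size_polyMleq _ _) _.
  rewrite -subn1 leq_subLR; apply: leq_trans (leq_add (size_polyMleq _ _) (leqnn _)) _.
  have := size_L; size_lia.
case: (leqP (size s + 2) (size r)) => cmp.
  have : (size (r ^+ 2)%R < size (r ^+ 2)%R)%N.
    rewrite {1}e1 (leq_ltn_trans (size_polyD _ _)) // gtn_max sCs sr.
    apply/andP; split; last by size_lia.
    by apply: leq_ltn_trans sm _; size_lia.
  by rewrite ltnn.
have : (size (C * s ^+ 2)%R < size (C * s ^+ 2)%R)%N.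
  have -> : C * s ^+ 2 = r ^+ 2 + - (L * r * s) by rewrite e1; ring.
  rewrite (leq_ltn_trans (size_polyD _ _)) // gtn_max size_polyN sr.
  have -> : r ^+ 2 + - (L * r * s) = C * s ^+ 2 by rewrite e1; ring.
  rewrite sCs; apply/andP; split; first by size_lia.
  by apply: leq_ltn_trans sm _; size_lia.
by rewrite ltnn.
Qed.

(** Functions on the affine curve whose pole at infinity has order less
    than m. *)
Definition weight_lt m (f : k -> k -> k) := exists r s : {poly k},
  [/\ ((size r).*2 <= m.+1)%N, ((size s).*2 <= m - 2)%N &
      forall x y, weq x y -> f x y = r.[x] + s.[x] * y].

Lemma weight_ext m f g : (forall x y, weq x y -> f x y = g x y) ->
  weight_lt m f -> weight_lt m g.
Proof. by move=> e [r [s [h1 h2 h3]]]; exists r, s; split=> // x y w; rewrite -e ?h3. Qed.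

Lemma weight_le m m' f : (m <= m')%N -> weight_lt m f -> weight_lt m' f.
Proof. by move=> le [r [s [h1 h2 h3]]]; exists r, s; split=> //; size_lia. Qed.

Lemma weight_add m f g : weight_lt m f -> weight_lt m g ->
  weight_lt m (fun x y => f x y + g x y).
Proof.
move=> [r [s [h1 h2 h3]]] [r' [s' [g1 g2 g3]]]; exists (r + r'), (s + s'); split.
- by have := size_polyD r r'; size_lia.
- by have := size_polyD s s'; size_lia.
- by move=> x y w; rewrite h3 // g3 // !hornerD; ring.
Qed.

Lemma weight_scale m c f : weight_lt m f -> weight_lt m (fun x y => c * f x y).
Proof.
move=> [r [s [h1 h2 h3]]]; exists (c *: r), (c *: s); split.
- by have := size_scale_leq c r; size_lia.
- by have := size_scale_leq c s; size_lia.
- by move=> x y w; rewrite h3 // !hornerZ; ring.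
Qed.

Lemma weight_x m f : weight_lt m f -> weight_lt m.+2 (fun x y => x * f x y).
Proof.
move=> [r [s [h1 h2 h3]]]; exists ('X * r), ('X * s); split.
- by have := size_polyMleq 'X r; rewrite size_polyX; size_lia.
- case: (eqVneq s 0) => [->|s0]; first by rewrite mulr0 size_poly0.
  by have := size_polyMleq 'X s; rewrite size_polyX; move: s0; rewrite -size_poly_gt0; size_lia.
- by move=> x y w; rewrite h3 // !hornerM hornerX; ring.
Qed.

Lemma weight_y m f : weight_lt m f -> weight_lt m.+3 (fun x y => y * f x y).
Proof.
move=> [r [s [h1 h2 h3]]]; exists (s * C), (r - L * s); split.
- case: (eqVneq s 0) => [->|s0]; first by rewrite mul0r size_poly0.
  by have := size_polyMleq s C; rewrite size_C; move: s0; rewrite -size_poly_gt0; size_lia.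
- have := size_polyD r (- (L * s)); rewrite size_polyN.
  case: (eqVneq s 0) => [->|s0]; first by rewrite mulr0 size_poly0; size_lia.
  have := size_polyMleq L s; have := size_L.
  by move: s0; rewrite -size_poly_gt0; size_lia.
- move=> x y w; rewrite h3 // hornerD hornerN !hornerM L_horner C_horner.
  by move: w; rewrite /weq => <-; ring.
Qed.

Lemma weight_yn d : weight_lt (3 * d).+1 (fun x y => y ^+ d).
Proof.
elim: d => [|d IH].
  exists 1, 0; split; rewrite ?size_poly0 ?size_poly1 // => x y _.
  by rewrite hornerC hornerC mul0r addr0.
apply: (@weight_le (3 * d).+4); first by size_lia.
by apply: weight_ext (weight_y IH) => x y _; rewrite exprS.
Qed.

Lemma norm_weight m (r s : {poly k}) : ((size r).*2 <= m.+1)%N -> ((size s).*2 <= m - 2)%N ->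
  (size (norm_poly r s) <= m)%N.
Proof.
move=> h1 h2; rewrite /norm_poly.
have p1 := size_polyMleq r r.
have p2 := leq_trans (size_polyMleq (L * r) s) (leq_pred _).
have p2' := size_polyMleq (L * r) s.
have p3 := size_polyMleq L r.
have p4 := size_polyMleq C (s ^+ 2); have p5 := size_polyMleq s s.
have p6 := size_L; have p7 := size_C.
have d1 := size_polyD (r ^+ 2) (- (L * r * s)).
have d2 := size_polyD (r ^+ 2 - L * r * s) (- (C * s ^+ 2)).
rewrite !size_polyN in d1 d2; rewrite !expr2 in p4 d1 d2 *.
case: (eqVneq s 0) => [s0|s0].
  by move: d1 d2; rewrite s0 !mulr0 subr0 size_poly0; size_lia.
case: (eqVneq r 0) => [r0|r0].
  move: s0 d1 d2; rewrite -size_poly_gt0 r0 !mulr0 mul0r subr0 size_poly0.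
  by size_lia.
move: s0 r0; rewrite -!size_poly_gt0; size_lia.
Qed.

(** At infinity a form of degree d is its value at the origin times y^d, up to
    terms with poles of smaller order. *)
Lemma form_weight d phi : isform d phi -> weight_lt (3 * d)
  (fun x y => phi (triple_coord x y 1) - phi (triple_coord 0 1 0) * y ^+ d).
Proof.
move: d phi; apply: form_ind.
- move=> c; exists 0, 0; split; rewrite ?size_poly0 // => x y _.
  by rewrite !hornerC expr0; ring.
- move=> d; exists 0, 0; split; rewrite ?size_poly0 // => x y _.
  by rewrite !hornerC; ring.
- move=> d i phi _ IH.
  have full : weight_lt (3 * d).+1 (fun x y => phi (triple_coord x y 1)).
    have h := weight_scale (phi (triple_coord 0 1 0)) (weight_yn d).
    apply: weight_ext (weight_add (weight_le (leqnSn _) IH) h) => x y _.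
    by rewrite subrK.
  case: (I3 i) => ->.
  + apply: (@weight_le (3 * d).+3); first by lia.
    by apply: weight_ext (weight_x full) => x y _; rewrite !tripleE; ring.
  + apply: (@weight_le (3 * d).+3); first by lia.
    by apply: weight_ext (weight_y IH) => x y _; rewrite !tripleE exprS; ring.
  + apply: (@weight_le (3 * d).+1); first by lia.
    by apply: weight_ext full => x y _; rewrite !tripleE; ring.
- move=> d phi psi _ _ h1 h2; apply: weight_ext (weight_add h1 h2) => x y _.
  by ring.
Qed.

Definition conj_coord (v : 'I_3 -> k) : 'I_3 -> k :=
  triple_coord (v i0) (- v i1 - a1 * v i0 - a3 * v i2) (v i2).

Lemma form_conj d phi : isform d phi -> isform d (fun v => phi (conj_coord v)).
Proof.
move=> hp; rewrite -(muln1 d).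
apply: (@form_comp k 2 2 d 1 phi (fun i v => conj_coord v i)) => // i.
have f j := form_var k (j : 'I_3).
case: (I3 i) => ->.
- by apply: form_ext (f i0) => v; rewrite /conj_coord tripleE.
- have h := form_sub (form_sub (form_opp (f i1)) (form_scale a1 (f i0)))
    (form_scale a3 (f i2)).
  by apply: form_ext h => v; rewrite /conj_coord tripleE.
- by apply: form_ext (f i2) => v; rewrite /conj_coord tripleE.
Qed.

Lemma conj_affine x y : conj_coord (triple_coord x y 1) = triple_coord x (conj_y x y) 1.
Proof. by rewrite /conj_coord !tripleE mulr1. Qed.

(** The norm of a form vanishes only if the form vanishes on the curve,
    including the origin: there, a nonzero value would make y^d a function of
    weight less than 3 d, which the degree of its norm forbids. *)
Lemma form_norm d phi : isform d phi -> exists N : {poly k},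
  (forall x y, weq x y -> N.[x] = phi (triple_coord x y 1) *
     phi (conj_coord (triple_coord x y 1))) /\
  (N = 0 -> forall Q, X Q -> phi (hcoord Q) = 0).
Proof.
move=> hp; have [r [s [hr hs hrs]]] := form_weight hp.
have [r' [s' [hr' hs' hrs']]] := weight_yn d.
set c := phi (triple_coord 0 1 0) in hrs.
pose R := r + c *: r'; pose S := s + c *: s'.
have E x y : weq x y -> phi (triple_coord x y 1) = R.[x] + S.[x] * y.
  move=> w; have := hrs x y w; rewrite (hrs' x y w) => /eqP.
  rewrite subr_eq => /eqP ->; rewrite /R /S !hornerD !hornerZ; ring.
exists (norm_poly R S); split.
  move=> x y w; rewrite (norm_horner R S w) -(E _ _ w) -(E _ _ (weq_conj w)).
  by rewrite conj_affine.
case/norm_eq0 => R0 S0 Q XQ.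
have z0 x y : weq x y -> phi (triple_coord x y 1) = 0.
  by move=> w; rewrite E // R0 S0 !hornerC; ring.
have c0 : c = 0.
  apply/eqP; apply: contraT => c0.
  have hy x y : weq x y -> y ^+ d = (- c^-1 *: r).[x] + (- c^-1 *: s).[x] * y.
    move=> w; have := hrs x y w; rewrite z0 // add0r !hornerZ => e.
    have -> : - c^-1 * r.[x] + - c^-1 * s.[x] * y = - c^-1 * (r.[x] + s.[x] * y).
      by ring.
    by rewrite -e mulrNN mulrA mulVf // mul1r.
  have : norm_poly (- c^-1 *: r) (- c^-1 *: s) = (- C) ^+ d.
    apply/eqP; rewrite -subr_eq0; apply/eqP; apply: poly_all_roots => x.
    have [y w] := weq_ex x; rewrite hornerD hornerN (norm_horner _ _ w).
    rewrite -(hy _ _ w) -(hy _ _ (weq_conj w)) -exprMn horner_exp hornerN C_horner.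
    have -> : y * conj_y x y = - (x ^+ 3 + a2 * x ^+ 2 + a4 * x + a6).
      by move: w; rewrite /weq /conj_y => <-; ring.
    by rewrite subrr.
  move/(congr1 (fun p => size (p : {poly k}))).
  have C0 : - C != 0 by rewrite oppr_eq0 -size_poly_eq0 size_C.
  have -> : size ((- C) ^+ d) = (3 * d).+1.
    elim: (d) => [|e IH]; first by rewrite expr0 size_poly1.
    by rewrite exprS size_mul ?expf_neq0 // IH size_polyN size_C; size_lia.
  have := @norm_weight (3 * d) (- c^-1 *: r) (- c^-1 *: s).
  have := size_scale_leq (- c^-1) r; have := size_scale_leq (- c^-1) s.
  by size_lia.
case: (wcurve_cases XQ) => [->|[x [y [w eQ z1]]]].
  by have [a a0 ->] := form_pt hp origin_nz; rewrite -/c c0 mulr0.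
by rewrite eQ; have [a a0 ->] := form_pt hp (triple_nz1 x y); rewrite z0 ?mulr0.
Qed.

Lemma form_affine_pt d phi x y : isform d phi -> phi (hcoord (affine_pt x y)) = 0 ->
  phi (triple_coord x y 1) = 0.
Proof.
move=> hp /eqP; have [c c0 ->] := form_pt hp (triple_nz1 x y).
by rewrite mulf_eq0 expf_eq0 (negPf c0) andbF => /eqP.
Qed.

(** The norm to the x-line is multiplicative, and k[x] is a domain. *)
Lemma wcurve_irr : irreducible X.
Proof.
move=> d e phi psi hp hq hz.
have [N [hN N0]] := form_norm hp; have [M [hM M0]] := form_norm hq.
have : N * M = 0.
  apply: poly_all_roots => x; have [y w] := weq_ex x.
  rewrite hornerM (hN _ _ w) (hM _ _ w).
  have := hz _ (affine_pt_in w).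
  rewrite (form_affine hp (affine_pt_z _ _)) (form_affine hq (affine_pt_z _ _)).
  rewrite xcoord_pt ycoord_pt => /eqP; rewrite !mulf_eq0 !expf_eq0.
  rewrite (negPf (affine_pt_z x y)) !andbF /= => /orP [] /eqP ->; ring.
by move/eqP; rewrite mulf_eq0 => /orP [/eqP /N0|/eqP /M0]; [left|right].
Qed.

End Weierstrass.

(** * Local rings of smooth Weierstrass curves *)

(** A factor of a product of finite order has finite order; the product will be
    that of a form and its conjugate, which is a polynomial in x. *)
Lemma dvr_norm (k : fieldType) n (X : set (projsp k n)) P pi K g g' :
  irreducible X -> param X P pi -> regular_at X P g -> regular_at X P g' ->
  ordat X P pi K (fun Q => g Q * g' Q) -> exists e, ordat X P pi e g.
Proof.
move=> irrX hp rg rg' [u [ru u0 eu]].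
have [[f rf ef]|[e _ he]] := param_expand hp K.+1 rg; last by exists e.
exfalso; apply: (@ordat_lt_cancel _ _ _ _ _ hp irrX K (fun Q => f Q * g' Q) u) => //.
  exact: reg_mul.
by apply: near_map2 eu ef => Q _ <- ->; rewrite mulrA.
Qed.

Lemma ordat_uniq (k : fieldType) n (X : set (projsp k n)) P pi e e' f :
  irreducible X -> param X P pi -> ordat X P pi e f -> ordat X P pi e' f -> e = e'.
Proof.
move=> irrX hp; wlog lt : e e' / (e < e')%N => [H o o'|].
  by case: (ltngtP e e') => // lt; [exact: H lt o o' | apply/esym/(H _ _ lt)].
move=> [u [ru u0 eu]] [v [rv v0 ev]]; exfalso.
apply: (@ordat_lt_cancel _ _ _ _ _ hp irrX e (fun Q => pi Q ^+ (e' - e.+1) * v Q) u) => //.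
  by apply: reg_mul => //; apply: reg_exp; exact: param_reg hp.
apply: near_map2 eu ev => Q _ <- ->.
by rewrite mulrA -exprD subnKC.
Qed.

Lemma reverse_horner (k : fieldType) (N : {poly k}) : N != 0 ->
  exists2 R : {poly k}, R.[0] != 0 &
    forall x, x != 0 -> N.[x] * (x^-1) ^+ (size N).-1 = R.[x^-1].
Proof.
move=> N0; set e := (size N).-1.
have se : size N = e.+1 by rewrite prednK // size_poly_gt0.
exists (\poly_(i < e.+1) N`_(e - i)).
  by rewrite horner_coef0 coef_poly subn0 -/(lead_coef N) lead_coef_eq0.
move=> x x0; rewrite (horner_coef_wide _ (eq_leq se)) horner_poly mulr_suml.
rewrite (reindex_inj rev_ord_inj); apply: eq_bigr => i _ /=.
rewrite subSS -mulrA; congr (_ * _).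
have ie : (i <= e)%N by rewrite -ltnS.
have -> : x^-1 ^+ e = x^-1 ^+ (e - i) * x^-1 ^+ i by rewrite -exprD subnK.
by rewrite mulrA -exprMn mulfV // expr1n mul1r.
Qed.

Section Smooth.
Variables (k : closedFieldType) (W : weierstrass k).
Hypothesis smoothW : wdisc W != 0.
Let a1 := wa1 W.
Let a2 := wa2 W.
Let a3 := wa3 W.
Let a4 := wa4 W.
Let a6 := wa6 W.
Let X := wcurve W.
Let i0 : 'I_3 := inord 0.
Let i1 : 'I_3 := inord 1.
Let i2 : 'I_3 := inord 2.
Let irrX : irreducible X := @wcurve_irr k W.
Let tripleE := (@triple0 k, @triple1 k, @triple2 k).

Definition w_y x y := 2 * y + a1 * x + a3.
Definition w_x x y := a1 * y - (3 * x ^+ 2 + 2 * a2 * x + a4).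

Lemma smooth_point x y : weq W x y -> w_y x y = 0 -> w_x x y != 0.
Proof.
rewrite /weq /w_y /w_x -/a1 -/a2 -/a3 -/a4 -/a6 => e ey; apply/eqP => ex.
move/negP: smoothW; apply; apply/eqP.
have e3 : a3 = - (2 * y + a1 * x) by apply/eqP; rewrite -addr_eq0 addrC; apply/eqP.
have e4 : a4 = a1 * y - (3 * x ^+ 2 + 2 * a2 * x).
  by move/eqP: ex; rewrite subr_eq0 => /eqP ->; ring.
have e6 : a6 = y ^+ 2 + a1 * x * y + a3 * y - (x ^+ 3 + a2 * x ^+ 2 + a4 * x).
  by rewrite e; ring.
rewrite /wdisc /wb8 /wb2 /wb4 /wb6 -/a1 -/a2 -/a3 -/a4 -/a6 e6 e4 e3.
by ring.
Qed.

Lemma gen_poly (p : {poly k}) : p != 0 ->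
  gen X (fun Q => hcoord Q i2 != 0 /\ p.[xcoord Q] != 0).
Proof.
move/closed_nonrootP => [x px]; have [y w] := weq_ex W x.
have z0 := affine_pt_z x y; have XP := affine_pt_in w.
have rx : regular_at X (affine_pt x y) (@xcoord k).
  exact: (reg_form XP (form_var k i0) (form_var k i2)).
have hz := near_form XP (form_var k i2) z0.
apply: (near_gen (P := affine_pt x y)); apply: near_and => //.
by apply: reg_neq0; [exact: reg_horner | rewrite xcoord_pt].
Qed.

Section AffinePoint.
Variables (x0 y0 : k).
Hypothesis w0 : weq W x0 y0.
Let P := affine_pt x0 y0.
Let XP : X P := affine_pt_in w0.
Let z0 : hcoord P i2 != 0 := affine_pt_z x0 y0.

Lemma xcoord_reg : regular_at X P (@xcoord k).
Proof. exact: (reg_form XP (form_var k i0) (form_var k i2)). Qed.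

Lemma ycoord_reg : regular_at X P (@ycoord k).
Proof. exact: (reg_form XP (form_var k i1) (form_var k i2)). Qed.

Lemma near_affine : near X P (fun Q => hcoord Q i2 != 0 /\ weq W (xcoord Q) (ycoord Q)).
Proof.
apply: near_sub (near_form XP (form_var k i2) z0) => Q XQ h.
by split=> //; exact: wcurve_affine.
Qed.

Let dx Q := @xcoord k Q - x0.
Let dy Q := @ycoord k Q - y0.
Let rdx : regular_at X P dx.
Proof. by apply: reg_sub; [exact: xcoord_reg | exact: reg_cst]. Qed.
Let rdy : regular_at X P dy.
Proof. by apply: reg_sub; [exact: ycoord_reg | exact: reg_cst]. Qed.
Let dx0 : dx P = 0. Proof. by rewrite /dx xcoord_pt subrr. Qed.
Let dy0 : dy P = 0. Proof. by rewrite /dy ycoord_pt subrr. Qed.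

Let fx Q := dx Q ^+ 2 + (3 * x0 + a2) * dx Q - w_x x0 y0.
Let fy Q := dy Q + a1 * dx Q + w_y x0 y0.
Let rfx : regular_at X P fx.
Proof.
apply: reg_sub; last exact: reg_cst.
apply: reg_add; first exact: reg_exp.
by apply: reg_mul; [exact: reg_cst|].
Qed.
Let rfy : regular_at X P fy.
Proof.
apply: reg_add; last exact: reg_cst.
by apply: reg_add => //; apply: reg_mul; [exact: reg_cst|].
Qed.
Let fxP : fx P = - w_x x0 y0. Proof. by rewrite /fx dx0; ring. Qed.
Let fyP : fy P = w_y x0 y0. Proof. by rewrite /fy dx0 dy0; ring. Qed.

(** The Weierstrass equation expanded at P. At a smooth point fx or fy is a unit,
    so that dy or dx is a multiple of the other. *)
Let expansion : near X P (fun Q => dy Q * fy Q = dx Q * fx Q).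
Proof.
apply: near_sub near_affine => Q _ [_ w].
apply/eqP; rewrite -subr_eq0; apply/eqP.
move: w w0; rewrite /weq /fx /fy /dx /dy /w_x /w_y -/a1 -/a2 -/a3 -/a4 -/a6.
move: (xcoord Q) (ycoord Q) => x y w w'.
transitivity ((y ^+ 2 + a1 * x * y + a3 * y - (x ^+ 3 + a2 * x ^+ 2 + a4 * x + a6)) -
  (y0 ^+ 2 + a1 * x0 * y0 + a3 * y0 - (x0 ^+ 3 + a2 * x0 ^+ 2 + a4 * x0 + a6))).
  by ring.
by rewrite w w' !subrr.
Qed.

Let I3 (i : 'I_3) : [\/ i = i0, i = i1 | i = i2] := ord3_cases i.

Let chart_param pi gx gy : regular_at X P pi -> pi P = 0 ->
  ~ near X P (fun Q => pi Q = 0) -> regular_at X P gx -> regular_at X P gy ->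
  near X P (fun Q => dx Q = pi Q * gx Q) -> near X P (fun Q => dy Q = pi Q * gy Q) ->
  param X P pi.
Proof.
move=> h1 h2 h3 rx ry hx hy.
apply: (@param_chart k 2 X P i2 XP z0 pi (fun i => if i == i0 then gx else
   if i == i1 then gy else fun=> 0)) => // i.
have i10 : (i1 == i0) = false by rewrite -val_eqE /= !inordK.
have i20 : (i2 == i0) = false by rewrite -val_eqE /= !inordK.
have i21 : (i2 == i1) = false by rewrite -val_eqE /= !inordK.
case: (I3 i) => ->.
- rewrite eqxx; split=> //; apply: near_sub hx => Q _ <-.
  by rewrite /dx -[x0 in RHS](xcoord_pt x0 y0).
- rewrite i10 eqxx; split=> //; apply: near_sub hy => Q _ <-.
  by rewrite /dy -[y0 in RHS](ycoord_pt x0 y0).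
- rewrite i20 i21; split; first exact: reg_cst.
  by apply: near_sub near_affine => Q _ [h _]; rewrite !divff // subrr mulr0.
Qed.

Lemma param_x : w_y x0 y0 != 0 -> param X P dx.
Proof.
move=> ny; apply: (chart_param (gx := fun=> 1) (gy := fun Q => fx Q / fy Q)) => //.
- move/near_gen => z.
  have [Q _ [[_ q0] q1]] := gen_ex (gen_and irrX (gen_poly (negbT (polyXsubC_eq0 x0))) z).
  by move: q0; rewrite hornerXsubC -/(dx Q) q1 eqxx.
- exact: reg_cst.
- by apply: reg_div => //; rewrite fyP.
- by apply: near_all => // Q _; rewrite mulr1.
have nfy : near X P (fun Q => fy Q != 0) by apply: reg_neq0 => //; rewrite fyP.
by apply: near_map2 expansion nfy => Q _ e q0; rewrite mulrA -e mulfK.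
Qed.

Lemma param_y : w_y x0 y0 = 0 -> param X P dy /\ ordat X P dy 2 dx.
Proof.
move=> ny; have nx := smooth_point w0 ny.
have fxn : fx P != 0 by rewrite fxP oppr_eq0.
have nfx := reg_neq0 rfx fxn.
pose g Q := fy Q / fx Q.
have rg : regular_at X P g by exact: reg_div.
have eg : near X P (fun Q => dx Q = dy Q * g Q).
  by apply: near_map2 expansion nfx => Q _ e q0; rewrite mulrA e mulfK.
split.
  apply: (chart_param (gx := g) (gy := fun=> 1)) => //.
  - move/near_gen => z.
    pose p : {poly k} := 'X^3 + (a2 *: 'X^2 + ((a4 - a1 * y0) *: 'X +
      (a6 - y0 ^+ 2 - a3 * y0)%:P)).
    have p0 : p != 0.
      suff : size p = 4%N by move=> sp; rewrite -size_poly_eq0 sp.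
      rewrite size_polyDl ?size_polyXn //.
      rewrite (leq_ltn_trans (size_polyD _ _)) // gtn_max.
      rewrite (leq_ltn_trans (size_scale_leq _ _)) ?size_polyXn //=.
      rewrite (leq_ltn_trans (size_polyD _ _)) // gtn_max.
      rewrite (leq_ltn_trans (size_scale_leq _ _)) ?size_polyX //=.
      by rewrite (leq_ltn_trans (size_polyC_leq1 _)).
    have [Q _ [[[zQ q0] q1] w]] := gen_ex (gen_and irrX
      (gen_and irrX (gen_poly p0) z) (near_gen near_affine)).
    move/negP: q0; apply; apply/eqP; case: w => _; rewrite /weq.
    have -> : ycoord Q = y0 by apply/eqP; rewrite -subr_eq0 -/(dy Q) q1.
    move: (xcoord Q) => x e.
    rewrite /p !(hornerD, hornerZ, hornerXn, hornerX, hornerC).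
    transitivity ((x ^+ 3 + a2 * x ^+ 2 + a4 * x + a6) -
      (y0 ^+ 2 + a1 * x * y0 + a3 * y0)); first by ring.
    by rewrite e subrr.
  - exact: reg_cst.
  - by apply: near_all => // Q _; rewrite mulr1.
exists (fun Q => (1 + a1 * g Q) / fx Q); split.
- apply: reg_div => //; apply: reg_add; first exact: reg_cst.
  by apply: reg_mul; [exact: reg_cst|].
- by rewrite mulf_neq0 ?invr_eq0 // /g fyP ny mul0r mulr0 addr0 oner_neq0.
apply: near_map2 (near_and expansion eg) nfx => Q _ [e1 e2] q0.
apply: (mulIf q0); rewrite -e1 /fy ny e2; move: (dy Q) (g Q) => a b.
by field.
Qed.

Lemma dvr_affine pi e : param X P pi -> ordat X P pi e dx -> dvr X P pi.
Proof.
move=> hp hx; split=> // f /regularP [d [a [b [ha hb b0 ef]]]].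
have [N [hN N0]] := form_norm W ha.
case: (eqVneq N 0) => [/N0 a0|Nnz].
  by left; apply: near_map2 ef (near_all XP (fun Q XQ => XQ)) => Q _ -> XQ; rewrite a0 ?mul0r.
right; have [m [q qr eN]] := multiplicity_XsubC N x0; rewrite Nnz /= in qr.
have zd : hcoord P i2 ^+ d != 0 by rewrite expf_neq0.
have fzd : isform d (fun v : 'I_3 -> k => v i2 ^+ d) := form_varX k i2 d.
have hac := form_conj W ha.
pose g Q := a (hcoord Q) / hcoord Q i2 ^+ d.
pose g' Q := a (conj_coord W (hcoord Q)) / hcoord Q i2 ^+ d.
have rg : regular_at X P g := reg_form XP ha fzd zd.
have rg' : regular_at X P g' := reg_form XP hac fzd zd.
have [j [v [rv v0 ev]]] : exists j, ordat X P pi j g.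
  apply: (@dvr_norm _ _ _ _ pi (e * m) g g') => //.
  have rq : regular_at X P (fun Q => q.[xcoord Q]).
    by apply: reg_horner; exact: xcoord_reg.
  have q0 : q.[xcoord P] != 0 by rewrite xcoord_pt.
  have := ordat_mul (ordat_exp hp m hx) (ordat_unit hp rq q0).
  rewrite addn0; apply: ordat_near.
  apply: near_sub near_affine => Q _ [zQ w].
  have := hN _ _ w; rewrite eN hornerM horner_exp hornerXsubC -/(dx Q) mulrC => ->.
  rewrite /g /g' (form_affine ha zQ) (form_affine hac zQ).
  by rewrite !mulrA mulrAC -!mulrA; field; rewrite expf_neq0.
exists j, (fun Q => v Q * (hcoord Q i2 ^+ d / b (hcoord Q))); split.
- by apply: reg_mul => //; exact: reg_form XP fzd hb b0.
- by rewrite !mulf_neq0 ?invr_eq0.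
apply: near_map2 (near_and ef ev) near_affine => Q _ [-> e1] [zQ _].
by rewrite mulrA -e1 /g mulrA divfK // expf_neq0.
Qed.

End AffinePoint.

Section Origin.
Let O := origin k.
Let XO : X O := origin_in W.
Let y0 : hcoord O i1 != 0 := origin_y k.
Let Oc : exists2 c, c != 0 & hcoord O = fun i => c * triple_coord 0 1 0 i.
Proof. exact: hcoord_pt (origin_nz k). Qed.

Let u (Q : projsp k 2) := hcoord Q i0 / hcoord Q i1.
Let w (Q : projsp k 2) := hcoord Q i2 / hcoord Q i1.
Let ru : regular_at X O u := reg_form XO (form_var k i0) (form_var k i1) y0.
Let rw : regular_at X O w := reg_form XO (form_var k i2) (form_var k i1) y0.
Let u0 : u O = 0.
Proof. by rewrite /u; case: Oc => c c0 ->; rewrite !tripleE mulr0 mul0r. Qed.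
Let w0 : w O = 0.
Proof. by rewrite /w; case: Oc => c c0 ->; rewrite !tripleE mulr0 mul0r. Qed.

Let den Q := 1 + a1 * u Q + a3 * w Q - a2 * u Q ^+ 2 - a4 * u Q * w Q -
  a6 * w Q ^+ 2.
Let rden : regular_at X O den.
Proof.
have rc c : regular_at X O (fun=> c) by exact: reg_cst.
by do !first [exact: ru | exact: rw | exact: rc | apply: reg_sub | apply: reg_add
  | apply: reg_exp | apply: reg_mul].
Qed.
Let den0 : den O != 0.
Proof. by rewrite /den u0 w0 !expr0n !mulr0 !subr0 !addr0 oner_neq0. Qed.

Let expansionO : near X O (fun Q => w Q * den Q = u Q ^+ 3).
Proof.
apply: near_sub (near_form XO (form_var k i1) y0).
move=> Q; rewrite {1}/X /wcurve /= -/i0 -/i1 -/i2 -/a1 -/a2 -/a3 -/a4 -/a6 => e yQ.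
rewrite /den /w /u; apply: (mulIf (expf_neq0 3 yQ)).
move: (hcoord Q i0) (hcoord Q i1) (hcoord Q i2) yQ e => x y z y1 e.
transitivity (y ^+ 2 * z + a1 * x * y * z + a3 * y * z ^+ 2 -
  (a2 * x ^+ 2 * z + a4 * x * z ^+ 2 + a6 * z ^+ 3)); first by field.
by rewrite e; field.
Qed.

Let u_nz : ~ near X O (fun Q => u Q = 0).
Proof.
move=> /near_gen z.
have p0 : ('X : {poly k}) != 0 by rewrite polyX_eq0.
have [Q _ [[[_ q0] q1] yQ]] := gen_ex (gen_and irrX (gen_and irrX (gen_poly p0) z)
  (near_gen (near_form XO (form_var k i1) y0))).
move/eqP: q1; rewrite mulf_eq0 invr_eq0 (negPf yQ) orbF => /eqP x0.
by move: q0; rewrite hornerX /xcoord -/i0 x0 mul0r eqxx.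
Qed.

Let w_u : near X O (fun Q => w Q = u Q ^+ 3 * (den Q)^-1).
Proof.
by apply: near_map2 expansionO (reg_neq0 rden den0) => Q _ <- d0; rewrite mulfK.
Qed.

Lemma param_origin : param X O u.
Proof.
have I3 (i : 'I_3) : [\/ i = i0, i = i1 | i = i2] := ord3_cases i.
apply: (@param_chart k 2 X O i1 XO y0 u (fun i => if i == i0 then fun=> 1 else
   if i == i1 then fun=> 0 else fun Q => u Q ^+ 2 * (den Q)^-1)) => // i.
have i10 : (i1 == i0) = false by rewrite -val_eqE /= !inordK.
have i20 : (i2 == i0) = false by rewrite -val_eqE /= !inordK.
have i21 : (i2 == i1) = false by rewrite -val_eqE /= !inordK.
case: (I3 i) => ->.
- rewrite eqxx; split; first exact: reg_cst.
  by apply: near_all => // Q _; rewrite -/(u Q) -/(u O) u0 subr0 mulr1.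
- rewrite i10 eqxx; split; first exact: reg_cst.
  apply: near_sub (near_form XO (form_var k i1) y0) => Q _ h.
  by rewrite !divff // subrr mulr0.
- rewrite i20 i21; split.
    by apply: reg_mul; [exact: reg_exp | exact: reg_inv].
  apply: near_sub w_u => Q _; rewrite -/(w Q) -/(w O) w0 subr0 => ->.
  by rewrite exprS mulrA.
Qed.

(** The function 1/x, in a form regular at the origin. *)
Definition xinv Q := u Q ^+ 2 / den Q.

Lemma xinv_reg : regular_at X O xinv.
Proof. by apply: reg_div => //; exact: reg_exp. Qed.

Lemma xinv_ord : ordat X O u 2 xinv.
Proof.
exists (fun Q => (den Q)^-1); split.
- exact: reg_inv.
- by rewrite invr_eq0.
- exact: near_all.
Qed.

(** The equality includes the origin, where both sides vanish. *)
Lemma xinvE : near X O (fun Q => xinv Q = (xcoord Q)^-1).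
Proof.
apply: near_map2 (near_and expansionO (near_form XO (form_var k i1) y0))
  (near_and (reg_neq0 rden den0) (near_all XO (fun Q XQ => XQ))).
move=> Q _ [e yQ] [d0 XQ]; rewrite /xinv.
case: (eqVneq (u Q) 0) => [uz|uz].
  have x0 : hcoord Q i0 = 0.
    by move/eqP: uz; rewrite mulf_eq0 invr_eq0 (negPf yQ) orbF => /eqP.
  by rewrite uz expr0n /= mul0r /xcoord -/i0 x0 mul0r invr0.
have x0 : hcoord Q i0 != 0.
  by apply: contraNneq uz => x0; rewrite /u x0 mul0r.
have z0 : hcoord Q i2 != 0.
  apply: contraNneq uz => z0; move: e; rewrite /w z0 !mul0r => /esym/eqP.
  by rewrite expf_eq0.
have -> : (xcoord Q)^-1 = w Q / u Q.
  by rewrite /xcoord -/i0 -/i2 /w /u; field; rewrite x0 yQ z0.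
apply: (mulIf d0); apply: (mulIf uz).
by rewrite divfK // [RHS]mulrAC divfK // e -exprSr.
Qed.

(** Near infinity, a form times its conjugate is its norm, which is a unit times
    the power of 1/x given by its degree, up to a power of w. *)
Lemma origin_norm d a (N : {poly k}) : isform d a -> N != 0 ->
  (forall x y, weq W x y -> N.[x] = a (triple_coord x y 1) *
     a (conj_coord W (triple_coord x y 1))) ->
  ordat X O u (6 * d) (fun Q => (a (hcoord Q) / hcoord Q i1 ^+ d) *
    (a (conj_coord W (hcoord Q)) / hcoord Q i1 ^+ d * xinv Q ^+ (size N).-1)).
Proof.
move=> ha Nnz hN; have [R R0 hR] := reverse_horner Nnz.
have hac := form_conj W ha.
have fyd : isform d (fun v : 'I_3 -> k => v i1 ^+ d) := form_varX k i1 d.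
have yd : hcoord O i1 ^+ d != 0 by rewrite expf_neq0.
have rg := reg_form XO ha fyd yd; have rg' := reg_form XO hac fyd yd.
have rR : regular_at X O (fun Q => R.[xinv Q]) by apply: reg_horner; exact: xinv_reg.
have xO : xinv O = 0 by rewrite /xinv u0 expr0n mul0r.
have RO : R.[xinv O] != 0 by rewrite xO.
have ow : ordat X O u 3 w.
  exists (fun Q => (den Q)^-1); split=> //; first exact: reg_inv.
  by rewrite invr_eq0.
have := ordat_mul (ordat_exp param_origin (d * 2) ow) (ordat_unit param_origin rR RO).
rewrite addn0 => h; have -> : (6 * d = 3 * (d * 2))%N by lia.
apply: ordat_near h; apply: (gen_reg irrX).
- apply: reg_mul => //; exact: reg_exp.
- apply: reg_mul => //; apply: reg_mul => //; apply: reg_exp; exact: xinv_reg.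
have p0 : ('X : {poly k}) != 0 by rewrite polyX_eq0.
apply: (gen_map2 irrX _ (gen_poly p0) (near_gen (near_and xinvE
  (near_and (near_form XO (form_var k i1) y0) (near_all XO (fun Q XQ => XQ)))))).
move=> Q _; rewrite hornerX => -[zQ xQ] [ex [yQ XQ]].
have wQ := wcurve_affine XQ zQ.
rewrite ex -hR // (hN _ _ wQ) (form_affine ha zQ) (form_affine hac zQ) /w.
rewrite exprM expr2 !expr_div_n.
move: (_ ^+ _) (a (triple_coord _ _ _)) (a (conj_coord _ _)) => *; by ring.
Qed.

(** The degree of the norm is maximal precisely when the form does not vanish at
    the origin. *)
Lemma origin_norm_unit d a (N : {poly k}) : isform d a -> N != 0 ->
  (forall x y, weq W x y -> N.[x] = a (triple_coord x y 1) *
     a (conj_coord W (triple_coord x y 1))) ->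
  if a (hcoord O) == 0 then (size N <= 3 * d)%N else size N == (3 * d).+1.
Proof.
move=> ha Nnz hN; have o := origin_norm ha Nnz hN.
have hac := form_conj W ha.
have fyd : isform d (fun v : 'I_3 -> k => v i1 ^+ d) := form_varX k i1 d.
have yd : hcoord O i1 ^+ d != 0 by rewrite expf_neq0.
have rg := reg_form XO ha fyd yd; have rg' := reg_form XO hac fyd yd.
have ox := ordat_exp param_origin (size N).-1 xinv_ord.
have sN : (0 < size N)%N by rewrite size_poly_gt0.
case: eqP => [aO|/eqP aO].
  have gO : a (hcoord O) / hcoord O i1 ^+ d = 0 by rewrite aO mul0r.
  have [f rf ef] := param_max param_origin rg gO.
  rewrite leqNgt; apply/negP => lt; case: o => v [rv v0 ev]; case: ox => t [rt t0 et].
  pose j := (2 * (size N).-1 - 6 * d)%N.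
  apply: (@ordat_lt_cancel _ _ _ _ _ param_origin irrX (6 * d)
    (fun Q => u Q ^+ j * (f Q * (a (conj_coord W (hcoord Q)) / hcoord Q i1 ^+ d * t Q))) v) => //.
    apply: reg_mul; first exact: reg_exp.
    by apply: reg_mul => //; exact: reg_mul.
  apply: near_map2 (near_and ev ef) et => Q _ [<- ->] ->.
  have -> : (2 * (size N).-1 = 6 * d + j)%N by rewrite /j; lia.
  rewrite exprD exprS; move: (u Q ^+ _) (u Q ^+ _) (_ / _) => *; by ring.
have acO : a (conj_coord W (hcoord O)) != 0.
  have [c c0 ec] := Oc; move: aO; rewrite ec (form_homog ha).
  have -> : conj_coord W (fun i => c * triple_coord 0 1 0 i) =
      (fun i => - c * triple_coord 0 1 0 i).
    apply/funext => i; rewrite /conj_coord -/i0 -/i1 -/i2 !tripleE /triple_coord.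
    by case: ifP => _; [ring | case: ifP => _; ring].
  by rewrite (form_homog ha) !mulf_eq0 !expf_eq0 oppr_eq0.
have := ordat_mul (ordat_unit param_origin rg _) (ordat_mul
  (ordat_unit param_origin rg' _) ox).
have nz b : b != 0 -> b / hcoord O i1 ^+ d != 0.
  by move=> b0; rewrite mulf_neq0 ?invr_eq0.
move/(_ (nz _ aO) (nz _ acO)); rewrite !add0n => o'.
have := ordat_uniq irrX param_origin o o'.
by lia.
Qed.

Lemma dvr_origin : dvr X O u.
Proof.
split; first exact: param_origin; move=> f /regularP [d [a [b [ha hb b0 ef]]]].
have [N [hN N0]] := form_norm W ha.
case: (eqVneq N 0) => [/N0 a0|Nnz].
  by left; apply: near_map2 ef (near_all XO (fun Q XQ => XQ)) => Q _ -> XQ; rewrite a0 ?mul0r.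
right; have o := origin_norm ha Nnz hN.
have hac := form_conj W ha.
have fyd : isform d (fun v : 'I_3 -> k => v i1 ^+ d) := form_varX k i1 d.
have yd : hcoord O i1 ^+ d != 0 by rewrite expf_neq0.
have rg := reg_form XO ha fyd yd; have rg' := reg_form XO hac fyd yd.
have [|j [v [rv v0 ev]]] := dvr_norm irrX param_origin rg _ o.
  by apply: reg_mul => //; apply: reg_exp; exact: xinv_reg.
exists j, (fun Q => v Q * (hcoord Q i1 ^+ d / b (hcoord Q))); split.
- by apply: reg_mul => //; exact: reg_form XO fyd hb b0.
- by rewrite !mulf_neq0 ?invr_eq0.
apply: near_map2 (near_and ef ev) (near_form XO (form_var k i1) y0) => Q _ [-> e1] yQ.
by rewrite mulrA -e1 mulrA divfK // expf_neq0.
Qed.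

End Origin.

Lemma dvr_wcurve P : X P -> exists pi, dvr X P pi.
Proof.
move=> XP; case: (wcurve_cases XP) => [->|[x [y [w -> _]]]].
  by eexists; exact: dvr_origin.
case: (eqVneq (w_y x y) 0) => [ny|ny].
  have [h1 h2] := param_y w ny.
  by eexists; exact: (dvr_affine w h1 h2).
have h := param_x w ny.
by eexists; exact: (dvr_affine w h (ordat_self h)).
Qed.

(** A function without poles is constant: the norm to k(x) of its difference
    with its value at infinity is a polynomial in x that vanishes at infinity. *)
Lemma regular_cst f : (forall P, X P -> exists c, rational_value X f P c) ->
  exists c, gen X (fun Q => f Q = c).
Proof.
move=> hf; have [c [psi /regularP [d [g0 [h [hg0 hh h0 e0]]]] [epsi psiO]]] :=
  hf _ (origin_in W).
exists c; pose g v := g0 v - c * h v.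
have hg : isform d g by apply: form_sub => //; exact: form_scale.
have efc : gen X (fun Q => f Q - c = g (hcoord Q) / h (hcoord Q)).
  apply: (gen_map2 irrX _ epsi (near_gen (near_and e0
    (near_form (origin_in W) hh h0)))) => Q _ <- [-> hQ].
  by rewrite /g; field.
have gO : g (hcoord (origin k)) = 0.
  rewrite /g -psiO (near_pt e0) divfK // subrr //.
have [N [hN N0]] := form_norm W hg; have [M [hM M0]] := form_norm W hh.
have Mnz : M != 0.
  by apply/eqP => /M0 /(_ _ (origin_in W)) z; rewrite z eqxx in h0.
case: (eqVneq N 0) => [/N0 z|Nnz].
  apply: (gen_map2 irrX _ efc (near_gen (near_all (origin_in W) (fun Q XQ => XQ)))).
  by move=> Q _ e XQ; apply/eqP; rewrite -subr_eq0 e z // mul0r.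
exfalso.
have sN := origin_norm_unit hg Nnz hN; rewrite gO eqxx in sN.
have sM := origin_norm_unit hh Mnz hM; rewrite (negPf h0) in sM; move/eqP in sM.
(* The norm of f - c is T / S in lowest terms. If S is constant, the degrees
   contradict the zero at infinity; at a root of S, the expression of f as a
   quotient regular at the two points above it shows that T vanishes too. *)
pose D := gcdp N M; pose T := N %/ D; pose S := M %/ D.
have eN : N = T * D by rewrite divpK // dvdp_gcdl.
have eM : M = S * D by rewrite divpK // dvdp_gcdr.
have cop : coprimep T S by apply: coprimep_div_gcd; rewrite Nnz.
have [T0 D0] : T != 0 /\ D != 0 by apply/andP; rewrite -negb_or -mulf_eq0 -eN.
have S0 : S != 0 by apply: contraNneq Mnz => e; rewrite eM e mul0r.
case: (eqVneq (size S) 1%N) => [s1|].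
  have : (size M <= size N)%N.
    by rewrite eM eN !size_mul // s1; move: T0; rewrite -size_poly_gt0; size_lia.
  by rewrite sM => /leq_trans /(_ sN); rewrite ltnn.
move/closed_rootP => [x0 /eqP Sx0].
have Tx0 : T.[x0] != 0.
  by apply: (coprimep_root (p := S)); [rewrite coprimep_sym|apply/eqP].
have [y0 w0] := weq_ex W x0; have w0' := weq_conj w0.
have frac x y : weq W x y -> exists e a b, [/\ isform e a, isform e b,
    b (triple_coord x y 1) != 0 &
    forall x y, weq W x y -> g (triple_coord x y 1) * b (triple_coord x y 1) =
      a (triple_coord x y 1) * h (triple_coord x y 1)].
  move=> w; have [c' [phi /regularP [e [a0 [b [ha0 hb b0 eb]]]] [ephi _]]] :=
    hf _ (affine_pt_in w).
  have XP := affine_pt_in w.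
  exists e, (fun v => a0 v - c * b v), b; split=> //.
  - by apply: form_sub => //; exact: form_scale.
  - by move: b0; rewrite (form_pt_neq0 hb) //; exact: triple_nz1.
  move=> x' y' w'; apply/eqP; rewrite -subr_eq0; apply/eqP.
  have fz : isform (d + e) (fun v => g v * b v - (a0 v - c * b v) * h v).
    apply: form_sub; first exact: form_mul.
    by rewrite addnC; apply: form_mul => //; apply: form_sub => //; exact: form_scale.
  apply: (form_affine_pt fz).
  apply: (gen_form0 irrX fz) (affine_pt_in w').
  apply: (gen_map2 irrX _ (gen_and irrX (gen_and irrX efc ephi)
    (near_gen (near_form (origin_in W) hh h0))) (near_gen (near_and eb
    (near_and (near_form XP hb b0) (near_all XP (fun Q XQ => XQ)))))).
  move=> Q _ [[e1 e2] hz] [e3 [bQ XQ]].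
  have -> : g (hcoord Q) = (a0 (hcoord Q) / b (hcoord Q) - c) * h (hcoord Q).
    by rewrite -e3 e2 e1 divfK.
  by field.
have [e [a [b [ha hb bP gb]]]] := frac _ _ w0.
have [e' [a' [b' [ha' hb' bP' gb']]]] := frac _ _ w0'.
pose tau Q := triple_coord (@xcoord k Q) (@ycoord k Q) 1.
pose G Q := T.[xcoord Q] * (b (tau Q) * b' (conj_coord W (tau Q))) -
  S.[xcoord Q] * (a (tau Q) * a' (conj_coord W (tau Q))).
have XP := affine_pt_in w0.
have rtau i : regular_at X (affine_pt x0 y0) (fun Q => tau Q i).
  rewrite /tau /triple_coord; case: (i == _); first exact: xcoord_reg.
  by case: (i == _); [exact: ycoord_reg | exact: reg_cst].
have rform m q : isform m q -> regular_at X (affine_pt x0 y0) (fun Q => q (tau Q)).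
  by move=> hq; exact: (reg_isform (phi := fun i Q => tau Q i) XP hq rtau).
have rG : regular_at X (affine_pt x0 y0) G.
  have rp (p : {poly k}) : regular_at X (affine_pt x0 y0) (fun Q => p.[xcoord Q]).
    by apply: reg_horner; exact: xcoord_reg.
  apply: reg_sub; apply: reg_mul; first exact: rp.
  - by apply: reg_mul; [exact: rform hb | exact: rform (form_conj W hb')].
  - exact: rp.
  - by apply: reg_mul; [exact: rform ha | exact: rform (form_conj W ha')].
have : near X (affine_pt x0 y0) (fun Q => G Q = 0).
  apply: (gen_reg0 irrX) => //.
  apply: (gen_map2 irrX _ (gen_poly D0) (near_gen (near_affine w0))).
  move=> Q _ [_ DQ] [_ wQ]; apply: (mulfI DQ); rewrite mulr0 /G /tau.
  have e1 := hN _ _ wQ; have e2 := hM _ _ wQ; rewrite eN hornerM in e1.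
  rewrite eM hornerM in e2.
  have e3 := gb _ _ wQ; have e4 := gb' _ _ (weq_conj wQ).
  rewrite !conj_affine in e1 e2 *.
  have alg (d1 t1 s1 g1 h1 a1' b1 g2 h2 a2' b2 : k) : t1 * d1 = g1 * g2 ->
      s1 * d1 = h1 * h2 -> g1 * b1 = a1' * h1 -> g2 * b2 = a2' * h2 ->
      d1 * (t1 * (b1 * b2) - s1 * (a1' * a2')) = 0.
    move=> f1 f2 f3 f4.
    transitivity ((t1 * d1) * (b1 * b2) - (s1 * d1) * (a1' * a2')); first by ring.
    rewrite f1 f2.
    transitivity ((g1 * b1) * (g2 * b2) - (a1' * h1) * (a2' * h2)); first by ring.
    by rewrite f3 f4 subrr.
  exact: (alg _ _ _ _ _ _ _ _ _ _ _ e1 e2 e3 e4).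
move/near_pt; rewrite /G /tau xcoord_pt ycoord_pt Sx0 mul0r subr0 conj_affine => /eqP.
by rewrite !mulf_eq0 (negPf Tx0) (negPf bP) (negPf bP').
Qed.

(** Each root contributes a point and its conjugate, hence possible
    repetitions. *)
Lemma fiber_points (p : {poly k}) : p != 0 -> exists r (s : 'I_r -> projsp k 2),
  (forall i, exists x y, [/\ weq W x y, p.[x] = 0 & s i = affine_pt x y]) /\
  (forall x y, weq W x y -> p.[x] = 0 -> exists i, affine_pt x y = s i).
Proof.
move=> p0; have [rs ep] := closed_field_poly_normal p.
have [Y hY] := choice (fun x => weq_ex W x).
pose l := [seq affine_pt x (Y x) | x <- rs] ++ [seq affine_pt x (conj_y W x (Y x)) | x <- rs].
have rootE x : (p.[x] == 0) = (x \in rs).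
  rewrite -[_ == 0]/(root p x) ep rootZ ?lead_coef_eq0 //.
  by rewrite root_prod_XsubC.
exists (size l), (fun i => nth (origin k) l i); split.
  move=> i; have : nth (origin k) l i \in l by rewrite mem_nth.
  rewrite {1}/l mem_cat => /orP [] /mapP [x xr ->].
    by exists x, (Y x); split=> //; apply/eqP; rewrite rootE.
  by exists x, (conj_y W x (Y x)); split=> //; [exact: weq_conj | apply/eqP; rewrite rootE].
move=> x y w px; suff : affine_pt x y \in l.
  by move=> /(nthP (origin k)) [i il ei]; exists (Ordinal il).
have xr : x \in rs by rewrite -rootE px.
have : (y - Y x) * (y - conj_y W x (Y x)) = 0.
  have := hY x; move: w; rewrite /weq /conj_y => e1 e2.
  transitivity ((y ^+ 2 + wa1 W * x * y + wa3 W * y) -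
    (Y x ^+ 2 + wa1 W * x * Y x + wa3 W * Y x)); first by ring.
  by rewrite e1 e2 subrr.
move/eqP; rewrite mulf_eq0 !subr_eq0 mem_cat => /orP [] /eqP ->.
  by rewrite (map_f (fun x => affine_pt x (Y x))).
by rewrite (map_f (fun x => affine_pt x (conj_y W x (Y x)))) ?orbT.
Qed.

End Smooth.

(** * Maps given by a quadratic equation over the x-line *)

Lemma param_unit (k : fieldType) n (X : set (projsp k n)) P pi u :
  irreducible X -> param X P pi -> regular_at X P u -> u P != 0 ->
  param X P (fun Q => pi Q * u Q).
Proof.
move=> irrX hp ru u0; have rp := param_reg hp; split.
- exact: reg_mul.
- by rewrite (param_0 hp) mul0r.
- move=> z; apply: (param_nz hp); apply: near_map2 z (reg_neq0 ru u0) => Q _ /eqP.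
  by rewrite mulf_eq0 => /orP [/eqP //|/eqP -> /eqP].
move=> f rf f0; have [g rg eg] := param_max hp rf f0.
exists (fun Q => g Q / u Q); first exact: reg_div.
apply: near_map2 eg (reg_neq0 ru u0) => Q _ -> uQ.
by field.
Qed.

Lemma closed_avoid (k : closedFieldType) (s : seq k) : exists c, c \notin s.
Proof.
have : \prod_(z <- s) ('X - z%:P) != 0.
  by apply: monic_neq0; exact: monic_prod_XsubC.
by move/closed_nonrootP => [c]; rewrite root_prod_XsubC => h; exists c.
Qed.

Section QuadraticMap.
Variables (k : closedFieldType) (W : weierstrass k).
Hypothesis smoothW : wdisc W != 0.
Let X := wcurve W.
Let irrX : irreducible X := @wcurve_irr k W.
Let dvrX := dvr_wcurve smoothW.
Let i0 : 'I_3 := inord 0.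
Let i1 : 'I_3 := inord 1.
Let i2 : 'I_3 := inord 2.

Variables (M D : {poly k}) (c1 : k) (f : projsp k 2 -> k).
(** The function f is a root of T^2 - c1 T - g with g = M / D of degree 4 in x.
    The poles of g on the curve are double, hence those of f are simple, and
    g - g(P) vanishes to the order 2 where the quadratic equation is inseparable,
    to the order 1 or 3 elsewhere. *)
Hypothesis szM : size M = 5%N.
Hypothesis szD : size D = 4%N.
Hypothesis coprimeMD : forall x, D.[x] = 0 -> M.[x] != 0.
Hypothesis poles_D : forall x y, weq W x y -> D.[x] = 0 ->
  (w_y W x y = 0 /\ exists2 c, D = ('X - x%:P) * c & c.[x] != 0) \/
  (w_y W x y != 0 /\ exists2 c, D = ('X - x%:P) ^+ 2 * c & c.[x] != 0).
Hypothesis unramified_D : forall x y, weq W x y -> D.[x] != 0 -> w_y W x y != 0.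
Hypothesis fiber_MD : forall x, D.[x] != 0 -> exists e c,
  [/\ D.[x] *: M - M.[x] *: D = ('X - x%:P) ^+ e * c, c.[x] != 0 &
      (c1 ^+ 2 + 4 * (M.[x] / D.[x]) = 0 /\ e = 2%N) \/
      (c1 ^+ 2 + 4 * (M.[x] / D.[x]) != 0 /\ (e = 1 \/ e = 3)%N)].
Hypothesis jacobianN : M^`() * D - M * D^`() != 0.
Hypothesis ratf : exists P, regular_at X P f.
Let g (Q : projsp k 2) := M.[xcoord Q] / D.[xcoord Q].
Hypothesis eq_f : gen X (fun Q => f Q ^+ 2 - c1 * f Q = g Q).

Let h := rational_map X f.

(** Where g is regular, f is integral over the local ring. *)
Let value_reg P psi : regular_at X P psi -> gen X (fun Q => psi Q = g Q) ->
  exists phi, [/\ regular_at X P phi, gen X (fun Q => phi Q = f Q) &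
    near X P (fun Q => phi Q ^+ 2 - c1 * phi Q = psi Q)].
Proof.
move=> rpsi epsi; have XP := reg_mem rpsi.
have rc c : regular_at X P (fun=> c) by exact: reg_cst.
have [[phi rphi ephi]|[phi [rphi phi0 ephi]]] := rational_dichotomy irrX dvrX ratf XP.
  exists phi; split=> //; apply: (gen_reg irrX) => //.
    by apply: reg_sub; [exact: reg_exp | exact: reg_mul].
  apply: (gen_map2 irrX _ (gen_and irrX ephi epsi) eq_f).
  by move=> Q _ [-> ->].
have : near X P (fun Q => phi Q ^+ 2 * psi Q = 1 - c1 * phi Q).
  apply: (gen_reg irrX).
  - by apply: reg_mul => //; exact: reg_exp.
  - by apply: reg_sub => //; exact: reg_mul.
  apply: (gen_map2 irrX _ (gen_and irrX ephi epsi) eq_f) => Q _ [e1 ->] <-.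
  transitivity ((phi Q * f Q) ^+ 2 - c1 * phi Q * (phi Q * f Q)); first by ring.
  by rewrite e1; ring.
move/near_pt/eqP; rewrite phi0 expr0n mul0r mulr0 subr0 eq_sym.
by rewrite (negPf (oner_neq0 k)).
Qed.

(** At a pole of g, it is 1 / f that is integral. *)
Let value_pole P psi : regular_at X P psi -> psi P = 0 ->
  gen X (fun Q => psi Q * g Q = 1) ->
  exists phi, [/\ regular_at X P phi, phi P = 0, gen X (fun Q => phi Q * f Q = 1) &
    near X P (fun Q => phi Q ^+ 2 = psi Q * (1 - c1 * phi Q))].
Proof.
move=> rpsi psi0 epsi; have XP := reg_mem rpsi.
have rc c : regular_at X P (fun=> c) by exact: reg_cst.
have [[phi rphi ephi]|[phi [rphi phi0 ephi]]] := rational_dichotomy irrX dvrX ratf XP.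
  have : near X P (fun Q => psi Q * (phi Q ^+ 2 - c1 * phi Q) = 1).
    apply: (gen_reg irrX) => //.
      by apply: reg_mul => //; apply: reg_sub; [exact: reg_exp | exact: reg_mul].
    apply: (gen_map2 irrX _ (gen_and irrX ephi epsi) eq_f).
    by move=> Q _ [-> e] ->.
  move/near_pt/eqP; rewrite psi0 mul0r eq_sym.
  by rewrite (negPf (oner_neq0 k)).
exists phi; split=> //; apply: (gen_reg irrX).
- exact: reg_exp.
- by apply: reg_mul => //; apply: reg_sub => //; exact: reg_mul.
apply: (gen_map2 irrX _ (gen_and irrX ephi epsi) eq_f) => Q _ [e1 e2] e3.
transitivity (phi Q ^+ 2 * (psi Q * g Q)); first by rewrite e2 mulr1.
rewrite -e3.
transitivity (psi Q * ((phi Q * f Q) ^+ 2 - c1 * phi Q * (phi Q * f Q))); first by ring.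
by rewrite e1; ring.
Qed.

Let ordat_sqrt P pi a b : param X P pi -> regular_at X P a -> a P = 0 ->
  near X P (fun Q => a Q ^+ 2 = b Q) -> ordat X P pi 2 b -> ordat X P pi 1 a.
Proof.
move=> hp ra a0 eab [u [ru u0 eu]]; have [v rv ev] := param_max hp ra a0.
exists v; split=> //.
have : near X P (fun Q => v Q ^+ 2 = u Q).
  apply: (reg_cancel irrX (reg_exp 2 (param_reg hp)) (reg_exp 2 rv) ru).
    exact: (param_exp_nz hp (e := 2)).
  by apply: near_map2 (near_and eab eu) ev => Q _ [<- <-] ->; rewrite exprMn.
by move/near_pt => e; move: u0; rewrite -e expf_eq0.
Qed.

(** The difference g - g(P) factors as f - f(P) times f + f(P) - c1. The second
    factor is a unit, unless f(P) is a double root: then both factors are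
    equal. *)
Let order_regular P pi psi c0 e : param X P pi -> (0 < e)%N ->
  regular_at X P psi -> gen X (fun Q => psi Q = g Q - c0) -> ordat X P pi e psi ->
  (c1 ^+ 2 + 4 * c0 = 0 /\ e = 2%N) \/ c1 ^+ 2 + 4 * c0 != 0 ->
  map_order X f P pi (if c1 ^+ 2 + 4 * c0 == 0 then 1 else e).
Proof.
move=> hp e0 rpsi epsi opsi alt; have XP := reg_mem rpsi.
have rc c : regular_at X P (fun=> c) by exact: reg_cst.
have psi0 := ordat_at0 hp e0 opsi.
have r1 : regular_at X P (fun Q => psi Q + c0) by exact: reg_add.
have eg1 : gen X (fun Q => psi Q + c0 = g Q).
  by apply: gen_sub epsi => Q _ ->; rewrite subrK.
have [phi [rphi ephi qphi]] := value_reg r1 eg1.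
left; exists phi; split=> //.
have eP := near_pt qphi; rewrite /= psi0 add0r in eP.
have rdiff : regular_at X P (fun Q => phi Q - phi P) by exact: reg_sub.
have fac : near X P (fun Q => (phi Q - phi P) * (phi Q + (phi P - c1)) = psi Q).
  apply: near_sub qphi => Q _ e1.
  transitivity ((phi Q ^+ 2 - c1 * phi Q) - (phi P ^+ 2 - c1 * phi P)); first by ring.
  by rewrite e1 eP addrK.
have disc : (phi P + (phi P - c1)) ^+ 2 = c1 ^+ 2 + 4 * c0 by rewrite -eP; ring.
case: ifP alt => [/eqP d0 [[_ e2]|]|/negbT dn _]; last 2 first.
- by [].
- have rs : regular_at X P (fun Q => phi Q + (phi P - c1)) by exact: reg_add.
  have s0 : phi P + (phi P - c1) != 0.
    by move: dn; rewrite -disc expf_eq0.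
  case: opsi => u [ru u0 eu]; exists (fun Q => u Q / (phi Q + (phi P - c1))); split.
  + exact: reg_div.
  + by rewrite mulf_neq0 ?invr_eq0.
  apply: near_map2 (near_and fac eu) (reg_neq0 rs s0) => Q _ [e1 e2] sQ.
  by rewrite mulrA -e2 -e1 mulfK.
apply: (ordat_sqrt (b := psi)) => //; first by rewrite subrr.
  have z : phi P + (phi P - c1) = 0.
    by move: d0; rewrite -disc => /eqP; rewrite expf_eq0 => /eqP.
  apply: near_sub fac => Q _ <-; rewrite expr2; congr (_ * _).
  by rewrite -[RHS]subr0 -z; ring.
by rewrite e2 in opsi.
Qed.

Let order_pole P pi psi : param X P pi -> regular_at X P psi ->
  gen X (fun Q => psi Q * g Q = 1) -> ordat X P pi 2 psi ->
  map_order X f P pi 1.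
Proof.
move=> hp rpsi epsi opsi; have XP := reg_mem rpsi.
have rc c : regular_at X P (fun=> c) by exact: reg_cst.
have psi0 := ordat_at0 hp (isT : (0 < 2)%N) opsi.
have [phi [rphi phi0 ephi qphi]] := value_pole rpsi psi0 epsi.
right; exists phi; split=> //; split=> //.
have rl : regular_at X P (fun Q => 1 - c1 * phi Q) by apply: reg_sub => //; exact: reg_mul.
apply: (ordat_sqrt hp rphi phi0 qphi).
have := ordat_mul opsi (ordat_unit hp rl _).
by rewrite addn0; apply; rewrite phi0 mulr0 subr0 oner_neq0.
Qed.

Let origin_inverse : exists psi, [/\ regular_at X (origin k) psi,
  psi (origin k) = 0, gen X (fun Q => psi Q * g Q = 1) &
  exists2 pi, param X (origin k) pi & ordat X (origin k) pi 2 psi].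
Proof.
have M0 : M != 0 by rewrite -size_poly_eq0 szM.
have D0 : D != 0 by rewrite -size_poly_eq0 szD.
have [RM RM0 hRM] := reverse_horner M0; have [RD RD0 hRD] := reverse_horner D0.
rewrite szM /= in hRM; rewrite szD /= in hRD.
have hp := param_origin W; have rxi := xinv_reg W; have ox := xinv_ord W.
have xi0 : xinv W (origin k) = 0 by exact: (ordat_at0 hp (isT : (0 < 2)%N) ox).
have rR (R : {poly k}) : regular_at X (origin k) (fun Q => R.[xinv W Q]).
  exact: reg_horner.
have RMO : RM.[xinv W (origin k)] != 0 by rewrite xi0.
have RDO : RD.[xinv W (origin k)] != 0 by rewrite xi0.
have op := ordat_mul ox (ordat_unit hp (reg_div (rR RD) (rR RM) RMO) _).
exists (fun Q => xinv W Q * (RD.[xinv W Q] / RM.[xinv W Q])); split.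
- by apply: reg_mul => //; exact: reg_div.
- by rewrite xi0 mul0r.
- have MDX : M * D * 'X != 0 by rewrite !mulf_neq0 ?polyX_eq0.
  apply: (gen_map2 irrX _ (gen_poly W MDX) (near_gen (xinvE W))).
  have nz x : (M * D * 'X).[x] != 0 -> [&& M.[x] != 0, D.[x] != 0 & x != 0].
    by rewrite !hornerM hornerX !mulf_eq0 !negb_or andbA.
  move=> Q _ [_ /nz /and3P [MQ DQ xQ]] ->; rewrite -hRM // -hRD // /g.
  move: (xcoord Q) MQ DQ xQ => x MQ DQ xQ; move: (M.[x]) (D.[x]) MQ DQ => a b a0 b0.
  by field; rewrite a0 b0 xQ.
eexists; first exact: hp.
by move: op; rewrite addn0; apply; rewrite mulf_neq0 ?invr_eq0.
Qed.

Let affine_inverse x y : weq W x y -> D.[x] = 0 ->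
  exists psi, [/\ regular_at X (affine_pt x y) psi,
  psi (affine_pt x y) = 0, gen X (fun Q => psi Q * g Q = 1) &
  exists2 pi, param X (affine_pt x y) pi & ordat X (affine_pt x y) pi 2 psi].
Proof.
move=> w Dx; have Mx := coprimeMD Dx; have XP := affine_pt_in w.
have rx := xcoord_reg w.
have rp (p : {poly k}) : regular_at X (affine_pt x y) (fun Q => p.[xcoord Q]).
  exact: reg_horner.
have M0 : M.[xcoord (affine_pt x y)] != 0 by rewrite xcoord_pt.
have M1 : M != 0 by rewrite -size_poly_eq0 szM.
have D1 : D != 0 by rewrite -size_poly_eq0 szD.
exists (fun Q => D.[xcoord Q] / M.[xcoord Q]); split.
- exact: reg_div.
- by rewrite xcoord_pt Dx mul0r.
- apply: gen_sub (gen_poly W (mulf_neq0 M1 D1)) => Q _ [_].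
  rewrite hornerM mulf_eq0 negb_or /g => /andP [MQ DQ].
  by field; rewrite MQ DQ.
have oc (c : {poly k}) pi : param X (affine_pt x y) pi -> c.[x] != 0 ->
    ordat X (affine_pt x y) pi 0 (fun Q => c.[xcoord Q] / M.[xcoord Q]).
  move=> hp cx; apply: (ordat_unit hp); first exact: reg_div.
  by rewrite xcoord_pt mulf_neq0 ?invr_eq0.
case: (poles_D w Dx) => [[ny [c eD cx]]|[ny [c eD cx]]].
  have [hp hx] := param_y smoothW w ny.
  eexists; first exact: hp.
  have := ordat_mul hx (oc _ _ hp cx); rewrite addn0; apply: ordat_near.
  by apply: near_all => // Q _; rewrite eD hornerM hornerXsubC mulrA.
have hp := param_x w ny; eexists; first exact: hp.
have := ordat_mul (ordat_exp hp 2 (ordat_self hp)) (oc _ _ hp cx).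
rewrite addn0 mul1n; apply: ordat_near.
by apply: near_all => // Q _; rewrite eD hornerM horner_exp hornerXsubC mulrA.
Qed.

Let affine_order x y : weq W x y -> D.[x] != 0 ->
  exists e, [/\ map_order X f (affine_pt x y) (fun Q => xcoord Q - x) e,
    (e = 1 \/ e = 3)%N & ((M^`() * D - M * D^`()).[x] != 0 -> e = 1%N)].
Proof.
move=> w Dx; have XP := affine_pt_in w.
have hp := param_x w (unramified_D w Dx).
have rp (p : {poly k}) : regular_at X (affine_pt x y) (fun Q => p.[xcoord Q]).
  by apply: reg_horner; exact: xcoord_reg.
have [e [c [eq cx alt]]] := fiber_MD Dx.
have Dx' : D.[x] * D.[xcoord (affine_pt x y)] != 0 by rewrite xcoord_pt mulf_neq0.
have rDD : regular_at X (affine_pt x y) (fun Q => D.[x] * D.[xcoord Q]).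
  by apply: reg_mul => //; exact: reg_cst.
have e0 : (0 < e)%N by case: alt => [[_ ->]|[_ []->]].
have := order_regular (P := affine_pt x y) (c0 := M.[x] / D.[x]) (e := e)
  (psi := fun Q => (D.[x] *: M - M.[x] *: D).[xcoord Q] / (D.[x] * D.[xcoord Q])) hp e0.
move=> H; exists (if c1 ^+ 2 + 4 * (M.[x] / D.[x]) == 0 then 1%N else e); split.
- apply: H.
  + exact: reg_div.
  + have DD : D != 0 by rewrite -size_poly_eq0 szD.
    apply: gen_sub (gen_poly W DD) => Q _ [_ DQ].
    rewrite /g hornerD hornerN !hornerZ.
    by field; rewrite Dx DQ.
  + have oc : ordat X (affine_pt x y) (fun Q => xcoord Q - x) 0
        (fun Q => c.[xcoord Q] / (D.[x] * D.[xcoord Q])).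
      apply: (ordat_unit hp); first exact: reg_div.
      by rewrite mulf_neq0 ?invr_eq0 // xcoord_pt.
    have := ordat_mul (ordat_exp hp e (ordat_self hp)) oc.
    rewrite addn0 mul1n; apply: ordat_near; apply: near_all => // Q _.
    by rewrite eq hornerM horner_exp hornerXsubC mulrA.
  + by case: alt => [[? ?]|[? _]]; [left | right].
- case: alt => [[-> _]|[/negPf -> //]].
  by rewrite eqxx; left.
move=> Nx.
have dT : (D.[x] *: M - M.[x] *: D)^`().[x] = (M^`() * D - M * D^`()).[x].
  rewrite derivB !derivZ !hornerD !hornerN !hornerZ !hornerM.
  by rewrite mulrC.
have sq (q : {poly k}) : (('X - x%:P) ^+ 2 * q)^`().[x] = 0.
  rewrite expr2 !derivM derivXsubC !(hornerD, hornerM, hornerN, hornerX, hornerC).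
  by ring.
case: eqP => // _; case: alt => [[_ e2]|[_ [//|e3]]]; exfalso; move: Nx.
  by rewrite -dT eq e2 sq eqxx.
by rewrite -dT eq e3 exprSr -mulrA sq eqxx.
Qed.

Let orders P : X P -> exists2 pi, param X P pi &
  map_order X f P pi 1 \/ map_order X f P pi 3.
Proof.
move=> XP; case: (wcurve_cases XP) => [->|[x [y [w -> _]]]].
  have [psi [rpsi psi0 epsi [pi hp op]]] := origin_inverse.
  by exists pi => //; left; exact: (order_pole hp rpsi epsi op).
case: (eqVneq D.[x] 0) => Dx.
  have [psi [rpsi psi0 epsi [pi hp op]]] := affine_inverse w Dx.
  by exists pi => //; left; exact: (order_pole hp rpsi epsi op).
have [e [mo [] e1 _]] := affine_order w Dx; rewrite e1 in mo;
  (eexists; [exact: (param_x w (unramified_D w Dx))|]); [by left | by right].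
Qed.

Lemma quadratic_only_triple : only_triple_ramification X (proj_line k) h.
Proof.
move=> P [XP net]; have [pi hp [mo|mo]] := orders XP.
  by case: net; exact: (map_order_etale irrX dvrX ratf hp mo).
exact: (map_order_ramification irrX dvrX ratf hp mo).
Qed.

Let xcoord_near P (p : {poly k}) : X P -> hcoord P i2 != 0 -> p.[xcoord P] != 0 ->
  near X P (fun Q => hcoord Q i2 != 0 /\ p.[xcoord Q] != 0).
Proof.
move=> XP zP pP; apply: near_and; first exact: (near_form XP (form_var k i2)).
apply: reg_neq0 => //; apply: reg_horner.
exact: (reg_form XP (form_var k i0) (form_var k i2)).
Qed.

Lemma quadratic_generically_etale : generically_etale X (proj_line k) h.
Proof.
pose p := (M^`() * D - M * D^`()) * D.
have p0 : p != 0 by rewrite mulf_neq0 // -size_poly_eq0 szD.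
exists [set Q | [/\ X Q, hcoord Q i2 != 0 & p.[xcoord Q] != 0]]; split.
- apply/open_inP; split=> [Q [] //|Q [XQ zQ pQ]].
  by apply: near_sub (xcoord_near XQ zQ pQ) => R XR [].
- move=> V oV [Q VQ].
  have [R XR [VR [zR pR]]] := gen_ex (gen_and irrX (near_gen (open_near oV VQ))
    (gen_poly W p0)).
  by exists R.
move=> P [XP zP pP]; have w := wcurve_affine XP zP.
rewrite (affine_ptE zP); move: (xcoord P) (ycoord P) w pP => x y w.
rewrite /p hornerM mulf_eq0 negb_or => /andP [Nx Dx].
have [e [mo _ /(_ Nx) e1]] := affine_order w Dx; rewrite e1 in mo.
exact: (map_order_etale irrX dvrX ratf (param_x w (unramified_D w Dx)) mo).
Qed.

(** Modulo the equation of the curve, Z times this conic is the cube of X - z Z.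
    It meets the curve exactly in the two points over x = z, whereas the line
    X = z Z also passes through the origin. *)
Let conic z (v : 'I_3 -> k) := v i1 * v i1 + wa1 W * (v i0 * v i1) +
  wa3 W * (v i1 * v i2) - (wa2 W + 3 * z) * (v i0 * v i0) -
  (wa4 W - 3 * z ^+ 2) * (v i0 * v i2) - (wa6 W + z ^+ 3) * (v i2 * v i2).

Let conic_form z : isform 2 (conic z).
Proof.
have q i j : isform 2 (fun v : 'I_3 -> k => v i * v j).
  by apply: (form_mul (d := 1) (e := 1)); exact: form_var.
by do ?[apply: form_sub | apply: form_add | exact: q | exact: form_scale].
Qed.

Let conic_affine z P : X P -> hcoord P i2 != 0 ->
  (conic z (hcoord P) == 0) = (xcoord P == z).
Proof.
rewrite /X /wcurve /= -/i0 -/i1 -/i2 => e zP.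
have e1 : hcoord P i2 * conic z (hcoord P) = (hcoord P i0 - z * hcoord P i2) ^+ 3.
  rewrite /conic; move: (hcoord P i0) (hcoord P i1) (hcoord P i2) e => a b c e.
  transitivity ((b ^+ 2 * c + wa1 W * a * b * c + wa3 W * b * c ^+ 2) -
    (wa2 W + 3 * z) * a ^+ 2 * c - (wa4 W - 3 * z ^+ 2) * a * c ^+ 2 -
    (wa6 W + z ^+ 3) * c ^+ 3); first by ring.
  by rewrite e; ring.
have -> : (conic z (hcoord P) == 0) = (hcoord P i2 * conic z (hcoord P) == 0).
  by rewrite mulf_eq0 (negPf zP).
rewrite e1 expf_eq0 /= subr_eq0 /xcoord -/i0 -/i2.
by rewrite -(inj_eq (mulIf zP) (_ / _)) divfK.
Qed.

Let conic_origin z : conic z (hcoord (origin k)) != 0.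
Proof.
have [c c0 ec] := hcoord_pt (origin_nz k).
rewrite /conic ec triple0 triple1 triple2.
by rewrite !(mulr0, mul0r, mulr1, addr0, subr0) mulf_neq0.
Qed.

Section Chart.
Variable c : k.
(** The value c is not critical for g. The chart V leaves out the values of f over
    g = c, hence its preimage leaves out the fibre of g over c. *)
Hypothesis c_regular : forall x, (M^`() * D - M * D^`()).[x] = 0 -> D.[x] != 0 ->
  M.[x] / D.[x] != c.
Let G := M - c *: D.
Let lambda (v : 'I_2 -> k) :=
  v (lift ord0 ord0) * v (lift ord0 ord0) - c1 * (v ord0 * v (lift ord0 ord0)) -
  c * (v ord0 * v ord0).
Let V : set (projsp k 1) := [set R | lambda (hcoord R) != 0].
Let U := X `&` h @^-1` V.

Let lambda_form : isform 2 lambda.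
Proof.
have q i j : isform 2 (fun v : 'I_2 -> k => v i * v j).
  by apply: (form_mul (d := 1) (e := 1)); exact: form_var.
by do ?[apply: form_sub | apply: form_add | exact: q | exact: form_scale].
Qed.

Let V_open : open_in (proj_line k) V.
Proof. by apply/open_inP; split=> // R VR; exact: near_form lambda_form VR. Qed.

Let U_open : open_in X U.
Proof.
by have [_ H _] := rational_map_morphism irrX dvrX ratf; exact: H.
Qed.

Let sizeG : size G = 5%N.
Proof.
rewrite size_polyDl ?szM // size_polyN.
by rewrite (leq_ltn_trans (size_scale_leq _ _)) ?szD.
Qed.

Let G0 : G != 0. Proof. by rewrite -size_poly_eq0 sizeG. Qed.

Let G_D x : G.[x] = 0 -> D.[x] != 0.
Proof.
move=> Gx; apply/eqP => Dx; have := coprimeMD Dx; move: Gx.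
by rewrite /G hornerD hornerN hornerZ Dx mulr0 subr0 => ->; rewrite eqxx.
Qed.

Let lambda_pt a b : (exists i, pair_coord a b i != 0) ->
  (lambda (hcoord (pt (pair_coord a b))) != 0) = (b * b - c1 * (a * b) - c * (a * a) != 0).
Proof. by move=> nz; rewrite (form_pt_neq0 lambda_form). Qed.

Let U_pole P psi : regular_at X P psi -> psi P = 0 ->
  gen X (fun Q => psi Q * g Q = 1) -> V (h P).
Proof.
move=> rpsi psi0 epsi; have [phi [rphi phi0 ephi _]] := value_pole rpsi psi0 epsi.
rewrite /V /= /h (rational_map_pole irrX rphi ephi) phi0 lambda_pt.
  by rewrite mul0r !mulr0 !subr0 mulr1 oner_neq0.
by apply: pair_coord_nz; right; exact: oner_neq0.
Qed.

Let U_origin : V (h (origin k)).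
Proof.
by have [psi [rpsi psi0 epsi _]] := origin_inverse; exact: U_pole psi0 epsi.
Qed.

Let U_affine x y : weq W x y ->
  (lambda (hcoord (h (affine_pt x y))) != 0) = (G.[x] != 0).
Proof.
move=> w; case: (eqVneq D.[x] 0) => Dx.
  have [psi [rpsi psi0 epsi _]] := affine_inverse w Dx.
  rewrite [LHS](U_pole rpsi psi0 epsi) /G hornerD hornerN hornerZ Dx mulr0 subr0.
  by rewrite coprimeMD.
have XP := affine_pt_in w; have rx := xcoord_reg w.
have rg : regular_at X (affine_pt x y) g.
  by apply: reg_div; [exact: reg_horner | exact: reg_horner | rewrite xcoord_pt].
have [|phi [rphi ephi qphi]] := value_reg rg.
  by apply: (@near_gen _ _ X (affine_pt x y)); exact: near_all.
rewrite /h (rational_mapE irrX rphi ephi) lambda_pt; last first.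
  by apply: pair_coord_nz; left; exact: oner_neq0.
rewrite mul1r mulr1 mulr1 -expr2 (near_pt qphi) /g xcoord_pt.
rewrite /G hornerD hornerN hornerZ.
have -> : M.[x] / D.[x] - c = (M.[x] - c * D.[x]) / D.[x] by field.
by rewrite mulf_eq0 invr_eq0 (negPf Dx) orbF.
Qed.

Let chart_affine_base : affine V.
Proof.
have clT : zariski_closed (proj_line k).
  have [|T [hT eT]] := @closedP k 1 set0; first by move=> phi [].
  exists T; split=> //; rewrite -eT; apply/seteqP; split=> // R _ phi [].
have := affine_form clT lambda_form.
by congr affine; apply/seteqP; split=> R //= [].
Qed.

Let closedX : zariski_closed X.
Proof.
pose phi (v : 'I_3 -> k) := (v i1 * v i1) * v i2 + wa1 W * ((v i0 * v i1) * v i2) +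
  wa3 W * ((v i1 * v i2) * v i2) - (v i0 * v i0) * v i0 - wa2 W * ((v i0 * v i0) * v i2) -
  wa4 W * ((v i0 * v i2) * v i2) - wa6 W * ((v i2 * v i2) * v i2).
have fphi : isform 3 phi.
  have q i j l : isform 3 (fun v : 'I_3 -> k => (v i * v j) * v l).
    apply: (form_mul (d := 2) (e := 1)); last exact: form_var.
    by apply: (form_mul (d := 1) (e := 1)); exact: form_var.
  by do ?[apply: form_sub | apply: form_add | exact: q | exact: form_scale].
have := @closedP k 2 [set psi | psi = phi] _.
have H : forall psi, [set psi | psi = phi] psi -> exists d, isform d psi.
  by move=> psi ->; exists 3%N.
move/(_ H); congr zariski_closed; apply/seteqP; split=> P /=.
  move/(_ phi erefl); rewrite /phi /X /wcurve /= -/i0 -/i1 -/i2 => e.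
  apply/eqP; rewrite -subr_eq0; apply/eqP; rewrite -[RHS]e; ring.
rewrite /X /wcurve /= -/i0 -/i1 -/i2 => e psi ->; rewrite /phi.
move: e => /eqP; rewrite -subr_eq0 => /eqP e; rewrite -[RHS]e; ring.
Qed.

(** The fibre of g over c is cut out by the product of the conics of its four
    x-coordinates. *)
Let chart_affine : affine U.
Proof.
have [rs eG] := closed_field_poly_normal G.
have rootG x : (G.[x] == 0) = (x \in rs).
  by rewrite -[_ == 0]/(root G x) eG rootZ ?lead_coef_eq0 // root_prod_XsubC.
pose K (v : 'I_3 -> k) := \prod_(z <- rs) conic z v.
have fK : isform (2 * size rs) K.
  rewrite /K; elim: (rs) => [|z l IH].
    by apply: form_ext (form_cst 2 1) => v; rewrite big_nil.
  rewrite /= mulnS; apply: form_ext (form_mul (conic_form z) IH) => v.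
  by rewrite big_cons.
have srs : size rs = 4%N.
  have := sizeG; rewrite eG size_scale ?lead_coef_eq0 // size_prod_XsubC.
  by case.
rewrite srs in fK; have := affine_form closedX fK.
have K0 P : (K (hcoord P) != 0) = all (fun z => conic z (hcoord P) != 0) rs.
  by rewrite /K prodf_seq_neq0.
congr affine; apply/seteqP; split=> P [XP] /= hP; split=> //; move: hP; rewrite /= K0.
  case: (wcurve_cases XP) => [-> _|[x [y [w eP zP]]]]; first exact: U_origin.
  move/allP => hz; rewrite /V /= eP U_affine // rootG; apply/negP => /hz.
  by rewrite conic_affine // eP xcoord_pt eqxx.
case: (wcurve_cases XP) => [-> _|[x [y [w eP zP]]]].
  by apply/allP => z _; exact: conic_origin.
rewrite {1}eP /V /= U_affine // rootG => nx; apply/allP => z zr.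
rewrite conic_affine // eP xcoord_pt; apply: contraNneq nx => -> //.
Qed.

(** Since c is not critical, theta = g - c is a parameter at each point of the
    fibre left out, and 1 / theta is the pullback of a function on V. *)
Let chart_finite : finite_over U V h.
Proof.
have [r [s [hs1 hs2]]] := fiber_points W G0.
pose theta Q := G.[@xcoord k Q] / D.[xcoord Q].
pose F (R : projsp k 1) := (hcoord R ord0 * hcoord R ord0) / lambda (hcoord R).
have D0 : D != 0 by rewrite -size_poly_eq0 szD.
have regF : regular_on V F.
  move=> R VR; apply/(reg_openE _ V_open VR).
  apply: (@reg_form k 1 (proj_line k) R 2 (fun v => v ord0 * v ord0) lambda) => //.
  by apply: (form_mul (d := 1) (e := 1)); exact: form_var.
apply: (@finite_by_poles k 2 1 X V h irrX dvrX
  (regular_cst smoothW) U_open _ r s theta _ _ F regF).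
- by exists (origin k); split; [exact: origin_in | exact: U_origin].
- move=> P XP; case: (wcurve_cases XP) => [->|[x [y [w eP zP]]]].
    by left; split; [exact: origin_in | exact: U_origin].
  case: (eqVneq G.[x] 0) => Gx; last first.
    by left; split=> //; rewrite eP /= /V /= U_affine.
  by right; rewrite eP; exact: hs2.
- move=> i; have [x [y [w Gx ->]]] := hs1 i.
  have Dx := G_D Gx; have hp := param_x w (unramified_D w Dx).
  have [q eq] := factor_theorem _ _ (introT eqP Gx : root G x).
  have qx : q.[x] != 0.
    have eMG : M = G + c *: D by rewrite /G subrK.
    have Mx : M.[x] = c * D.[x] by rewrite eMG hornerD hornerZ Gx add0r.
    have N1 : (M^`() * D - M * D^`()).[x] != 0.
      apply/eqP => Nx; have /eqP := c_regular Nx Dx; apply.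
      by rewrite Mx mulfK.
    apply: contraNneq N1 => qx; rewrite hornerD hornerN !hornerM Mx.
    rewrite {1}eMG derivD derivZ eq derivM derivXsubC !(hornerD, hornerZ, hornerM, hornerN, hornerX, hornerC).
    by rewrite qx; apply/eqP; ring.
  have rx := xcoord_reg w.
  have Dx' : D.[xcoord (affine_pt x y)] != 0 by rewrite xcoord_pt.
  have ru : regular_at X (affine_pt x y) (fun Q => q.[xcoord Q] / D.[xcoord Q]).
    by apply: reg_div => //; exact: reg_horner.
  eexists.
    by apply: (param_unit irrX hp ru); rewrite xcoord_pt mulf_neq0 ?invr_eq0.
  apply: (@near_gen _ _ X (affine_pt x y)); apply: near_all => [|Q _].
    exact: affine_pt_in.
  by rewrite /theta eq hornerM hornerXsubC mulrA [_ * (xcoord Q - x)]mulrC.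
- have [_ _ H] := rational_map_morphism irrX dvrX ratf.
  exact: H V_open regF.
have [P1 rf] := ratf; have X1 := reg_mem rf.
have eff : gen X (fun Q => f Q = f Q) by apply: (@near_gen _ _ X P1); exact: near_all.
have hQ := near_gen (rational_map_near irrX rf eff).
apply: (gen_map2 irrX _ (gen_and irrX hQ eq_f) (gen_poly W (mulf_neq0 G0 D0))).
move=> Q _ [e1 e2] [_]; rewrite hornerM mulf_eq0 negb_or => /andP [GQ DQ].
have nz : exists i, pair_coord 1 (f Q) i != 0.
  by apply: pair_coord_nz; left; exact: oner_neq0.
have [b b0 eb] := hcoord_pt nz.
have et : theta Q = f Q ^+ 2 - c1 * f Q - c.
  by rewrite e2 /theta /g /G hornerD hornerN hornerZ; field.
have t0 : theta Q != 0 by rewrite /theta mulf_neq0 ?invr_eq0.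
rewrite /F /h e1 eb (form_homog lambda_form).
have -> : lambda (pair_coord 1 (f Q)) = theta Q.
  by rewrite et /lambda /pair_coord /=; ring.
by rewrite /pair_coord /=; field; rewrite t0 b0.
Qed.

Lemma quadratic_chart : [/\ open_in (proj_line k) V, affine V, affine U &
  finite_over U V h].
Proof. by split. Qed.

End Chart.

Theorem quadratic_finite : finite_morphism X (proj_line k) h.
Proof.
split; first exact: rational_map_morphism.
move=> Q _.
have [rs eN] := closed_field_poly_normal (M^`() * D - M * D^`()).
pose q0 := hcoord Q ord0; pose q1 := hcoord Q (lift ord0 ord0).
have [c] := closed_avoid ((q1 * q1 - c1 * (q0 * q1)) / (q0 * q0) ::
  [seq M.[x] / D.[x] | x <- rs]).
rewrite inE negb_or => /andP [cQ cN].
have [|oV aV aU fU] := @quadratic_chart c.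
  move=> x Nx Dx; apply: contraNneq cN => <-; apply: (map_f (fun x => M.[x] / D.[x])).
  have : root (M^`() * D - M * D^`()) x by apply/eqP.
  by rewrite {1}eN rootZ ?lead_coef_eq0 // root_prod_XsubC.
eexists; split; [exact: oV | | exact: aV | exact: aU | exact: fU].
rewrite /= -/q0 -/q1; case: (eqVneq q0 0) => [z|z].
  have z1 : q1 != 0.
    have [i hi] := hcoord_neq0 Q.
    case: (unliftP ord0 i) => [j ej|ei]; last by rewrite ei -/q0 z eqxx in hi.
    by rewrite /q1; move: hi; rewrite ej (ord1 j).
  by rewrite z !mul0r !mulr0 !subr0 mulf_neq0.
apply: contraNneq cQ => e; apply/eqP; apply: (mulIf (mulf_neq0 z z)).
rewrite divfK ?mulf_neq0 //; apply/esym/eqP; rewrite -subr_eq0; apply/eqP.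
exact: e.
Qed.

End QuadraticMap.

(** * The covering in characteristic different from 2 *)

Definition triple_covering (k : fieldType) (W : weierstrass k)
    (h : projsp k 2 -> projsp k 1) :=
  [/\ finite_morphism (wcurve W) (proj_line k) h,
      generically_etale (wcurve W) (proj_line k) h &
      only_triple_ramification (wcurve W) (proj_line k) h].

Lemma root_power_uniq (k : fieldType) (a : k) (p q : {poly k}) m n :
  p.[a] != 0 -> q.[a] != 0 ->
  ('X - a%:P) ^+ m * p = ('X - a%:P) ^+ n * q -> m = n.
Proof.
wlog lt : m n p q / (m < n)%N => [H pa qa e|pa _ e].
  case: (ltngtP m n) => // lt; first exact: H lt pa qa e.
  by apply/esym/(H _ _ _ _ lt qa pa).
exfalso; move: e; rewrite -(subnKC lt) exprD exprSr -!mulrA.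
move/(mulfI (expf_neq0 m (negbT (polyXsubC_eq0 a))))/(congr1 (fun p => p.[a])).
by rewrite hornerM hornerXsubC subrr mul0r => e; rewrite e eqxx in pa.
Qed.

Section OddCharacteristic.
Variables (k : closedFieldType) (W : weierstrass k).
Hypothesis smoothW : wdisc W != 0.
Hypothesis two0 : (2 : k) != 0.
Hypothesis three0 : (3 : k) != 0.
Hypothesis c4_0 : wc4 W != 0.
Let X := wcurve W.
Let b2 := wb2 W.
Let b4 := wb4 W.
Let b6 := wb6 W.

(** With x + h as coordinate, (2y + a1 x + a3)^2 is 4 times
   (x + h)^3 + A (x + h) + B. *)
Let h := b2 / 12.
Let A := b4 / 2 - 3 * h ^+ 2.
Let B := b6 / 4 - h ^+ 3 - A * h.

Let four0 : (4 : k) != 0.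
Proof. by rewrite (_ : 4 = 2 * 2 :> k) ?mulf_neq0 //; ring. Qed.
Let twelve0 : (12 : k) != 0.
Proof. by rewrite (_ : 12 = 4 * 3 :> k) ?mulf_neq0 //; ring. Qed.

Let A0 : A != 0.
Proof.
apply: contraNneq c4_0 => e; have : - 48 * A = 0 by rewrite e mulr0.
rewrite /A /h /wc4 -/b2 -/b4 => <-; apply/eqP.
by field; rewrite ?two0 ?three0 ?twelve0.
Qed.

(** The zeros of the function will lie over x + h = n and x + h = m, and
    q is the constant term of the polynomial R below. With s = n + m, the second
    equation gives q, the first one n m, and the third one becomes a quartic
    equation for s. The root s must not be zero: for B = 0 the quartic is
    divisible by s^2, but the quotient has a nonzero constant term as A is
    nonzero. *)
Lemma covering_parameters : exists n m q, [/\
  (n + m) ^+ 2 / 4 + 2 * q = 3 * (A - n * m),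
  (n + m) * q = 4 * B - A * (n + m) &
  q ^+ 2 = - (A * (n * m) + 2 * B * (n + m))].
Proof.
have [s s0 hs] : exists2 s, s != 0 & A * s ^+ 4 - 24 * B * s ^+ 3 -
    32 * A ^+ 2 * s ^+ 2 + 128 * A * B * s - 192 * B ^+ 2 = 0.
  case: (eqVneq B 0) => [->|B0].
    have [s hs] := quadratic_root 0 (32 * A); rewrite mul0r addr0 in hs.
    exists s.
      apply: contraNneq A0 => s0; have : 2 ^+ 5 * A = 0.
        by transitivity (s ^+ 2); [rewrite hs; ring | rewrite s0; ring].
      by move/eqP; rewrite mulf_eq0 expf_eq0 (negPf two0).
    transitivity (A * (s ^+ 2) * (s ^+ 2 - 32 * A)); first by ring.
    by rewrite hs subrr mulr0.
  pose p : {poly k} := A *: 'X^4 + (- (24 * B) *: 'X^3 +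
    (- (32 * A ^+ 2) *: 'X^2 + ((128 * A * B) *: 'X - (192 * B ^+ 2)%:P))).
  have sp : size p != 1%N.
    rewrite /p size_polyDl size_scale // size_polyXn //.
    do 3!rewrite (leq_ltn_trans (size_polyD _ _)) // gtn_max
      (leq_ltn_trans (size_scale_leq _ _)) ?size_polyXn ?size_polyX //=.
    by rewrite size_polyN (leq_ltn_trans (size_polyC_leq1 _)).
  have /closed_rootP [s /eqP] := sp.
  rewrite /p !(hornerD, hornerZ, hornerN, hornerXn, hornerX, hornerC) => hs.
  exists s; last by rewrite -[RHS]hs; ring.
  apply: contraNneq B0 => s0; have : (2 ^+ 6 * 3) * (B * B) = 0.
    by rewrite -[RHS]oppr0 -[in RHS]hs s0; ring.
  have nz : (2 ^+ 6 * 3 : k) != 0 by rewrite mulf_neq0 ?expf_neq0.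
  by move/eqP; rewrite mulf_eq0 (negPf nz) mulf_eq0 orbb.
pose t := 5 * A / 3 - s ^+ 2 / 12 - 8 * B / (3 * s).
have [n hn] := quadratic_root (- s) (- t).
have et : n * (s - n) = t.
  by apply: oppr_inj; rewrite -hn; ring.
exists n, (s - n), (4 * B / s - A); rewrite et (_ : n + (s - n) = s); last by ring.
split.
- by rewrite /t; field; rewrite ?s0 ?three0 ?twelve0 ?four0.
- by field; rewrite ?s0.
apply/eqP; rewrite -subr_eq0; apply/eqP.
transitivity (- (A * s ^+ 4 - 24 * B * s ^+ 3 -
    32 * A ^+ 2 * s ^+ 2 + 128 * A * B * s - 192 * B ^+ 2) / (12 * s ^+ 2)).
  by rewrite /t; field; rewrite ?s0 ?three0 ?twelve0.
by rewrite hs oppr0 mul0r.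
Qed.

Section Covering.
Variables n m q : k.
Hypothesis r1 : (n + m) ^+ 2 / 4 + 2 * q = 3 * (A - n * m).
Hypothesis r2 : (n + m) * q = 4 * B - A * (n + m).
Hypothesis r3 : q ^+ 2 = - (A * (n * m) + 2 * B * (n + m)).

Let Xh : {poly k} := 'X + h%:P.
Let Q : {poly k} := (Xh - n%:P) * (Xh - m%:P).
Let D : {poly k} := 4 *: 'X^3 + (b2 *: 'X^2 + ((2 * b4) *: 'X + b6%:P)).
Let R : {poly k} := Xh ^+ 2 + ((n + m) / 2) *: Xh + q%:P.
Let hE := (hornerD, hornerN, hornerM, hornerZ, hornerXn, hornerX, hornerC, horner_exp).

Let Qx x : Q.[x] = (x + h - n) * (x + h - m).
Proof. by rewrite /Q /Xh !hE. Qed.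
Let Rx x : R.[x] = (x + h) ^+ 2 + (n + m) / 2 * (x + h) + q.
Proof. by rewrite /R /Xh !hE. Qed.
Let Dx x : D.[x] = 4 * ((x + h) ^+ 3 + A * (x + h) + B).
Proof.
rewrite /D !hE /B /A /h; field.
by rewrite ?two0 ?four0 ?twelve0.
Qed.
Let Q'x x : Q^`().[x] = (x + h - n) + (x + h - m).
Proof. by rewrite /Q /Xh !derivE !hE; ring. Qed.
Let D'x x : D^`().[x] = 4 * (3 * (x + h) ^+ 2 + A).
Proof.
rewrite /D !derivE !hE /A /h; field.
by rewrite ?two0 ?twelve0.
Qed.

(** Up to the factor 2 w^3, the left side is the derivative of Q / w for w^2 = D, so that
    this derivative has only double zeros. *)
Let square_identity : 2 *: (Q^`() * D) - Q * D^`() = 4 *: R ^+ 2.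
Proof.
apply/eqP; rewrite -subr_eq0; apply/eqP; apply: poly_all_roots => x.
rewrite hornerD hornerN hornerD hornerN !hornerZ (hornerM Q^`()) (hornerM Q).
rewrite horner_exp Q'x D'x Qx Dx Rx; set z := x + h.
transitivity (- 4 * (((n + m) ^+ 2 / 4 + 2 * q - 3 * (A - n * m)) * z ^+ 2 +
  ((n + m) * q - (4 * B - A * (n + m))) * z +
  (q ^+ 2 + (A * (n * m) + 2 * B * (n + m))))).
  by field; rewrite ?two0 ?four0.
by rewrite r1 r2 r3 !subrr addNr; ring.
Qed.

Let identity_at z : (z - n + (z - m)) * (z ^+ 3 + A * z + B) * 2 -
  (z - n) * (z - m) * (3 * z ^+ 2 + A) = (z ^+ 2 + (n + m) / 2 * z + q) ^+ 2.
Proof.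
have := congr1 (fun p : {poly k} => p.[z - h]) square_identity.
rewrite /= hornerD hornerN !hornerZ (hornerM Q^`()) (hornerM Q).
rewrite horner_exp Q'x D'x Qx Dx Rx subrK => e; apply: (mulfI four0).
by rewrite -e; ring.
Qed.

Let D_wy x y : weq W x y -> w_y W x y ^+ 2 = D.[x].
Proof.
rewrite /weq /w_y /D !hE /b2 /b4 /b6 /wb2 /wb4 /wb6 => w.
transitivity (4 * (y ^+ 2 + wa1 W * x * y + wa3 W * y) + (wa1 W * x + wa3 W) ^+ 2).
  by ring.
by rewrite w; ring.
Qed.

Let D_simple x y : weq W x y -> D.[x] = 0 -> D^`().[x] != 0.
Proof.
move=> w Dz; have wy : w_y W x y = 0.
  by apply/eqP; rewrite -sqrf_eq0 D_wy // Dz.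
apply: contraNneq (smooth_point smoothW w wy) => e.
have ey : 2 * y = - (wa1 W * x + wa3 W).
  by move/eqP: wy; rewrite /w_y -addrA addr_eq0 => /eqP.
apply/eqP; apply: (mulfI four0); apply: oppr_inj; rewrite mulr0 oppr0 -e.
rewrite /D !derivE !hE /b2 /b4 /wb2 /wb4 /w_x.
transitivity (- (2 * wa1 W) * (2 * y) + 4 * (3 * x ^+ 2 + 2 * wa2 W * x + wa4 W)).
  by ring.
by rewrite ey; ring.
Qed.

Let n_neq_m : n != m.
Proof.
apply: contraNneq A0 => e; move: (identity_at n); rewrite -e !subrr addr0 !mul0r subrr.
move/esym/eqP; rewrite expf_eq0 /= => /eqP eR.
have : 3 * A = 0.
  transitivity (2 * (n ^+ 2 + (n + n) / 2 * n + q) -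
    ((n + n) ^+ 2 / 4 + 2 * q - 3 * (A - n * n))).
    by field; rewrite two0 four0.
  have r1' : (n + n) ^+ 2 / 4 + 2 * q = 3 * (A - n * n) by move: r1; rewrite -e.
  by rewrite eR r1' subrr mulr0 subr0.
by move/eqP; rewrite mulf_eq0 (negPf three0).
Qed.

(** A common root of Q and D would be a double root of D. *)
Let P_root_neq0 z : (z - n) * (z - m) = 0 -> z ^+ 3 + A * z + B != 0.
Proof.
move=> Qz; apply/eqP => Pz.
have nz : z - n + (z - m) != 0.
  have : (z == n) || (z == m).
    by rewrite -(subr_eq0 z n) -(subr_eq0 z m) -mulf_eq0 Qz.
  case/orP => /eqP ->; first by rewrite subrr add0r subr_eq0.
  by rewrite subrr addr0 subr_eq0 eq_sym.
have Rz : z ^+ 2 + (n + m) / 2 * z + q = 0.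
  move: (identity_at z); rewrite Pz Qz mulr0 !mul0r subrr => /esym/eqP.
  by rewrite expf_eq0 => /andP [_ /eqP].
have P'z : 3 * z ^+ 2 + A = 0.
  apply: (mulfI nz); rewrite mulr0.
  transitivity (2 * (z ^+ 2 + (n + m) / 2 * z + q) * (2 * z + (n + m) / 2) -
    4 * (z ^+ 3 + A * z + B) + 6 * z * ((z - n) * (z - m)) -
    2 * ((n + m) ^+ 2 / 4 + 2 * q - 3 * (A - n * m)) * z -
    ((n + m) * q - (4 * B - A * (n + m)))).
    by field; rewrite two0 four0.
  by rewrite Rz Pz Qz r1 r2 !subrr; ring.
have [y w] := weq_ex W (z - h).
have Dz : D.[z - h] = 0 by rewrite Dx subrK Pz mulr0.
by have := D_simple w Dz; rewrite D'x subrK P'z mulr0 eqxx.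
Qed.

Let size_Xh a : size (Xh - a%:P) = 2%N.
Proof. by rewrite /Xh -addrA -polyCN -polyCD size_XaddC. Qed.

Let size_Q : size Q = 3%N.
Proof. by rewrite /Q size_mul ?size_Xh // -size_poly_eq0 size_Xh. Qed.

Let Q0 : Q != 0. Proof. by rewrite -size_poly_eq0 size_Q. Qed.

Let size_Q2 : size (Q ^+ 2) = 5%N.
Proof. by rewrite expr2 size_mul // size_Q. Qed.

Let size_D : size D = 4%N.
Proof.
rewrite /D size_polyDl size_scale // size_polyXn //.
do 2!rewrite (leq_ltn_trans (size_polyD _ _)) // gtn_max
  (leq_ltn_trans (size_scale_leq _ _)) ?size_polyXn ?size_polyX //=.
by rewrite (leq_ltn_trans (size_polyC_leq1 _)).
Qed.

Let D0 : D != 0. Proof. by rewrite -size_poly_eq0 size_D. Qed.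

Let R0 : R != 0.
Proof.
apply/eqP => e; have := congr1 (fun p : {poly k} => p^`()^`().[0]) e.
rewrite /R /Xh !derivE !hE => /eqP; rewrite (_ : _ + _ = 2); last by ring.
by rewrite (negPf two0).
Qed.

Let jacobian : (Q ^+ 2)^`() * D - Q ^+ 2 * D^`() = Q * (4 *: R ^+ 2).
Proof.
rewrite -square_identity expr2 derivM scaler_nat.
by ring.
Qed.

(** The orders of the zeros of the Jacobian Q (4 R^2) determine those of
    Q^2 - Q(x)^2 / D(x) D off the zeros of Q: they are one less, hence even. *)
Let fiber_order x : D.[x] != 0 -> exists e c,
  [/\ D.[x] *: Q ^+ 2 - (Q ^+ 2).[x] *: D = ('X - x%:P) ^+ e * c, c.[x] != 0 &
      (0 ^+ 2 + 4 * ((Q ^+ 2).[x] / D.[x]) = 0 /\ e = 2%N) \/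
      (0 ^+ 2 + 4 * ((Q ^+ 2).[x] / D.[x]) != 0 /\ (e = 1 \/ e = 3)%N)].
Proof.
move=> Dnz; case: (eqVneq Q.[x] 0) => Qnz.
  have Qz : (x + h - n) * (x + h - m) = 0 by rewrite -Qx.
  have /factor_theorem [q1 eq1] : root Q x by apply/eqP.
  have q1x : q1.[x] != 0.
    have := Q'x x; rewrite eq1 derivM derivXsubC !(hornerD, hornerM, hornerN, hornerX, hornerC).
    rewrite subrr mulr0 add0r mulr1 => ->.
    have : (x + h == n) || (x + h == m).
      by rewrite -(subr_eq0 _ n) -(subr_eq0 _ m) -mulf_eq0 Qz.
    case/orP => /eqP ->; first by rewrite subrr add0r subr_eq0.
    by rewrite subrr addr0 subr_eq0 eq_sym.
  exists 2%N, (D.[x] *: q1 ^+ 2); split.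
  - rewrite horner_exp Qnz expr0n /= scale0r subr0 {1}eq1 exprMn.
    by rewrite -scalerAr mulrC.
  - by rewrite hornerZ horner_exp mulf_neq0 ?expf_neq0.
  - by left; rewrite horner_exp Qnz !expr0n /= mul0r mulr0 addr0.
have alt : 0 ^+ 2 + 4 * ((Q ^+ 2).[x] / D.[x]) != 0.
  by rewrite expr0n add0r horner_exp !mulf_neq0 ?invr_eq0 ?expf_neq0.
set T := D.[x] *: Q ^+ 2 - (Q ^+ 2).[x] *: D.
have sT : size T = 5%N.
  rewrite /T size_polyDl size_scale ?size_Q2 // size_polyN.
  by rewrite (leq_ltn_trans (size_scale_leq _ _)) ?size_D.
have T0 : T != 0 by rewrite -size_poly_eq0 sT.
have [e [c cx eT]] := multiplicity_XsubC T x; rewrite T0 /= mulrC in cx eT.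
have [i [r rx eR]] := multiplicity_XsubC R x; rewrite R0 /= mulrC in rx eR.
have cnz : c != 0 by apply: contraNneq cx => ->; rewrite root0.
have e4 : (e <= 4)%N.
  have := sT; rewrite eT size_mul ?expf_neq0 ?polyXsubC_eq0 // size_exp_XsubC.
  by move: cnz; rewrite -size_poly_gt0; move: (size c); clear; lia.
have Tx : T.[x] = 0 by rewrite /T hornerD hornerN !hornerZ mulrC subrr.
case: e => [|e] in eT e4 *.
  by move: cx; rewrite /root -[c]mul1r -[1](expr0 ('X - x%:P)) -eT Tx eqxx.
have jac : T^`() * D - T * D^`() = D.[x] *: (Q * (4 *: R ^+ 2)).
  rewrite -jacobian /T derivB !derivZ -!mul_polyC; ring.
have jac2 : T^`() * D - T * D^`() = ('X - x%:P) ^+ e *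
    ((e.+1)%:R *: (c * D) + ('X - x%:P) * (c^`() * D - c * D^`())).
  rewrite eT derivM deriv_exp derivXsubC mul1r -mulr_natl -mul_polyC rmorph_nat.
  by rewrite exprS /=; ring.
have e1 : (e.+1)%:R != 0 :> k.
  move: e4; case: (e) => [|[|[|[|//]]]] _; first exact: oner_neq0.
  - exact: two0.
  - exact: three0.
  - exact: four0.
have := @root_power_uniq k x
  ((e.+1)%:R *: (c * D) + ('X - x%:P) * (c^`() * D - c * D^`()))
  (D.[x] *: (Q * (4 *: r ^+ 2))) e (2 * i).
rewrite -jac2 jac hornerD (hornerM ('X - _)) hornerXsubC subrr mul0r addr0 !hornerZ.
rewrite (hornerM c) (hornerM Q) hornerZ horner_exp !mulf_neq0 ?expf_neq0 //.
have eRR : D.[x] *: (Q * (4 *: R ^+ 2)) =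
    ('X - x%:P) ^+ (2 * i) * (D.[x] *: (Q * (4 *: r ^+ 2))).
  rewrite eR exprMn -exprM (mulnC i) -!mul_polyC; ring.
move/(_ isT isT eRR) => e2; exists e.+1, c; split=> //.
by right; split=> //; move: e4; rewrite e2 mul2n; case: (i) => [|[|?]] // _; [left|right].
Qed.

Let f (P : projsp k 2) := Q.[xcoord P] / w_y W (xcoord P) (ycoord P).

Let f_reg : exists P, regular_at X P f.
Proof.
have /closed_nonrootP [x Dnz] := D0; have [y w] := weq_ex W x.
exists (affine_pt x y); apply: reg_div.
- by apply: reg_horner; exact: xcoord_reg.
- have rc c : regular_at X (affine_pt x y) (fun=> c) by apply: reg_cst; exact: affine_pt_in.
  apply: reg_add => //; apply: reg_add; apply: reg_mul => //.
    exact: ycoord_reg.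
  exact: xcoord_reg.
by rewrite xcoord_pt ycoord_pt -sqrf_eq0 D_wy.
Qed.

Lemma odd_covering : triple_covering W (rational_map X f).
Proof.
have hM x : D.[x] = 0 -> (Q ^+ 2).[x] != 0.
  move=> Dz; rewrite horner_exp expf_neq0 // Qx.
  apply: contra_eq_neq Dz => Qz; rewrite Dx mulf_neq0 //; exact: P_root_neq0.
have hP x y : weq W x y -> D.[x] = 0 ->
    (w_y W x y = 0 /\ exists2 c, D = ('X - x%:P) * c & c.[x] != 0) \/
    (w_y W x y != 0 /\ exists2 c, D = ('X - x%:P) ^+ 2 * c & c.[x] != 0).
  move=> w Dz; left; split.
    by apply/eqP; rewrite -sqrf_eq0 D_wy // Dz.
  have /factor_theorem [c ec] : root D x by apply/eqP.
  exists c; first by rewrite mulrC.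
  have := D_simple w Dz; rewrite ec derivM derivXsubC !(hornerD, hornerM, hornerN, hornerX, hornerC).
  by rewrite subrr mulr0 add0r mulr1.
have hU x y : weq W x y -> D.[x] != 0 -> w_y W x y != 0.
  by move=> w; rewrite -(D_wy w) sqrf_eq0.
have hN : (Q ^+ 2)^`() * D - Q ^+ 2 * D^`() != 0.
  by rewrite jacobian mulf_neq0 // scaler_eq0 negb_or four0 expf_neq0.
have hE' : gen X (fun P => f P ^+ 2 - 0 * f P = (Q ^+ 2).[xcoord P] / D.[xcoord P]).
  apply: (gen_map2 (@wcurve_irr k W) _ (gen_poly W D0)
    (near_gen (near_all (origin_in W) (fun P XP => XP)))).
  move=> P _ [zP DP] XP; have w := wcurve_affine XP zP.
  by rewrite mul0r subr0 horner_exp -(D_wy w) /f expr_div_n.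
split.
- exact: (quadratic_finite smoothW size_Q2 size_D hM hP hU hN f_reg hE').
- exact: (quadratic_generically_etale smoothW size_D hU fiber_order hN f_reg hE').
- exact: (quadratic_only_triple smoothW size_Q2 size_D hM hP hU fiber_order f_reg hE').
Qed.

End Covering.

Lemma triple_covering_odd : exists h, triple_covering W h.
Proof.
have [n [m [q [r1 r2 r3]]]] := covering_parameters.
by eexists; exact: (odd_covering r1 r2 r3).
Qed.

End OddCharacteristic.

(** * The covering in characteristic 2 *)

Section EvenCharacteristic.
Variables (k : closedFieldType) (W : weierstrass k).
Hypothesis smoothW : wdisc W != 0.
Hypothesis two0 : (2 : k) = 0.
Hypothesis c4_0 : wc4 W != 0.
Let X := wcurve W.
Let a := wa1 W.
Let r := wa3 W / a.

(** Identities in characteristic 2 are proved by exhibiting half of the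
    difference of their sides. *)
Let char2 (z x y : k) : x = y + 2 * z -> x = y.
Proof. by rewrite two0 mul0r addr0. Qed.

Let a0 : a != 0.
Proof.
apply: contraNneq c4_0 => e; rewrite /wc4 /wb2 /wb4 -/a e.
apply/eqP/(char2 (z := 8 * wa2 W ^+ 2 - 24 * wa4 W)); by ring.
Qed.

Let a3E : wa3 W = a * r.
Proof. by rewrite /r mulrC divfK. Qed.

(** The translation x - r removes the term in y; then l and mu are chosen to
    remove those in x^2 and 1. The remaining linear coefficient is the square of
    rho, which is nonzero because the curve is smooth. *)
Lemma even_normal_form : exists l mu beta,
  let rho := beta ^+ 2 + a * beta in
  rho != 0 /\ forall x y, weq W x y ->
    (y + l * x + mu) ^+ 2 + a * (x - r) * (y + l * x + mu) =
    (x - r) ^+ 3 + rho ^+ 2 * (x - r).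
Proof.
have [l hl] := quadratic_root a (r + wa2 W).
have [mu hmu] := quadratic_root 0
  (r ^+ 3 + wa2 W * r ^+ 2 + wa4 W * r + wa6 W + l ^+ 2 * r ^+ 2).
rewrite mul0r addr0 in hmu.
pose K := 3 * r ^+ 2 + wa4 W + a * (l * r + mu).
have normal x y : weq W x y ->
    (y + l * x + mu) ^+ 2 + a * (x - r) * (y + l * x + mu) =
    (x - r) ^+ 3 + K * (x - r).
  rewrite /weq -/a a3E => w.
  apply: (char2 (z := l * x * y + mu * y + l * mu * x - a * r * y - a * l * r * x +
    2 * r * x ^+ 2 - 3 * r ^+ 2 * x + 3 * r ^+ 3 + wa4 W * r + wa2 W * x ^+ 2 +
    wa6 W + wa2 W * r ^+ 2)).
  apply/eqP; rewrite -subr_eq0; apply/eqP.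
  transitivity (((y ^+ 2 + a * x * y + a * r * y) -
     (x ^+ 3 + wa2 W * x ^+ 2 + wa4 W * x + wa6 W)) +
    (x ^+ 2 + r ^+ 2) * ((l ^+ 2 + a * l) - (r + wa2 W)) +
    (mu ^+ 2 - (r ^+ 3 + wa2 W * r ^+ 2 + wa4 W * r + wa6 W + l ^+ 2 * r ^+ 2))).
    by rewrite /K; ring.
  by rewrite w hl hmu !subrr mulr0 !addr0.
have [rho] := quadratic_root 0 K; rewrite mul0r addr0 => hrho.
have [beta hbeta] := quadratic_root a rho.
exists l, mu, beta; rewrite /= hbeta hrho; split; last exact: normal.
apply: contraTneq isT => rho0; have [y w] := weq_ex W r.
have K0 : K = 0 by rewrite -hrho rho0 expr0n.
have y0 : y + l * r + mu = 0.
  have := normal _ _ w; rewrite subrr K0 expr0n !mulr0 mul0r !addr0 => /eqP.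
  by rewrite sqrf_eq0 => /eqP.
have wy : w_y W r y = 0.
  by rewrite /w_y -/a a3E; apply: (char2 (z := y + a * r)); ring.
have /eqP := smooth_point smoothW w wy; case.
rewrite /w_x -/a; apply: (char2 (z := - wa2 W * r)).
transitivity (a * (y + l * r + mu) - K - 2 * wa2 W * r); first by rewrite /K; ring.
by rewrite y0 K0; ring.
Qed.

Section NormalForm.
Variables l mu beta : k.
Let rho := beta ^+ 2 + a * beta.
Hypothesis rho0 : rho != 0.
Hypothesis normal : forall x y, weq W x y ->
  (y + l * x + mu) ^+ 2 + a * (x - r) * (y + l * x + mu) =
  (x - r) ^+ 3 + rho ^+ 2 * (x - r).

Let e := a * beta.
Let L : {poly k} := 'X - r%:P.
Let D : {poly k} := a ^+ 2 *: (L * (L + rho%:P) ^+ 2).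
Let M : {poly k} := L ^+ 4 + (e ^+ 2 *: L ^+ 2 + (e ^+ 3 *: L + (rho ^+ 4)%:P)).
Let hE := (hornerD, hornerN, hornerM, hornerZ, hornerXn, hornerX, hornerC, horner_exp).

Let beta0 : beta != 0.
Proof. by apply: contraNneq rho0 => b0; rewrite /rho b0 expr0n mulr0 addr0. Qed.
Let e0 : e != 0. Proof. exact: mulf_neq0. Qed.

Let Lx x : L.[x] = x - r. Proof. exact: hornerXsubC. Qed.
Let Dx x : D.[x] = a ^+ 2 * ((x - r) * (x - r + rho) ^+ 2).
Proof. by rewrite /D /L !hE. Qed.
Let Mx x : M.[x] = (x - r) ^+ 4 + e ^+ 2 * (x - r) ^+ 2 + e ^+ 3 * (x - r) + rho ^+ 4.
Proof. by rewrite /M /L !hE !addrA. Qed.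

Let size_Lc c : size (L + c%:P) = 2%N.
Proof. by rewrite /L -addrA -polyCN -polyCD size_XaddC. Qed.
Let size_L : size L = 2%N. Proof. exact: size_XsubC. Qed.
Let L0 : L != 0. Proof. by rewrite -size_poly_eq0 size_L. Qed.
Let Lc0 c : L + c%:P != 0. Proof. by rewrite -size_poly_eq0 size_Lc. Qed.

Let size_D : size D = 4%N.
Proof.
rewrite /D size_scale ?expf_neq0 // expr2 !size_mul ?mulf_neq0 // ?Lc0 //.
by rewrite size_L !size_Lc.
Qed.

Let size_M : size M = 5%N.
Proof.
have s4 : size (L ^+ 4) = 5%N by rewrite /L size_exp_XsubC.
rewrite /M size_polyDl s4 //.
do 2!rewrite (leq_ltn_trans (size_polyD _ _)) // gtn_max
  (leq_ltn_trans (size_scale_leq _ _)) ?size_exp_XsubC ?size_XsubC //=.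
by rewrite (leq_ltn_trans (size_polyC_leq1 _)).
Qed.

Let D0 : D != 0. Proof. by rewrite -size_poly_eq0 size_D. Qed.

Let w_yE x y : w_y W x y = a * (x - r).
Proof.
rewrite /w_y -/a a3E; apply: (char2 (z := y + a * r)); by ring.
Qed.

Let D_nonroot x : D.[x] != 0 -> x - r != 0 /\ x - r + rho != 0.
Proof.
rewrite Dx => nz; split; apply: contraNneq nz => ->.
  by rewrite mul0r mulr0.
by rewrite expr0n !mulr0.
Qed.

Let D_roots x : D.[x] = 0 -> x = r \/ x = r - rho.
Proof.
rewrite Dx => /eqP; rewrite mulf_eq0 sqrf_eq0 (negPf a0) /= mulf_eq0 sqrf_eq0.
case/orP => /eqP h; [left | right].
  by apply/eqP; rewrite -subr_eq0 h.
by apply/eqP; rewrite -subr_eq0 opprB addrA addrAC h.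
Qed.

Let coprimeMD x : D.[x] = 0 -> M.[x] != 0.
Proof.
case/D_roots => ->; rewrite Mx.
  by rewrite subrr !expr0n !mulr0 !add0r expf_neq0.
have -> : (r - rho - r) ^+ 4 + e ^+ 2 * (r - rho - r) ^+ 2 + e ^+ 3 * (r - rho - r) +
    rho ^+ 4 = e ^+ 2 * rho * beta ^+ 2.
  apply: (char2 (z := rho ^+ 4)); rewrite /rho /e; ring.
by rewrite !mulf_neq0 ?expf_neq0.
Qed.

Let poles_D x y : weq W x y -> D.[x] = 0 ->
  (w_y W x y = 0 /\ exists2 c, D = ('X - x%:P) * c & c.[x] != 0) \/
  (w_y W x y != 0 /\ exists2 c, D = ('X - x%:P) ^+ 2 * c & c.[x] != 0).
Proof.
move=> w /D_roots [] ex; rewrite w_yE ex; [left | right].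
  split; first by rewrite subrr mulr0.
  exists (a ^+ 2 *: (L + rho%:P) ^+ 2); first by rewrite -scalerAr.
  by rewrite !hE subrr add0r mulf_neq0 ?mulf_neq0 ?expf_neq0.
split; first by rewrite addrAC subrr sub0r mulf_neq0 // oppr_eq0.
have eL : 'X - (r - rho)%:P = L + rho%:P by rewrite /L polyCB opprB addrA addrAC.
exists (a ^+ 2 *: L); first by rewrite eL /D -scalerAr mulrC.
by rewrite !hE addrAC subrr sub0r mulf_neq0 ?expf_neq0 // oppr_eq0.
Qed.

Let unramified_D x y : weq W x y -> D.[x] != 0 -> w_y W x y != 0.
Proof.
by move=> _ /D_nonroot [nx _]; rewrite w_yE mulf_neq0.
Qed.

(** The derivative is a square, with roots x = r - rho and those of a quadratic
    factor: the first is a pole, the others carry the triple points. *)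
Let jacobianE x : (M^`() * D - M * D^`()).[x] =
  a ^+ 2 * ((x - r + rho) * ((x - r) ^+ 2 + e * (x - r) + rho ^+ 2)) ^+ 2.
Proof.
have M'x : M^`().[x] = 4 * (x - r) ^+ 3 + 2 * e ^+ 2 * (x - r) + e ^+ 3.
  by rewrite /M /L !derivE !hE; ring.
have D'x : D^`().[x] = a ^+ 2 * ((x - r + rho) ^+ 2 + 2 * (x - r) * (x - r + rho)).
  by rewrite /D /L !derivE !hE; ring.
rewrite hornerD hornerN (hornerM M^`()) (hornerM M) M'x D'x Mx Dx.
move: (x - r) => z; clearbody e rho.
apply: (char2 (z := a ^+ 2 * (z ^+ 5 * rho - z ^+ 4 * e ^+ 2 - z ^+ 3 * e ^+ 3 -
  z ^+ 2 * e ^+ 3 * rho - 3 * z ^+ 2 * rho ^+ 4 - 3 * z * rho ^+ 5 - rho ^+ 6 -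
  z ^+ 5 * e - 2 * z ^+ 4 * e * rho - 2 * z ^+ 3 * rho ^+ 3 -
  2 * z ^+ 3 * e * rho ^+ 2 - z ^+ 3 * e ^+ 2 * rho - 2 * z ^+ 2 * e * rho ^+ 3 -
  z * e * rho ^+ 4))).
by ring.
Qed.

Let jacobianN : M^`() * D - M * D^`() != 0.
Proof.
pose p : {poly k} := ('X + rho%:P) * ('X^2 + (e *: 'X + (rho ^+ 2)%:P)).
have p0 : p != 0.
  rewrite mulf_neq0 // -size_poly_eq0; first by rewrite size_XaddC.
  rewrite size_polyDl size_polyXn // (leq_ltn_trans (size_polyD _ _)) // gtn_max.
  rewrite (leq_ltn_trans (size_scale_leq _ _)) ?size_polyX //=.
  by rewrite (leq_ltn_trans (size_polyC_leq1 _)).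
have /closed_nonrootP [u pu] := p0.
apply: contraNneq pu => J0; have := jacobianE (u + r); rewrite J0 horner0 addrK.
move/esym/eqP; rewrite mulf_eq0 sqrf_eq0 (negPf a0) sqrf_eq0 /=.
by rewrite /root /p !hE !addrA.
Qed.

Let fiber_order x : D.[x] != 0 -> exists m c,
  [/\ D.[x] *: M - M.[x] *: D = ('X - x%:P) ^+ m * c, c.[x] != 0 &
      (1 ^+ 2 + 4 * (M.[x] / D.[x]) = 0 /\ m = 2%N) \/
      (1 ^+ 2 + 4 * (M.[x] / D.[x]) != 0 /\ (m = 1 \/ m = 3)%N)].
Proof.
move=> Dnz.
have alt : 1 ^+ 2 + 4 * (M.[x] / D.[x]) != 0.
  have -> : 1 ^+ 2 + 4 * (M.[x] / D.[x]) = 1.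
    by apply: (char2 (z := 2 * (M.[x] / D.[x]))); ring.
  exact: oner_neq0.
set T := D.[x] *: M - M.[x] *: D; set u := x - r.
have Tz z : T.[z] = D.[x] * M.[z] - M.[x] * D.[z].
  by rewrite hornerD hornerN (hornerZ D.[x] M) (hornerZ M.[x] D).
(* At a root u of the quadratic factor, the value of M / D is taken three times;
   the constant g comes from comparing the coefficients of the cube. *)
case: (eqVneq (u ^+ 2 + e * u + rho ^+ 2) 0) => [qu|qu].
  have u0 : u != 0.
    by have [] := D_nonroot Dnz.
  pose g := e ^+ 2 / u.
  have gu : g * u = e ^+ 2 by rewrite divfK.
  have identity z : M.[z] - g / a ^+ 2 * D.[z] = (z - x) ^+ 3 * (z - r + (u + g)).
    rewrite Mx Dx; have -> : z - x = (z - r) - u by rewrite /u; ring.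
    move: (z - r) => w; have aa : a ^+ 2 != 0 by rewrite expf_neq0.
    rewrite (mulrA (g / a ^+ 2)) divfK //.
    move: gu qu; clearbody g u e rho => gu qu.
    apply: (char2 (z := w ^+ 2 * e ^+ 2 + w * e ^+ 3 - g * w ^+ 3 - g * w ^+ 2 * rho -
      g * w * rho ^+ 2 + w ^+ 3 * u + g * w ^+ 2 * u - w * u ^+ 3 -
      2 * g * w * u ^+ 2 + u ^+ 4 - g * w * e * u + e ^+ 2 * u ^+ 2 + e * u ^+ 3)).
    apply/eqP; rewrite -subr_eq0; apply/eqP.
    transitivity ((w ^+ 2 + e * w + u ^+ 2) * (g * u - e ^+ 2) +
      (g * w + rho ^+ 2 - u ^+ 2 - e * u) * (u ^+ 2 + e * u + rho ^+ 2)).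
      by ring.
    by rewrite gu qu subrr !mulr0 addr0.
  have gx : M.[x] = g / a ^+ 2 * D.[x].
    by have := identity x; rewrite subrr expr0n mul0r => /eqP; rewrite subr_eq0 => /eqP.
  exists 3%N, (D.[x] *: (L + (u + g)%:P)); split.
  - apply/eqP; rewrite -subr_eq0; apply/eqP; apply: poly_all_roots => z.
    rewrite hornerD Tz gx hornerN (hornerM (_ ^+ 3)) (hornerZ D.[x] (L + _)).
    rewrite horner_exp hornerXsubC (hornerD L) Lx hornerC.
    transitivity (D.[x] * ((M.[z] - g / a ^+ 2 * D.[z]) -
      (z - x) ^+ 3 * (z - r + (u + g)))); first by ring.
    by rewrite identity subrr mulr0.
  - rewrite (hornerZ D.[x] (L + _)) (hornerD L) Lx hornerC mulf_neq0 //.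
    have -> : x - r + (u + g) = g by apply: (char2 (z := u)); rewrite -/u; ring.
    by rewrite mulf_neq0 ?expf_neq0 ?invr_eq0.
  - by right; split=> //; right.
have Tx : root T x by rewrite /root Tz mulrC subrr.
have [c eT] := factor_theorem _ _ Tx.
exists 1%N, c; split; first by rewrite expr1 mulrC.
  have T'x : T^`().[x] = (M^`() * D - M * D^`()).[x].
    have hB (p q : {poly k}) z : (p - q).[z] = p.[z] - q.[z] by rewrite hornerD hornerN.
    rewrite derivB (derivZ D.[x] M) (derivZ M.[x] D) !hB.
    rewrite (hornerZ D.[x] M^`()) (hornerZ M.[x] D^`()).
    by rewrite (hornerM M^`()) (hornerM M) mulrC.
  move: T'x; rewrite jacobianE -/u.
  rewrite eT derivM derivXsubC hornerD !hornerM hornerXsubC subrr mulr0 add0r hornerC mulr1.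
  have [_ ur] := D_nonroot Dnz.
  by move=> ->; rewrite !mulf_neq0 ?expf_neq0 ?mulf_neq0.
by right; split=> //; left.
Qed.

Let f (P : projsp k 2) :=
  (ycoord P + l * xcoord P + mu) / (a * (xcoord P - r)) +
  beta ^+ 2 / (xcoord P - r + rho).

Let f_reg : exists P, regular_at X P f.
Proof.
have /closed_nonrootP [x Dnz] := D0; have [y w] := weq_ex W x.
have rx := xcoord_reg w; have ry := ycoord_reg w.
have rc c : regular_at X (affine_pt x y) (fun=> c) by apply: reg_cst; exact: affine_pt_in.
have [nx nx'] := D_nonroot Dnz; exists (affine_pt x y); apply: reg_add.
- apply: reg_div.
  + by apply: reg_add => //; apply: reg_add => //; apply: reg_mul.
  + by apply: reg_mul => //; apply: reg_sub.
  + by rewrite xcoord_pt mulf_neq0.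
- apply: reg_div => //; last by rewrite xcoord_pt.
  by apply: reg_add => //; apply: reg_sub.
Qed.

Lemma even_covering : triple_covering W (rational_map X f).
Proof.
have hE' : gen X (fun P => f P ^+ 2 - 1 * f P = M.[xcoord P] / D.[xcoord P]).
  apply: (gen_map2 (@wcurve_irr k W) _ (gen_poly W D0)
    (near_gen (near_all (origin_in W) (fun P XP => XP)))).
  move=> P _ [zP DP] XP; have w := normal (wcurve_affine XP zP).
  have [nx nx'] := D_nonroot DP.
  apply: (mulIf DP); rewrite divfK // Mx Dx /f {DP}; move: nx nx' w.
  move: (ycoord P + l * xcoord P + mu) (xcoord P - r) => y x nx nx' w.
  apply: (mulfI nx).
  transitivity ((y * (x + rho) + a * beta ^+ 2 * x) ^+ 2 -
    a * x * (x + rho) * (y * (x + rho) + a * beta ^+ 2 * x)).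
    by field; rewrite nx nx' a0.
  apply: (char2 (z := - x ^+ 3 * y * a - 2 * x ^+ 2 * y * a ^+ 2 * beta -
    x * y * a ^+ 3 * beta ^+ 2 + x ^+ 3 * beta ^+ 4 + 2 * x ^+ 3 * a * beta ^+ 3 -
    x ^+ 2 * y * a * beta ^+ 2 + x ^+ 4 * beta ^+ 2 + x ^+ 2 * beta ^+ 6 +
    3 * x ^+ 2 * a * beta ^+ 5 + 3 * x ^+ 2 * a ^+ 2 * beta ^+ 4 +
    x ^+ 4 * a * beta - x * y * a ^+ 2 * beta ^+ 3)).
  apply/eqP; rewrite -subr_eq0; apply/eqP.
  transitivity ((x + rho) ^+ 2 * ((y ^+ 2 + a * x * y) - (x ^+ 3 + rho ^+ 2 * x))).
    by rewrite /rho /e; ring.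
  by rewrite w subrr mulr0.
split.
- exact: (quadratic_finite smoothW size_M size_D coprimeMD poles_D unramified_D
    jacobianN f_reg hE').
- exact: (quadratic_generically_etale smoothW size_D unramified_D fiber_order
    jacobianN f_reg hE').
- exact: (quadratic_only_triple smoothW size_M size_D coprimeMD poles_D
    unramified_D fiber_order f_reg hE').
Qed.

End NormalForm.

Lemma triple_covering_even : exists h, triple_covering W h.
Proof.
have [l [mu [beta [rho0 normal]]]] := even_normal_form.
by eexists; exact: (even_covering rho0 normal).
Qed.

End EvenCharacteristic.

Theorem corollary5p3 (k : closedFieldType) (char_k : 3%N \notin [pchar k]%R) :
  exists bad : seq k, forall j : k, j \notin bad ->
    forall E : elliptic_curve k, j_invariant E = j ->
      exists h : projsp k 2 -> projsp k 1,
        [/\ finite_morphism (ec_curve E) (proj_line k) h,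
            generically_etale (ec_curve E) (proj_line k) h &
            only_triple_ramification (ec_curve E) (proj_line k) h].
Proof.
(* The value 0 is where c4 vanishes; there n = m in the first construction, and
   the curve is supersingular in the second. *)
exists [:: 0] => j; rewrite inE => j0 E jE.
have c4_0 : wc4 (ec_eqn E) != 0.
  apply: contraNneq j0 => c0; rewrite -jE /j_invariant c0 expr0n mul0r //.
have three0 : (3 : k) != 0 by apply: contra char_k => e; rewrite inE /= e.
case: (eqVneq (2 : k) 0) => two0.
  exact: (triple_covering_even (ec_smooth E) two0 c4_0).
exact: (triple_covering_odd (ec_smooth E) two0 three0 c4_0).
Qed.
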